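(* Let $E$ be a compact Polish space and let $\{A(t)\}_{t\ge0}$ be a set of bounded operators on $C(E)$. Suppose that $t\mapsto A(t)$ is continuous in the uniform (operator) norm topology and that each $A(t)$ generates a strongly continuous, positive, contraction semigroup on $C(E)$. Then the Cauchy problem $$\frac{\partial u}{\partial t}(x,t)=A(t)u(x,t),\qquad u(x,s)=u_s(x)\in C(E)$$ is well-posed, and its evolution family $U(t,s)$ generates a strong Markov process (in fact a Hunt process): for every $T>0$ there is such a process $(X(t))_{t\in[0,T]}$ with $$[U(t,s)f](x)=\mathbb{E}_{t,x}[f(X(s))]\qquad\text{for all } f\in C(E),\ x\in E,\ 0\le s\le t\le T.$$
   Context: $C(E)$ is the Banach space of complex-valued continuous functions on $E$ with the supremum norm. A (strict) solution with initial time $s$ is $u\in C^1([s,\infty),C(E))$ with $u(s)=u_s$ and $\frac{\partial u}{\partial t}=A(t)u$ for $t\ge s$. An evolution family for the problem is a family $(U(t,s))_{t\ge s\geq 0}$ of linear operators such that: $U(t,r)U(r,s)=U(t,s)$ and $U(t,t)=\mathrm{id}$; $(s,t)\mapsto U(t,s)$ is strongly continuous; $\|U(t,s)\|\le Me^{\omega(t-s)}$ for some $M\ge1$, $\omega\in\mathbb{R}$; and for each $s$ the space of $y$ for which $t\mapsto U(t,s)y$ is the (unique) solution with initial value $y$ at time $s$ is dense. The problem is well-posed if such a solving evolution family exists. Convention on time: in $U(t,s)$ the first argument $t\ge s$ plays the role of the starting time, so $\mathbb{P}_{t,x}$ is the law of the process located at $x$ at time $t$, and the process is observed at times $s\le t$;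 that is, with $Y(r)=X(T-r)$, $r\in[0,T]$, $Y$ is a time-inhomogeneous process in the usual increasing time direction, starting from $x$ at time $T-t$ under $\mathbb{P}_{t,x}$. Being Markov means $\mathbb{E}_{t,x}[f(X(s))\mid\mathcal{F}]=\mathbb{E}_{r,X(r)}[f(X(s))]$ almost surely for bounded Borel $f$ and $s\le r\le t$, where $\mathcal{F}=\sigma(X(q): r\le q\le t)$. A Hunt process is a strong Markov process such that $Y$ has right-continuous paths with left limits and is quasi-left-continuous. The transition function may be sub-probability; in that case the process lives on $E$ with an added cemetery point at which functions $f$ are set to $0$. *)

(* Defs.v *)
From HB Require Import structures.
From mathcomp Require Import all_boot all_order all_algebra.
From mathcomp Require Import all_classical all_reals all_analysis.
From mathcomp Require Import complex.

Set Implicit Arguments.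
Unset Strict Implicit.
Unset Printing Implicit Defensive.

Import Order.TTheory GRing.Theory Num.Theory.
Import numFieldNormedType.Exports.

Local Open Scope classical_set_scope.
Local Open Scope ring_scope.
Local Open Scope complex_scope.

HB.mixin Record isCompactSpace E & Topological E := {
  compact_setT : compact [set: E]
}.

#[short(type="compactSpaceType")]
HB.structure Definition CompactSpace := {E of Topological E & isCompactSpace E}.

Definition separable (T : topologicalType) : Prop :=
  exists2 D : set T, countable D & dense D.

Definition completely_metrizable (R : realType) (T : topologicalType) : Prop :=
  exists dist : T -> T -> R,
    [/\ [/\ forall x y, 0 <= dist x y,
            forall x y, dist x y = 0 <-> x = y,
            forall x y, dist x y = dist y x &
            forall x y z, dist x z <= dist x y + dist y z],
        forall x : T, nbhs x =
          filter_from [set e : R | 0 < e] (fun e => [set y | dist x y < e]) &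
        forall u : nat -> T,
          (forall e : R, 0 < e -> exists N : nat, forall m n : nat,
            (N <= m)%N -> (N <= n)%N -> dist (u m) (u n) < e) ->
          exists x : T, u n @[n --> \oo] --> x].

Definition polish (R : realType) (T : topologicalType) : Prop :=
  separable T /\ completely_metrizable R T.

Definition cfun (R : realType) (E : compactSpaceType) : Type :=
  continuousType E (R[i]^o).

Definition cfun_fun (R : realType) (E : compactSpaceType) (f : cfun R E) :
  E -> R[i]^o := (f : continuousType E (R[i]^o)).
Coercion cfun_fun : cfun >-> Funclass.

Section CfunSpace.
Context {R : realType} {E : compactSpaceType}.
Local Notation C := (cfun R E).
Implicit Types f g h : C.

(* The supremum of a bounded set, E being compact; 0 when E is empty. *)
Definition supnorm f : R := sup [set complex.Re `|f x| | x in [set: E]].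

HB.instance Definition _ := Choice.copy C (continuousType E (R[i]^o)).

Lemma cfun_continuous f : continuous (f : E -> R[i]^o).
Proof. exact: (@cts_fun _ _ (f : continuousType E R[i]^o)). Qed.

Lemma cfun_cvg f (x : E) : (f : E -> R[i]^o) y @[y --> x] --> f x.
Proof. exact: cfun_continuous. Qed.

Definition cfun_of (f : E -> R[i]^o) (fC : continuous f) :
    C := (mkcts fC : continuousType E (R[i]^o)).

Lemma cfunP f g : (forall x, f x = g x) -> f = g.
Proof. by move=> fg; apply/continuousEP => x; exact: fg. Qed.

Definition cfun_zero : C := cfun_of (@cst_continuous E (R[i]^o) 0).

Lemma cfun_opp_subproof f : continuous (fun x => - f x : R[i]^o).
Proof. by move=> x; apply: cvgN; exact: cfun_cvg. Qed.
Definition cfun_opp f : C := cfun_of (@cfun_opp_subproof f).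

Lemma cfun_add_subproof f g : continuous (fun x => f x + g x : R[i]^o).
Proof. by move=> x; apply: cvgD; exact: cfun_cvg. Qed.
Definition cfun_add f g : C := cfun_of (@cfun_add_subproof f g).

Lemma cfun_scale_subproof (a : R[i]) f :
  continuous (fun x => a *: f x : R[i]^o).
Proof. by move=> x; apply: cvgZr; exact: cfun_cvg. Qed.
Definition cfun_scale (a : R[i]) f : C := cfun_of (@cfun_scale_subproof a f).

Lemma cfun_addA : associative cfun_add.
Proof. by move=> f g h; apply: cfunP => x; exact: addrA. Qed.
Lemma cfun_addC : commutative cfun_add.
Proof. by move=> f g; apply: cfunP => x; exact: addrC. Qed.
Lemma cfun_add0 : left_id cfun_zero cfun_add.
Proof. by move=> f; apply: cfunP => x; exact: add0r. Qed.
Lemma cfun_addN : left_inverse cfun_zero cfun_opp cfun_add.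
Proof. by move=> f; apply: cfunP => x; exact: addNr. Qed.

HB.instance Definition _ :=
  GRing.isZmodule.Build C cfun_addA cfun_addC cfun_add0 cfun_addN.

Lemma cfun_scaleA (a b : R[i]) f :
  cfun_scale a (cfun_scale b f) = cfun_scale (a * b) f.
Proof. by apply: cfunP => x; exact: scalerA. Qed.
Lemma cfun_scale1 : left_id (1 : R[i]) cfun_scale.
Proof. by move=> f; apply: cfunP => x; exact: scale1r. Qed.
Lemma cfun_scaleDr : right_distributive cfun_scale +%R.
Proof. by move=> a f g; apply: cfunP => x; exact: scalerDr. Qed.
Lemma cfun_scaleDl f : {morph cfun_scale^~ f : a b / a + b}.
Proof. by move=> a b; apply: cfunP => x; exact: scalerDl. Qed.

HB.instance Definition _ := GRing.Zmodule_isLmodule.Build R[i] C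
  cfun_scaleA cfun_scale1 cfun_scaleDr cfun_scaleDl.

Lemma normcRe (z : R[i]) : `|z| = (complex.Re `|z|)%:C.
Proof. by rewrite normc_def. Qed.

Lemma Re_norm_continuous : continuous (fun z : R[i]^o => complex.Re `|z| : R^o).
Proof.
move=> z; apply/(@cvgrPdist_lt _ _ _ (nbhs (z : R[i]^o))) => e e0.
have e0C : 0 < e%:C :> R[i] by rewrite ltcR.
apply/nbhs_ballP; exists e%:C => //= w zw; rewrite -ltcR.
apply: le_lt_trans zw.
have -> : `|complex.Re `|z| - complex.Re `|w| |%:C = `| `|z| - `|w| | :> R[i].
  rewrite (normcRe z) (normcRe w) -rmorphB /=.
  by rewrite normc_def /= expr0n /= addr0 sqrtr_sqr.
exact: ler_dist_dist.
Qed.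

Lemma supnorm_has_ubound f :
  has_ubound [set complex.Re `|f x| | x in [set: E]].
Proof.
have /compact_bounded [M [_ fM]] :
    compact ((fun x => complex.Re `|f x| : R^o) @` [set: E]).
  apply: continuous_compact; last exact: compact_setT.
  apply: continuous_subspaceT => x.
  exact: (continuous_comp (@cfun_continuous f x) (@Re_norm_continuous (f x))).
exists (M + 1) => _ [x _ <-].
by apply: le_trans (ler_norm _) _; apply: fM; [rewrite ltrDl | exists x].
Qed.

Lemma supnorm_ge f (x : E) : complex.Re `|f x| <= supnorm f.
Proof. by apply: (ub_le_sup (supnorm_has_ubound f)); exists x. Qed.

Lemma supnorm_le f (M : R) :
  0 <= M -> (forall x, complex.Re `|f x| <= M) -> supnorm f <= M.
Proof.
move=> M0 fM; rewrite /supnorm.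
have [->|ne] := eqVneq [set complex.Re `|f x| | x in [set: E]] set0.
  by rewrite sup0.
by apply: ge_sup; [exact/set0P | move=> _ [x _ <-]].
Qed.

Lemma supnorm_ge0 f : 0 <= supnorm f.
Proof.
rewrite /supnorm.
have [->|/set0P[_ [x _ _]]] :=
  eqVneq [set complex.Re `|f x| | x in [set: E]] set0; first by rewrite sup0.
apply: le_trans (supnorm_ge f x).
by rewrite -lecR -normcRe normr_ge0.
Qed.

Lemma supnormD f g : (supnorm (f + g))%:C <= (supnorm f)%:C + (supnorm g)%:C.
Proof.
rewrite -rmorphD /= lecR; apply: supnorm_le => [|x].
  by rewrite addr_ge0 ?supnorm_ge0.
apply: le_trans (lerD (supnorm_ge f x) (supnorm_ge g x)).
by rewrite -lecR rmorphD /= -!normcRe; exact: ler_normD.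
Qed.

Lemma supnormZ_le (a : R[i]) f :
  (supnorm (a *: f))%:C <= `|a| * (supnorm f)%:C.
Proof.
rewrite normcRe -rmorphM /= lecR; apply: supnorm_le => [|x].
  by rewrite mulr_ge0 ?supnorm_ge0// -lecR -normcRe normr_ge0.
have -> : complex.Re `|(a *: f) x| = complex.Re `|a| * complex.Re `|f x|.
  apply: (can_inj (g := @complex.Re R) (f := fun r : R => r%:C)) => //.
  by rewrite rmorphM /= -!normcRe; exact: normrM.
by rewrite ler_wpM2l ?supnorm_ge// -lecR -normcRe normr_ge0.
Qed.

Lemma supnormZ (a : R[i]) f : (supnorm (a *: f))%:C = `|a| * (supnorm f)%:C.
Proof.
apply/eqP; rewrite eq_le supnormZ_le /=.
have [->|a0] := eqVneq a 0.
  by rewrite normr0 mul0r lecR supnorm_ge0.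
rewrite -[X in (supnorm X)%:C](scalerK a0 f) -ler_pdivlMl ?normr_gt0//.
by rewrite -normfV; exact: supnormZ_le.
Qed.

Lemma supnorm_eq0 f : (supnorm f)%:C = 0 :> R[i] -> f = 0.
Proof.
move=> /(congr1 (@complex.Re R)) /= f0; apply: cfunP => x.
apply/eqP; rewrite -normr_le0 normcRe.
by rewrite lecR -f0; exact: supnorm_ge.
Qed.

HB.instance Definition _ :=
  Lmodule_isNormed.Build R[i] C supnormD supnormZ supnorm_eq0.

Lemma cfun_normE f : `|f| = (supnorm f)%:C.
Proof. by []. Qed.

End CfunSpace.

Arguments cfun : clear implicits.

Section Operators.
Context {R : realType} {E : compactSpaceType}.
Local Notation C := (cfun R E).

Definition bounded_operator (L : C -> C) : Prop :=
  exists K : R, forall f, supnorm (L f) <= K * supnorm f.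

(* Meaningful for bounded operators only: [sup] of an unbounded set is 0. *)
Definition opnorm (L : C -> C) : R :=
  sup [set supnorm (L f) | f in [set f : C | supnorm f <= 1]].

(* In the order of R[i], [0 <= z] means that z is real and nonnegative. *)
Definition positive_operator (L : C -> C) : Prop :=
  forall f : C,
    (forall x : E, 0 <= (f x : R[i])) -> forall x : E, 0 <= (L f x : R[i]).

Definition contraction_operator (L : C -> C) : Prop :=
  forall f, supnorm (L f) <= supnorm f.

Definition strongly_continuous_semigroup (S : R -> {linear C -> C}) : Prop :=
  [/\ forall f, S 0 f = f,
      forall a b f, 0 <= a -> 0 <= b -> S (a + b) f = S a (S b f) &
      forall f, {within [set h : R | 0 <= h], continuous (fun h => S h f)}].

(* The infinitesimal generator of S is the everywhere defined operator L. *)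
Definition is_generator (L : C -> C) (S : R -> {linear C -> C}) : Prop :=
  forall f, (h^-1)%:C *: (S h f - f) @[h --> 0^'+] --> L f.

Definition generates_positive_contraction_semigroup (L : C -> C) : Prop :=
  exists S : R -> {linear C -> C},
    [/\ strongly_continuous_semigroup S,
        forall h, 0 <= h -> positive_operator (S h),
        forall h, 0 <= h -> contraction_operator (S h) &
        is_generator L S].

Definition opnorm_continuous (A : R -> {linear C -> C}) : Prop :=
  forall t, 0 <= t ->
    opnorm (fun f => A r f - A t f) @[r --> within [set r | 0 <= r] (nbhs t)]
      --> (0 : R).

(* v is the derivative of u at t relative to D, hence one-sided at the left
   endpoint of D = [s, oo[. *)
Definition has_derivative_on (D : set R) (u : R -> C) (t : R) (v : C) : Prop :=
  ((r - t)^-1)%:C *: (u r - u t) @[r --> within D t^'] --> v.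

Definition is_solution (A : R -> {linear C -> C}) (s : R) (us : C)
    (u : R -> C) : Prop :=
  [/\ u s = us,
      exists du : R -> C,
        {within [set t | s <= t], continuous du} /\
        forall t, s <= t -> has_derivative_on [set t | s <= t] u t (du t) &
      forall t, s <= t ->
        has_derivative_on [set t | s <= t] u t (A t (u t))].

Definition is_unique_solution (A : R -> {linear C -> C}) (s : R) (us : C)
    (u : R -> C) : Prop :=
  is_solution A s us u /\
  forall v, is_solution A s us v -> forall t, s <= t -> v t = u t.

(* Only the values U t s with 0 <= s <= t are relevant. *)
Definition solving_evolution_family (A : R -> {linear C -> C})
    (U : R -> R -> {linear C -> C}) : Prop :=
  [/\ forall s r t f, 0 <= s -> s <= r -> r <= t ->
        U t r (U r s f) = U t s f,
      forall t f, 0 <= t -> U t t f = f,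
      forall f, {within [set p : R * R | 0 <= p.1 /\ p.1 <= p.2],
        continuous (fun p => U p.2 p.1 f)},
      exists M w : R, 1 <= M /\
        forall s t f, 0 <= s -> s <= t ->
          supnorm (U t s f) <= M * expR (w * (t - s)) * supnorm f &
      forall s, 0 <= s ->
        dense [set y : C | is_unique_solution A s y (fun t => U t s y)]].

Definition well_posed (A : R -> {linear C -> C}) : Prop :=
  exists U, solving_evolution_family A U.

End Operators.

Definition borel (T : topologicalType) : set (set T) := <<s @open T >>.
Arguments borel : clear implicits.

Definition measurable_wrt (S T : Type) (F : set (set S)) (G : set (set T))
    (f : S -> T) : Prop :=
  preimage_set_system [set: S] f G `<=` F.

(* The state space with a cemetery point [None].  When E is compact, [None] is
   an isolated point of the one-point compactification. *)
Notation with_cemetery E := (one_point_compactification E).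

Definition extend0 (E : Type) (V : nmodType) (f : E -> V)
    (y : with_cemetery E) : V :=
  if y is Some x then f x else 0.

Definition bounded_borel (R : realType) (E : topologicalType) (f : E -> R) :
    Prop :=
  measurable_wrt (borel E) (measurable : set (set R)) f /\ exists M, forall x, `|f x| <= M.

Section Processes.
Context {R : realType} {E : topologicalType}.
Context {d : measure_display} {Om : measurableType d}.
Local Notation ED := (with_cemetery E).
Implicit Types (X Y : R -> Om -> ED) (P Q : R -> ED -> probability Om R).

(* W is a version of the conditional expectation of Z given G under p. *)
Definition is_condexp (p : probability Om R) (G : set (set Om))
    (Z W : Om -> R) : Prop :=
  [/\ p.-integrable setT (EFin \o Z), p.-integrable setT (EFin \o W),
      measurable_wrt G (measurable : set (set R)) W &
      forall B, G B -> \int[p]_(o in B) W o = \int[p]_(o in B) Z o].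

Definition sigma_of X (I : set R) : set (set Om) :=
  <<s \bigcup_(q in I) preimage_set_system setT (X q) (borel ED) >>.

(* E_{t,x}[f(X(s))], with f set to 0 at the cemetery. *)
Definition expect X P (t : R) (x : ED) (f : E -> R) (s : R) : R :=
  \int[P t x]_o extend0 f (X s o).

Definition cexpect X P (t : R) (x : ED) (f : E -> R[i]) (s : R) : R[i] :=
  Complex (expect X P t x (fun y => complex.Re (f y)) s)
          (expect X P t x (fun y => complex.Im (f y)) s).

(* Time runs backwards: P t x is the law of the process located at x at time t
   and observed at the times s in [0, t]. *)
Definition markov_process (T : R) X P : Prop :=
  [/\ forall s, 0 <= s <= T -> measurable_wrt (measurable : set (set Om)) (borel ED) (X s),
      forall s t (B : set ED), 0 <= s -> s <= t -> t <= T -> borel ED B ->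
        measurable_wrt (borel ED) (measurable : set (set R))
          (fun x => fine (P t x (X s @^-1` B))),
      forall t x, 0 <= t <= T -> P t x [set o | X t o = x] = 1%E,
      forall s t, 0 <= s -> s <= t -> t <= T ->
        P t None [set o | X s o = None] = 1%E &
      forall s r t x f, 0 <= s -> s <= r -> r <= t -> t <= T ->
        bounded_borel f ->
        is_condexp (P t x) (sigma_of X [set q | r <= q <= t])
          (fun o => extend0 f (X s o)) (fun o => expect X P r (X r o) f s)].

(* Below, Y is the process in increasing time on [0, T], and Q a x is its law
   when it starts from x at time a. *)

(* The right-continuous filtration generated by Y from time a on; no
   information is gained after the horizon T. *)
Definition filtration_plus (T : R) Y (a r : R) : set (set Om) :=
  \bigcap_(e in [set e : R | 0 < e])
    sigma_of Y [set q | a <= q <= Num.min (r + e) T].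

(* Stopping times are taken with values in [a, T], which covers an infinite
   value after replacing tau by its minimum with T. *)
Definition stopping_time (T : R) Y (a : R) (tau : Om -> R) : Prop :=
  (forall o, a <= tau o <= T) /\
  forall r, a <= r -> filtration_plus T Y a r [set o | tau o <= r].

Definition stopped_sigma (T : R) Y (a : R) (tau : Om -> R) : set (set Om) :=
  [set B | forall r, a <= r ->
    filtration_plus T Y a r (B `&` [set o | tau o <= r])].

(* The state is predicted at a random time sigma >= tau known at time tau, such
   as (tau + h) /\ T, or max(tau, u) for a fixed u. *)
Definition strong_markov (T : R) Y Q : Prop :=
  forall a x (tau sigma : Om -> R) f, 0 <= a <= T ->
    stopping_time T Y a tau ->
    (forall o, tau o <= sigma o <= T) ->
    measurable_wrt (stopped_sigma T Y a tau) (measurable : set (set R)) sigma ->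
    bounded_borel f ->
    is_condexp (Q a x) (stopped_sigma T Y a tau)
      (fun o => extend0 f (Y (sigma o) o))
      (fun o => expect Y Q (tau o) (Y (tau o) o) f (sigma o)).

Definition cadlag_paths (T : R) Y : Prop :=
  forall o,
    (forall r, 0 <= r < T -> Y q o @[q --> r^'+] --> Y r o) /\
    (forall r, 0 < r <= T -> exists y : ED, Y q o @[q --> r^'-] --> y).

Definition quasi_left_continuous (T : R) Y Q : Prop :=
  forall a x (tau_ : nat -> Om -> R) (tau : Om -> R), 0 <= a <= T ->
    (forall n, stopping_time T Y a (tau_ n)) ->
    (forall o m n, (m <= n)%N -> tau_ m o <= tau_ n o) ->
    (forall o, tau_ n o @[n --> \oo] --> tau o) ->
    {ae Q a x, forall o, Y (tau_ n o) o @[n --> \oo] --> Y (tau o) o}.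

Definition strong_markov_process (T : R) X P : Prop :=
  markov_process T X P /\
  strong_markov T (fun r => X (T - r)) (fun r => P (T - r)).

Definition hunt_process (T : R) X P : Prop :=
  [/\ strong_markov_process T X P,
      cadlag_paths T (fun r => X (T - r)) &
      quasi_left_continuous T (fun r => X (T - r)) (fun r => P (T - r))].

End Processes.

(* Main.v *)
Require Import Defs.
From HB Require Import structures.
From mathcomp Require Import all_boot all_order all_algebra.
From mathcomp Require Import all_classical all_reals all_analysis.
From mathcomp Require Import measurable_realfun.
From mathcomp Require Import complex.
From mathcomp Require Import ring lra.
Set Implicit Arguments.
Unset Strict Implicit.
Unset Printing Implicit Defensive.
Import Order.TTheory GRing.Theory Num.Theory.
Import numFieldNormedType.Exports.
Local Open Scope classical_set_scope.
Local Open Scope ring_scope.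

(* Fix a horizon [T].  On [[0, T]] the operators [A t] are uniformly bounded, say by
   [kappa], and for [c >= kappa] the operator [K_t = I + A t / c] is positive:
   testing positivity of the semigroup on [f - min(f, f x)] gives
   [A t f x >= - kappa * f x] for [f >= 0].  With a cemetery absorbing the mass
   defect, [K_t] becomes a probability kernel by the Riesz theorem, and the
   process is the pure jump process which jumps at rate [c] according to [K_t].
   Its law is obtained from the measure on step paths which sums over the number
   of jumps the Lebesgue measures of the ordered jump times, normalized by [exp (c t)].

   Paths are step functions and mean values are Lipschitz in time for every bounded
   Borel observable, so the strong Markov property follows by discretizing the stopping
   times, without any topology on the state space; quasi-left-continuity follows since
   a jump out of a Borel set within time [h] after a stopping time has
   probability [O(h)].

   The mean values [F_t] satisfy
   [exp (c t) F_t = exp (c r) F_r + c * \int_r^t exp (c u) K_u F_u du].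
   Picard iteration of this Volterra equation shows that [F_t] is continuous on [E], and
   differentiating it gives [F_t' = A t F_t].  Solutions are unique because the
   contraction semigroup generated by [A t] follows a solution to first order, whence
   the norm of a solution has nonpositive upper right Dini derivative.  The solutions
   over increasing horizons therefore glue to the evolution family. *)

(** * Probability measures from positive functionals *)

(** The first index of U(t,s) is the start, so the process moves down from t to s. Its paths are
    constant to the left of each time and become right-continuous only after the reversal r -> T -
    r; the past at r consists of the times above r. Lebesgue measure enters for the following
    reason. For n jumps the exponential waiting times of a Poisson clock of rate c, together with
    the survival after the last jump, have the joint density c^n exp (- c t), whatever the jump
    times are. Without the factor exp (- c t) the measure depends on the start time only through the
    window [0, t[, so restarting at r < t just cuts this window. This is where the Volterra equation
    comes from. Each iteration turns a bound into the next term (c t)^n / n! of the exponential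
    series; this one mechanism proves both the Markov property and absorption at the cemetery.
    Boundedness of A t makes the jump rate finite, but kappa, and with it c, depends on the horizon;
    this is why there is one process for each T and why uniqueness is needed to connect the
    horizons. Times are clamped to [0, T] so that all kernels are finite and defined for every
    time. *)

Definition borel_space (T : ptopologicalType) :
  measurableType (@open T).-sigma :=
  [the measurableType _ of g_sigma_algebraType (@open T)].

Section RieszOuterMeasure.
Context {R : realType} {S : ptopologicalType} (L : (S -> R) -> R).
Hypothesis S_compact : compact [set: S].
Hypothesis L_add : forall f g : S -> R, continuous f -> continuous g ->
  L (f \+ g) = L f + L g.
Hypothesis L_scale : forall (a : R) (f : S -> R), continuous f ->
  L (fun x => a * f x) = a * L f.
Hypothesis L_ge0 : forall f : S -> R, continuous f -> (forall x, 0 <= f x) ->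
  0 <= L f.
Hypothesis L1 : L (fun=> 1) = 1.
Hypothesis open_support : forall U : set S, open U ->
  exists h : S -> R, [/\ continuous h, forall x, 0 <= h x &
    U = [set x | 0 < h x]].

Implicit Types f g : S -> R.

Let cC (a : R) : continuous (fun _ : S => a).
Proof. exact: cst_continuous. Qed.

Let cD f g : continuous f -> continuous g -> continuous (fun x => f x + g x).
Proof. by move=> cf cg x; apply: cvgD; [exact: cf|exact: cg]. Qed.

Let cM f g : continuous f -> continuous g -> continuous (fun x => f x * g x).
Proof. by move=> cf cg x; apply: cvgM; [exact: cf|exact: cg]. Qed.

Let cB f g : continuous f -> continuous g -> continuous (fun x => f x - g x).
Proof. by move=> cf cg x; apply: cvgB; [exact: cf|exact: cg]. Qed.

Let cMin f g : continuous f -> continuous g ->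
  continuous (fun x => Num.min (f x) (g x)).
Proof. by move=> cf cg x; apply: continuous_min; [exact: cf|exact: cg]. Qed.

Let cMax f g : continuous f -> continuous g ->
  continuous (fun x => Num.max (f x) (g x)).
Proof. by move=> cf cg x; apply: continuous_max; [exact: cf|exact: cg]. Qed.

Let cSum (F : nat -> S -> R) n : (forall i, continuous (F i)) ->
  continuous (fun x => \sum_(i < n) F i x).
Proof.
move=> cF; elim: n => [|n IH].
  by under eq_fun do rewrite big_ord0; exact: cC.
by under eq_fun do rewrite big_ord_recr /=; exact: cD.
Qed.

Let LB f g : continuous f -> continuous g ->
  L (fun x => f x - g x) = L f - L g.
Proof.
move=> cf cg.
have -> : (fun x => f x - g x) = f \+ (fun x => -1 * g x).
  by apply/funext => x /=; rewrite mulN1r.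
by rewrite L_add// ?L_scale// ?mulN1r//; apply: cM => //; exact: cC.
Qed.

Let Lcst (a : R) : L (fun=> a) = a.
Proof.
have -> : (fun _ : S => a) = (fun x => a * (fun=> 1) x).
  by apply/funext => x; rewrite mulr1.
by rewrite L_scale ?L1 ?mulr1//; exact: cC.
Qed.

Let L_le f g : continuous f -> continuous g -> (forall x, f x <= g x) ->
  L f <= L g.
Proof.
move=> cf cg fg; rewrite -subr_ge0 -LB//; apply: L_ge0; first exact: cB.
by move=> x; rewrite subr_ge0.
Qed.

Let L_sum (F : nat -> S -> R) n : (forall i, continuous (F i)) ->
  L (fun x => \sum_(i < n) F i x) = \sum_(i < n) L (F i).
Proof.
move=> cF; elim: n => [|n IH].
  by under eq_fun do rewrite big_ord0; rewrite Lcst big_ord0.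
under eq_fun do rewrite big_ord_recr /=.
by rewrite L_add ?IH ?big_ord_recr//; exact: cSum.
Qed.

(** Daniell's upper approximation: the increasing limit of the [f n] is at least 1 on [A], and [L]
    stays below [a] along it. With sequences as witnesses, countable unions and intersections with
    an open set become operations on functions. *)
Definition riesz_cover (A : set S) (f : nat -> S -> R) (a : R) : Prop :=
  [/\ forall n, continuous (f n), forall n x, 0 <= f n x,
      forall x, {homo f ^~ x : m n / (m <= n)%N >-> m <= n},
      forall x e, A x -> 0 < e -> exists n, 1 - e < f n x &
      forall n, L (f n) <= a].

Definition riesz_outer (A : set S) : \bar R :=
  (inf [set a | exists u, riesz_cover A u a])%:E.

Let cover1 A : riesz_cover A (fun _ _ => 1) 1.
Proof.
split => // [n|x e _ e0|_].
- by move=> ? ?.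
- by exists 0%N; lra.
- by rewrite Lcst.
Qed.

Let cover_ge0 A u a : riesz_cover A u a -> 0 <= a.
Proof.
by case=> cf f0 _ _ /(_ 0%N); apply: le_trans; apply: L_ge0.
Qed.

Let lb_cover A : has_lbound [set a | exists u, riesz_cover A u a].
Proof. by exists 0 => a [f /cover_ge0]. Qed.

Let has_inf_cover A : has_inf [set a | exists u, riesz_cover A u a].
Proof.
split; last exact: lb_cover.
by exists 1; exists (fun _ _ => 1); exact: cover1.
Qed.

Let outer_le A u a : riesz_cover A u a -> (riesz_outer A <= a%:E)%E.
Proof.
move=> fa; rewrite lee_fin; apply: ge_inf; first exact: lb_cover.
by exists u.
Qed.

Let outer_approx A (e : R) : 0 < e ->
  exists u a, riesz_cover A u a /\ (a%:E <= riesz_outer A + e%:E)%E.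
Proof.
move=> e0; have [a [f fa] ae] := inf_adherent e0 (has_inf_cover A).
by exists f, a; split => //; rewrite -EFinD lee_fin ltW.
Qed.

Let outer0 : riesz_outer set0 = 0%E.
Proof.
apply/eqP; rewrite eq_le; apply/andP; split.
  apply: (@outer_le _ (fun _ _ => 0)); split => [n|n x|x m n mn|//|n].
  - exact: cC.
  - exact: lexx.
  - exact: lexx.
  - by rewrite Lcst.
rewrite lee_fin; apply: lb_le_inf; first exact: (has_inf_cover _).1.
by move=> a [f /cover_ge0].
Qed.

Let outer_ge0 A : (0 <= riesz_outer A)%E.
Proof.
rewrite lee_fin; apply: lb_le_inf; first exact: (has_inf_cover _).1.
by move=> a [f /cover_ge0].
Qed.

Let le_outer : {homo riesz_outer : A B / A `<=` B >-> (A <= B)%E}.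
Proof.
move=> A B AB; rewrite lee_fin; apply: lb_le_inf.
  exact: (has_inf_cover _).1.
move=> a [f [cf f0 ndf Bf La]]; apply: ge_inf; first exact: lb_cover.
by exists f; split => // x e /AB; exact: Bf.
Qed.

(** Covers of the sets [F i], chosen within e / 2^(i+1), are combined diagonally: [g n] adds the
    rank-n functions of the first n covers. It increases with n both through new terms and through
    the rank, and [L (g n)] stays below the sum of the bounds. *)
Let outer_subadd : sigma_subadditive riesz_outer.
Proof.
move=> F; apply/lee_addgt0Pr => e e0.
have ei (i : nat) : 0 < e / (2 ^ i.+1)%:R by rewrite divr_gt0// ltr0n expn_gt0.
have /choice[fa Hfa] : forall i, exists fa : (nat -> S -> R) * R,
    riesz_cover (F i) fa.1 fa.2 /\
    (fa.2%:E <= riesz_outer (F i) + (e / (2 ^ i.+1)%:R)%:E)%E.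
  by move=> i; have [f [a fa]] := outer_approx (F i) (ei i); exists (f, a).
apply: (le_trans _ (epsilon_trick xpredT (fun n => outer_ge0 (F n)) (ltW e0))).
apply: (@le_trans _ _ (\sum_(i <oo) (fa i).2%:E)%E); last first.
  apply: lee_nneseries => [i _ _|i _]; last exact: (Hfa i).2.
  by rewrite lee_fin; exact: cover_ge0 (Hfa i).1.
have a0 i : 0 <= (fa i).2 by exact: cover_ge0 (Hfa i).1.
case E : (\sum_(i <oo) (fa i).2%:E)%E => [a| |]; last 2 first.
- by rewrite leey.
- have : (0 <= \sum_(i <oo) (fa i).2%:E)%E.
    by apply: nneseries_ge0 => i _ _; rewrite lee_fin.
  by rewrite E.
pose g n x := \sum_(i < n) (fa i).1 n x.
have cfa i n : continuous ((fa i).1 n) by case: (Hfa i) => -[].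
have fa0 i n x : 0 <= (fa i).1 n x by case: (Hfa i) => -[].
have ndfa i m n x : (m <= n)%N -> (fa i).1 m x <= (fa i).1 n x.
  by case: (Hfa i) => -[_ _ + _ _] _ => /(_ x m n).
apply: (@outer_le _ g); split.
- by move=> n; apply: (@cSum (fun i => (fa i).1 n)) => i.
- by move=> n x; apply: sumr_ge0.
- move=> x m n mn; rewrite /g (big_ord_widen n (fun i => (fa i).1 m x) mn).
  rewrite big_mkcond/=; apply: ler_sum => i _.
  by case: ifPn => _; [exact: ndfa|].
- move=> x d [i _ Fix] d0; have [[_ _ _ /(_ x d Fix d0)[n dn] _] _] := Hfa i.
  pose m := maxn n i.+1; exists m; apply: (lt_le_trans dn).
  have im : (i < m)%N by rewrite /m leq_max ltnSn orbT.
  rewrite /g (bigD1 (Ordinal im))//=.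
  apply: (@le_trans _ _ ((fa i).1 m x)); first by apply: ndfa; rewrite leq_max leqnn.
  by rewrite lerDl; apply: sumr_ge0.
- move=> n; rewrite /g (@L_sum (fun i => (fa i).1 n))// -lee_fin -E.
  apply: (@le_trans _ _ (\sum_(0 <= i < n) (fa i).2%:E)%E); last first.
    by apply: nneseries_lim_ge => i _ _; rewrite lee_fin.
  rewrite big_mkord sumEFin lee_fin; apply: ler_sum => i _.
  by case: (Hfa i) => -[].
Qed.

HB.instance Definition _ := isOuterMeasure.Build R S riesz_outer
  outer0 outer_ge0 le_outer outer_subadd.

(* Dini's argument: by compactness the increasing cover exceeds [1 - e] everywhere
   from some rank on. *)
Let outerT : riesz_outer setT = 1%E.
Proof.
apply/eqP; rewrite eq_le (outer_le (@cover1 _))/= lee_fin.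
apply: lb_le_inf; first exact: (has_inf_cover _).1.
move=> a [f [cf f0 ndf Tf La]]; apply/ler_addgt0Pl => e e0.
have /compact_near_coveringP cS := S_compact.
have [N _ HN] : \forall n \near \oo, [set: S] `<=` (fun x => 1 - e < f n x).
  apply: cS => x _; have [n0 n0x] := Tf x e I e0.
  near=> y n => /=; apply: (@lt_le_trans _ _ (f n0 y)).
    by near: y; exact: (cvgr_gt _ (cf n0 x)).
  apply: ndf; near: n; exact: nbhs_infty_ge.
have : L (fun=> 1 - e) <= L (f N).
  apply: L_le; [exact: cC|exact: cf|move=> x].
  exact: ltW (HN N (leqnn N) x I).
by rewrite Lcst; have := La N; lra.
Unshelve. all: by end_near. Qed.

(* With [h_n := min(1, n h)] increasing to the indicator of [U], a cover [f_n]
   of [X] splits into the cover [f_n h_n] of [X `&` U] and, for each fixed [k],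
   the cover [f_n (1 - h_k)] of [X `\` U]. *)
Let open_caratheodory U : open U -> caratheodory_measurable riesz_outer U.
Proof.
move=> oU; have [h [ch h0 UE]] := open_support oU.
apply: le_caratheodory_measurable => X; apply/lee_addgt0Pr => e e0.
have [f [a [[cf f0 ndf Xf La] ae]]] := outer_approx X e0.
apply: le_trans ae.
pose hk (n : nat) x := Num.min 1 (n%:R * h x).
have chk n : continuous (hk n).
  by apply: cMin; [exact: cC|apply: cM => //; exact: cC].
have hk0 n x : 0 <= hk n x by rewrite le_min ler01 mulr_ge0.
have hk1 n x : hk n x <= 1 by rewrite ge_min lexx.
have ndhk m n x : (m <= n)%N -> hk m x <= hk n x.
  move=> mn; rewrite le_min ge_min lexx /= ge_min; apply/orP; right.
  by rewrite ler_wpM2r// ler_nat.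
have hkU x : U x -> exists n, forall m, (n <= m)%N -> hk m x = 1.
  rewrite UE /= => hx0; exists (Num.Def.truncn (h x)^-1).+1 => m nm.
  apply/min_idPl; rewrite -ler_pdivrMr// mul1r.
  apply: le_trans (ltW (truncnS_gt _)) _; first by rewrite ler_nat.
have hkNU x n : ~ U x -> hk n x = 0.
  rewrite UE /= => /negP; rewrite -leNgt => hx.
  have hx0 : h x = 0 by apply/eqP; rewrite eq_le hx h0.
  by rewrite /hk hx0 mulr0; apply/min_idPr.
pose b n := L (fun x => f n x * hk n x).
have ba n : b n <= a.
  apply: le_trans (La n); apply: L_le => [||x]; [exact: cM|exact: cf|].
  by rewrite ler_piMr.
have hsb : has_sup (range b).
  by split; [exists (b 0%N); exists 0%N|exists a => _ [n _ <-]].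
have U1 : (riesz_outer (X `&` U) <= (sup (range b))%:E)%E.
  apply: (@outer_le _ (fun n x => f n x * hk n x)); split.
  - by move=> n; exact: cM.
  - by move=> n x; rewrite mulr_ge0.
  - by move=> x m n mn; rewrite ler_pM//; [exact: ndf|exact: ndhk].
  - move=> x d [Xx Ux] d0; have [n nd] := Xf x d Xx d0.
    have [m hm] := hkU x Ux; exists (maxn n m).
    rewrite hm ?leq_maxr// mulr1; apply: lt_le_trans nd _.
    by apply: ndf; exact: leq_maxl.
  - by move=> n; apply: ub_le_sup; [exact: hsb.2|exists n].
have U2 k : (riesz_outer (X `&` ~` U) <= (a - b k)%:E)%E.
  have cv n : continuous (fun x => f n x * (1 - hk k x)).
    by apply: cM => //; apply: cB => //; exact: cC.
  have ndv x m n : (m <= n)%N ->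
      f m x * (1 - hk k x) <= f n x * (1 - hk k x).
    by move=> mn; rewrite ler_wpM2r ?subr_ge0//; exact: ndf.
  have Lv n : (k <= n)%N -> L (fun x => f n x * (1 - hk k x)) <= a - b k.
    move=> kn.
    under eq_fun do rewrite mulrBr mulr1.
    rewrite LB//; last exact: cM.
    apply: lerB => //; apply: L_le => [||x]; [exact: cM|exact: cM|].
    by rewrite ler_wpM2r//; exact: ndf.
  apply: (@outer_le _ (fun n x => f n x * (1 - hk k x))); split.
  - exact: cv.
  - by move=> n x; rewrite mulr_ge0 ?subr_ge0.
  - by move=> x m n; exact: ndv.
  - move=> x d [Xx Ux] d0; have [n nd] := Xf x d Xx d0; exists n.
    by rewrite hkNU// subr0 mulr1.
  - move=> n; apply: le_trans (Lv (maxn n k) (leq_maxr _ _)).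
    by apply: L_le => // x; apply: ndv; exact: leq_maxl.
apply/lee_addgt0Pr => d d0.
have [_ [k _ <-] bk] := sup_adherent d0 hsb.
apply: le_trans (leeD U1 (U2 k)) _.
by rewrite -!EFinD lee_fin; lra.
Qed.

Local Notation borelS := (borel_space S).

Let borel_caratheodory : (measurable : set (set borelS)) `<=`
  caratheodory_measurable riesz_outer.
Proof.
apply: smallest_sub; last exact: open_caratheodory.
exact: (@sigma_algebra_measurable _ (caratheodory_type riesz_outer)).
Qed.

Definition riesz_measure : set borelS -> \bar R := riesz_outer.

Let riesz_measure_sigma_additive : semi_sigma_additive riesz_measure.
Proof.
move=> F mF tF mUF.
apply: (@caratheodory_measure_sigma_additive _ _ riesz_outer) => //.
- by move=> n; apply: borel_caratheodory; exact: mF.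
- exact: borel_caratheodory.
Qed.

HB.instance Definition _ := isMeasure.Build _ borelS R riesz_measure
  outer0 outer_ge0 riesz_measure_sigma_additive.

HB.instance Definition _ := Measure_isProbability.Build _ borelS R riesz_measure
  outerT.

Lemma riesz_probability : exists mu : probability borelS R, mu = riesz_outer :> (set _ -> _).
Proof. by exists riesz_measure. Qed.

Let continuous_measurable f : continuous f ->
  measurable_fun [set: borelS] (f : borelS -> R).
Proof.
move=> cf; apply: (measurability _ (RGenOpens.measurableE R)).
move=> _ [_ [a [b ->] <-]]; rewrite setTI.
apply: sub_sigma_algebra; apply: open_comp => // x _; exact: cf.
Qed.

Context (mu : probability borelS R).
Hypothesis muE : mu = riesz_outer :> (set _ -> _).

(* The slice [min(1, max(0, N f - j))] is 1 on [f >= (j + 1)/N], so its value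
   under [L] bounds the measure of that set; the slices add up to [N f]. *)
Let integral_le f : continuous f -> (forall x, 0 <= f x <= 1) ->
  (\int[mu]_x (f x)%:E <= (L f)%:E)%E.
Proof.
move=> cf f01; apply/lee_addgt0Pr => e e0.
pose N := (Num.Def.truncn e^-1).+1.
have N0 : 0 < N%:R :> R by rewrite ltr0n.
have Ne : N%:R^-1 < e.
  by rewrite -[e]invrK ltf_pV2 ?posrE ?invr_gt0// truncnS_gt.
pose phi (j : nat) (y : R) : R := Num.min 1 (Num.max 0 (N%:R * y - j%:R)).
pose A (j : nat) : set borelS := [set x | j.+1%:R <= N%:R * f x].
have cphi j : continuous (fun x => phi j (f x)).
  apply: cMin; first exact: cC.
  apply: cMax; first exact: cC.
  by apply: cB; [apply: cM => //; exact: cC|exact: cC].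
have phi_sum M y : 0 <= y -> \sum_(j < M) phi j y = Num.min (N%:R * y) M%:R.
  move=> y0; have Ny0 : 0 <= N%:R * y by rewrite mulr_ge0// ltW.
  elim: M => [|M IH]; first by rewrite big_ord0; apply/esym/min_idPr.
  rewrite big_ord_recr/= IH /phi -natr1.
  by rewrite /Num.min /Num.max; do ! case: ifPn; rewrite -?leNgt; lra.
(* For y >= 0 the number of slices filled by N y is its integer part capped at M, hence within 1 of
   the truncated value. Division by N turns this error into 1 / N < e. *)
have ind_sum M y : Num.min (N%:R * y) M%:R <=
    \sum_(j < M) (j.+1%:R <= N%:R * y)%R%:R +
      (if M%:R <= N%:R * y then 0 else 1) :> R.
  elim: M => [|M IH].
    rewrite big_ord0 add0r; case: ifPn => [_|]; first by rewrite ge_min lexx orbT.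
    by rewrite -ltNge => /ltW ?; rewrite ge_min (le_trans _ ler01).
  rewrite big_ord_recr/=; move: IH; rewrite -natr1.
  by rewrite /Num.min; do ! case: ifPn; rewrite -?leNgt -?ltNge/=; lra.
have mA j : measurable (A j).
  have := continuous_measurable (cM (@cC N%:R) cf).
  move=> /(_ measurableT `[j.+1%:R, +oo[%classic (measurable_itv _)).
  rewrite setTI; congr measurable; apply/seteqP; split => x /=;
    by rewrite in_itv/= andbT.
have muA j : (mu (A j) <= (L (fun x => phi j (f x)))%:E)%E.
  rewrite muE; apply: (@outer_le _ (fun _ x => phi j (f x))); split => [_|_ x|x m n _|x d Ax d0|_].
  - exact: cphi.
  - by rewrite le_min ler01 le_max lexx.
  - exact: lexx.
  - exists 0%N.
    suff -> : phi j (f x) = 1 by lra.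
    rewrite /phi; apply/min_idPl; rewrite le_max; apply/orP; right.
    by move: Ax; rewrite /A/= -natr1; lra.
  - exact: lexx.
have mf : measurable_fun [set: borelS] (EFin \o (f : borelS -> R)).
  by apply/measurable_EFinP; exact: continuous_measurable.
have mind : measurable_fun [set: borelS]
    (EFin \o (fun x : borelS => \sum_(j < N) (\1_(A j) x : R) * N%:R^-1)).
   apply/measurable_EFinP; apply: measurable_sum => j.
  apply: measurable_funM; first exact: measurable_indic.
  exact: measurable_cst.
apply: (@le_trans _ _ (\int[mu]_x
    ((\sum_(j < N) (\1_(A j) x : R) * N%:R^-1)%:E + e%:E))%E).
  apply: ge0_le_integral => //.
  - by move=> x _; rewrite lee_fin; case/andP: (f01 x).
  - by apply: emeasurable_funD => //; exact: measurable_cst.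
  - move=> x _; rewrite -EFinD lee_fin -mulr_suml.
    have := ind_sum N (f x).
    have -> : Num.min (N%:R * f x) N%:R = N%:R * f x.
      by apply/min_idPl; rewrite ler_piMr ?(ltW N0)//; case/andP: (f01 x).
    move=> H; rewrite -(ler_pM2l N0); apply: (le_trans H).
    rewrite mulrDr mulrCA mulfV ?gt_eqF// mulr1; apply: lerD.
      apply: ler_sum => j _; rewrite indicE /A.
      by have [Hj|_] := boolP (j.+1%:R <= N%:R * f x); [rewrite mem_set|rewrite /=].
    case: ifPn => _; first by rewrite mulr_ge0 ?ltW.
    by rewrite -ler_pdivrMl// mulr1 ltW.
rewrite ge0_integralD//; last first.
  by move=> x _; rewrite lee_fin ltW.
  by move=> x _; rewrite lee_fin; apply: sumr_ge0 => j _; rewrite mulr_ge0// invr_ge0 ltW.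
rewrite integral_cst//= probability_setT mule1.
rewrite leeD2r//.
under eq_integral do rewrite -sumEFin.
rewrite ge0_integral_sum//=; last first.
  move=> j; apply/measurable_EFinP; apply: measurable_funM.
    exact: measurable_indic.
  exact: measurable_cst.
apply: (@le_trans _ _ (\sum_(j < N) (L (fun x => phi j (f x)) * N%:R^-1)%:E)%E).
  apply: lee_sum => j _.
  under eq_integral do rewrite EFinM.
  rewrite ge0_integralZr//; last by apply/measurable_EFinP; exact: measurable_indic.
  rewrite integral_indic// setIT EFinM.
  by apply: lee_wpmul2r; [rewrite lee_fin invr_ge0 ltW|exact: muA].
rewrite sumEFin lee_fin -mulr_suml -(@L_sum (fun j x => phi j (f x)))//.
have -> : (fun x => \sum_(j < N) phi j (f x)) = (fun x => N%:R * f x).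
  apply/funext => x; rewrite phi_sum; last by case/andP: (f01 x).
  by apply/min_idPl; rewrite ler_piMr ?(ltW N0)//; case/andP: (f01 x).
by rewrite L_scale// mulrAC mulfV ?gt_eqF// mul1r.
Qed.

(** The upper bound holds for [f] and for [1 - f], and on each side the two values add up to 1; this
    forces equality. *)
Let integral_ge0E f : continuous f -> (forall x, 0 <= f x <= 1) ->
  (\int[mu]_x (f x)%:E)%E = (L f)%:E.
Proof.
move=> cf f01; apply/eqP; rewrite eq_le integral_le//=.
pose g : S -> R := fun x => 1 - f x.
have f0 x : 0 <= f x by case/andP: (f01 x).
have g01 x : 0 <= g x <= 1 by have := f01 x; rewrite /g; lra.
have g0 x : 0 <= g x by case/andP: (g01 x).
have cg : continuous g by apply: cB => //; exact: cC.
have := integral_le cg g01.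
rewrite (LB (@cC 1) cf) Lcst.
have mf : measurable_fun [set: borelS] (EFin \o (f : borelS -> R)).
  by apply/measurable_EFinP; exact: continuous_measurable.
have mg : measurable_fun [set: borelS] (EFin \o (g : borelS -> R)).
  by apply/measurable_EFinP; exact: continuous_measurable.
have : (\int[mu]_x ((g x)%:E + (f x)%:E) = 1)%E.
  rewrite (eq_integral (cst 1%E)); last first.
    by move=> x _; rewrite -EFinD subrK.
  by rewrite integral_cst//= probability_setT mule1.
rewrite ge0_integralD//; last 2 first.
- by move=> x _; rewrite lee_fin.
- by move=> x _; rewrite lee_fin.
have := integral_le cf f01.
have : (0 <= \int[mu]_x (f x)%:E)%E.
  by apply: integral_ge0 => x _; rewrite lee_fin.
have : (0 <= \int[mu]_x (g x)%:E)%E.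
  by apply: integral_ge0 => x _; rewrite lee_fin.
case: (\int[mu]_x (g x)%:E)%E => [a| |]//.
case: (\int[mu]_x (f x)%:E)%E => [b| |]//.
by rewrite -EFinD !lee_fin => _ _ _ [] + H; rewrite ?lee_fin; lra.
Qed.

(** Compactness bounds |f| by some M > 0, so (f + M) / (2 M) takes values in [0, 1]; both sides are
    compatible with this affine change. *)
Lemma riesz_integral f : continuous f ->
  (\int[mu]_x f x)%R = L f.
Proof.
move=> cf.
have bnd (h : S -> R) : continuous h ->
    exists2 M, 0 < M & forall x, `|h x| <= M.
  move=> ch; have /compact_bounded[M [_ HM]] : compact (h @` [set: S]).
    by apply: continuous_compact => //; exact: continuous_subspaceT.
  exists (`|M| + 1); first by rewrite ltr_wpDl.
  move=> x; apply: HM; last by exists x.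
  by rewrite (le_lt_trans (ler_norm _))// ltrDl.
have cint (h : borelS -> R) : continuous (h : S -> R) ->
    mu.-integrable setT (EFin \o h).
  move=> ch; have [M M0 hM] := bnd _ ch.
  apply: measurable_bounded_integrable => //.
  - by rewrite /= probability_setT ltry.
  - exact: continuous_measurable.
  - exists M; split => [|y My x _ /=]; first exact: num_real.
    by rewrite (le_trans (hM x))// ltW.
have [M M0 fM] := bnd f cf.
have M20 : 0 < 2 * M by rewrite mulr_gt0.
pose g x := (2 * M)^-1 * (f x + M).
have cg : continuous g by apply: cM; [exact: cC|apply: cD => //; exact: cC].
have g01 x : 0 <= g x <= 1.
  have := fM x; rewrite ler_norml /g => /andP[H1 H2].
  rewrite mulr_ge0 ?invr_ge0 ?(ltW M20)//=; last by lra.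
  by rewrite ler_pdivrMl// mulr1; lra.
have Lg : L g = (2 * M)^-1 * (L f + M).
  rewrite L_scale; last by apply: cD => //; exact: cC.
  by rewrite L_add ?Lcst//; exact: cC.
have := integral_ge0E cg g01; rewrite Lg => Ig.
have : (\int[mu]_x g x)%R = (2 * M)^-1 * (L f + M).
  by rewrite /Rintegral Ig.
rewrite RintegralZl//; last first.
  by apply: (cint (fun x => f x + M)); apply: cD => //; exact: cC.
rewrite RintegralD//; [|exact: cint|by apply: (cint (fun=> M)); exact: cC].
rewrite Rintegral_cst//=.
rewrite probability_setT/= mulr1.
by move=> /(mulfI (invr_neq0 (lt0r_neq0 M20))); move=> /addIr.
Qed.

End RieszOuterMeasure.

Theorem positive_functional_probability (R : realType) (S : ptopologicalType)
    (L : (S -> R) -> R) :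
  compact [set: S] ->
  (forall f g : S -> R, continuous f -> continuous g ->
    L (f \+ g) = L f + L g) ->
  (forall (a : R) (f : S -> R), continuous f ->
    L (fun x => a * f x) = a * L f) ->
  (forall f : S -> R, continuous f -> (forall x, 0 <= f x) -> 0 <= L f) ->
  L (fun=> 1) = 1 ->
  (forall U : set S, open U -> exists h : S -> R,
    [/\ continuous h, forall x, 0 <= h x & U = [set x | 0 < h x]]) ->
  exists mu : probability (borel_space S) R,
    forall f : S -> R, continuous f -> (\int[mu]_x f x)%R = L f.
Proof.
move=> cS LD LZ L0 L1 oS.
have [mu muE] := riesz_probability cS LD LZ L0 L1 oS.
by exists mu; exact: riesz_integral muE.
Qed.

(** * Restricted integrals and kernels pulled back along a map *)

Lemma ge0_integral_mrestr d (T : measurableType d) (R : realType)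
    (mu : {measure set T -> \bar R}) (D : set T) (mD : measurable D)
    (f : T -> \bar R) : measurable_fun [set: T] f -> (forall x, 0 <= f x)%E ->
  (\int[mrestr mu mD]_x f x = \int[mu]_(x in D) f x)%E.
Proof.
move=> mf f0.
have mC : measurable (~` D) by exact: measurableC.
rewrite (@ge0_negligible_integral _ _ _ (mrestr mu mD) setT (~` D))//; last first.
  transitivity (mu (~` D `&` D)); first reflexivity.
  by rewrite setICl measure0.
rewrite setDE setCK setTI.
apply: eq_measure_integral => A mA AD.
transitivity (mu (A `&` D)); [reflexivity|by rewrite setIidl].
Qed.

Lemma integral_mrestr d (T : measurableType d) (R : realType)
    (mu : {measure set T -> \bar R}) (D : set T) (mD : measurable D)
    (f : T -> \bar R) : measurable_fun [set: T] f ->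
  (\int[mrestr mu mD]_x f x = \int[mu]_(x in D) f x)%E.
Proof.
move=> mf; rewrite [LHS]integralE [RHS]integralE.
rewrite ge0_integral_mrestr//; last exact: measurable_funepos.
by rewrite ge0_integral_mrestr//; exact: measurable_funeneg.
Qed.

Lemma bounded_integrable d (T : measurableType d) (R : realType)
    (mu : {measure set T -> \bar R}) (f : T -> R) (M : R) (D : set T) :
  measurable D -> (mu setT < +oo)%E -> measurable_fun [set: T] f ->
  (forall x, `|f x| <= M) -> mu.-integrable D (EFin \o f).
Proof.
move=> mD muT mf fM; apply: measurable_bounded_integrable => //.
- by apply: le_lt_trans muT; apply: le_measure => //; rewrite inE.
- exact: measurable_funTS.
- exists M; split => [|y My x _ /=]; first exact: num_real.
  exact: le_trans (fM x) (ltW My).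
Qed.

Lemma normr_Rintegral_le d (T : measurableType d) (R : realType)
    (mu : {measure set T -> \bar R}) (D : set T) (f g : T -> R) :
  measurable D -> mu.-integrable D (EFin \o f) ->
  mu.-integrable D (EFin \o g) -> (forall x, D x -> `|f x| <= g x) ->
  `|\int[mu]_(x in D) f x| <= \int[mu]_(x in D) g x.
Proof.
move=> mD fi gi fg; apply: (le_trans (le_normr_Rintegral mD fi)).
apply: le_Rintegral => //; exact: integrable_norm.
Qed.

Section KernelPrecomposition.
Context d d' d'' (X : measurableType d) (Y : measurableType d')
  (Z : measurableType d'') (R : realType).
Variables (f : X -> Y) (k : R.-sfker Y ~> Z).

Definition kernel_precomp (mf : measurable_fun [set: X] f) (x : X) :
  {measure set Z -> \bar R} := k (f x).

Variable mf : measurable_fun [set: X] f.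

Let measurable_precomp U : measurable U ->
  measurable_fun [set: X] ((kernel_precomp mf)^~ U).
Proof. by move=> mU; exact: (measurableT_comp (measurable_kernel k U mU) mf). Qed.

HB.instance Definition _ :=
  isKernel.Build _ _ X Z R (kernel_precomp mf) measurable_precomp.

End KernelPrecomposition.

Section SFinitePrecomposition.
Context d d' d'' (X : measurableType d) (Y : measurableType d')
  (Z : measurableType d'') (R : realType).
Variables (f : X -> Y) (k : R.-sfker Y ~> Z) (mf : measurable_fun [set: X] f).

Let sfinite_precomp : exists2 s : (R.-ker X ~> Z)^nat,
  forall n, measure_fam_uub (s n) &
  forall x U, measurable U -> kernel_precomp k mf x U = kseries s x U.
Proof.
have [s ks] := sfinite_kernel k.
exists (fun n => kernel_precomp (s n) mf) => [n|x U mU].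
  by have [r sr] := measure_uub (s n); exists r => x; exact: sr.
by rewrite /kernel_precomp ks.
Qed.

HB.instance Definition _ :=
  isSFiniteKernel_subdef.Build _ _ X Z R (kernel_precomp k mf) sfinite_precomp.

End SFinitePrecomposition.

(** * The space of step paths *)

Definition step_function (R : realType) (S : Type) (w : R -> S) : Prop :=
  forall q, (exists2 e, 0 < e & forall p, q - e < p <= q -> w p = w q) /\
    (exists2 e, 0 < e & exists y, forall p, q < p < q + e -> w p = y).

(** Constancy on ]q - e, q] becomes right-continuity once time is reversed, and constancy on ]q, q +
    e[ gives the left limits. Constancy near a point replaces limits, so that [S] can be a bare
    measurable space. *)
Record step_path (R : realType) (S : Type) := StepPath {
  path_fun :> R -> S ;
  path_step : step_function path_fun }.

Section StepPathSpace.
Context (R : realType) d (S : measurableType d).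

HB.instance Definition _ := gen_eqMixin (step_path R S).
HB.instance Definition _ := gen_choiceMixin (step_path R S).

Definition cst_path (x : S) : step_path R S.
Proof.
by exists (fun=> x) => q; split; exists 1 => //; exists x.
Defined.

HB.instance Definition _ := isPointed.Build (step_path R S) (cst_path point).

Definition path_cylinders : set (set (step_path R S)) :=
  \bigcup_(q in [set: R])
    preimage_set_system [set: step_path R S] (fun w => w q) measurable.

Definition path_space : measurableType path_cylinders.-sigma :=
  [the measurableType _ of g_sigma_algebraType path_cylinders].

Lemma measurable_eval (q : R) :
  measurable_fun [set: path_space] (fun w : path_space => w q).
Proof.
move=> _ B mB; apply: sub_sigma_algebra.
by exists q => //; exists B.
Qed.

Lemma measurable_to_path d' (X : measurableType d') (f : X -> path_space) :
  (forall q, measurable_fun [set: X] (fun x => f x q)) ->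
  measurable_fun [set: X] f.
Proof.
move=> mf; apply: (@measurability _ _ X path_space setT f path_cylinders) => //.
move=> _ [_ [q _ [B mB <-]] <-].
by have := mf q measurableT B mB; rewrite !setTI.
Qed.

(** In decreasing time the path rests at [x] until the jump time [u] and follows [w] from there. At
    [u] itself the value is already [w u], which preserves constancy to the left. *)
Definition graft_fun (u : R) (x : S) (w : R -> S) : R -> S :=
  fun q => if u < q then x else w q.

Lemma graft_step (u : R) (x : S) (w : step_path R S) :
  step_function (graft_fun u x w).
Proof.
move=> q; have [[e e0 we] [e' e'0 [y wy]]] := path_step w q; rewrite /graft_fun.
have [uq|qu] := ltP u q.
  split.
    exists (q - u) => [|p /andP[pu _]]; first by rewrite subr_gt0.
    by rewrite ifT//; lra.
  exists 1 => //; exists x => p /andP[qp _].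
  by rewrite ifT// (lt_trans uq).
split.
  exists e => // p /andP[pe pq].
  by rewrite ltNge (le_trans pq qu)/= we// pe.
have [->|uq] := eqVneq u q.
  exists 1 => //; exists x => p /andP[qp _].
  by rewrite ifT.
exists (Num.min e' (u - q)).
  by rewrite lt_min e'0 subr_gt0 lt_neqAle eq_sym uq.
exists y => p /andP[qp]; rewrite -ltrBlDl lt_min => /andP[p1 p2].
rewrite ifF; last by apply/negbTE; rewrite -leNgt; lra.
by apply: wy; rewrite qp/=; lra.
Qed.

Definition graft (u : R) (x : S) (w : path_space) : path_space :=
  StepPath (graft_step u x w).

Lemma measurable_graft : measurable_fun [set: (R * S) * path_space]
  (fun z => graft z.1.1 z.1.2 z.2).
Proof.
apply: measurable_to_path => q /=; apply: measurable_fun_ifT.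
- apply: measurable_fun_ltr => //.
  by apply: measurableT_comp => //; exact: measurable_fst.
- by apply: measurableT_comp => //; exact: measurable_fst.
- exact: (measurableT_comp (@measurable_eval q) (@measurable_snd _ _ _ _)).
Qed.

Lemma measurable_cst_path : measurable_fun [set: S] (cst_path : S -> path_space).
Proof. by apply: measurable_to_path => q /=. Qed.

End StepPathSpace.

(** * The unnormalized law of the jump process *)

Section JumpKernels.
Context (R : realType) d (S : measurableType d) (c : {posnum R}) (T : R)
  (K : R.-pker (R * S)%type ~> S).
Local Notation Z := (R * S)%type.
Local Notation Om := (path_space R S).
Local Notation RR := (measurableTypeR R).

Let measurable_RR : measurable_fun [set: RR] (id : RR -> R).
Proof. by move=> _ B mB; rewrite setTI preimage_id. Qed.

Definition clamp_time (t : R) : R := Num.max 0 (Num.min t T).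

Definition jump_window (z : Z) : set RR := `[0, clamp_time z.1[%classic.

Lemma measurable_jump_window z : measurable (jump_window z).
Proof. exact: measurable_itv. Qed.

(** The intensity c du on [0, t[ and not the exponential law of the first jump: the factors exp (- c
    * waiting time) multiply to exp (- c t), which the final normalization restores. Clamping bounds
    the total mass uniformly in the start. *)
Definition clock (z : Z) : {measure set RR -> \bar R} :=
  mscale (c%:num)%:nng (mrestr lebesgue_measure (measurable_jump_window z)).

Let measurable_clock U : measurable U -> measurable_fun [set: Z] (clock ^~ U).
Proof.
move=> mU; apply: measurable_funeM.
pose A : set (Z * RR) := [set p | U p.2 /\ (0 <= p.2 < clamp_time p.1.1)].
have -> : (fun z => lebesgue_measure (U `&` jump_window z)) =
    (fun z => lebesgue_measure (xsection A z)).
  apply/funext => z; congr (lebesgue_measure _); apply/seteqP.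
  by split=> u; rewrite /xsection /A /jump_window /= inE /= in_itv/=.
apply: measurable_fun_xsection.
have -> : A = (snd @^-1` U) `&` [set p | (0 <= p.2) && (p.2 < clamp_time p.1.1)].
  by apply/seteqP; split.
apply: measurableI.
  by rewrite -[X in measurable X]setTI; exact: measurable_snd.
have m2 : measurable_fun [set: Z * RR] (fun p : Z * RR => p.2 : R).
  exact: (measurableT_comp measurable_RR (@measurable_snd _ _ Z RR)).
have m11 : measurable_fun [set: Z * RR] (fun p : Z * RR => p.1.1).
  exact: (measurableT_comp (@measurable_fst _ _ _ _) (@measurable_fst _ _ _ _)).
have mb : measurable_fun [set: Z * RR]
    (fun p : Z * RR => (0 <= p.2) && (p.2 < clamp_time p.1.1)).
  apply: measurable_and; first by apply: measurable_fun_ler.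
  apply: measurable_fun_ltr => //; apply: measurable_maxr => //.
  exact: measurable_minr.
have := mb measurableT [set true] I; rewrite setTI.
by congr measurable; apply/seteqP; split.
Qed.

HB.instance Definition _ :=
  isKernel.Build _ _ Z RR R clock measurable_clock.

Lemma clockT z : (clock z setT <= (c%:num * `|T|)%:E)%E.
Proof.
rewrite /clock/= /mscale/= EFinM; apply: lee_wpmul2l => //.
rewrite /mrestr setTI lebesgue_measure_itv/=.
case: ifPn => [|_]; last by rewrite lee_fin.
rewrite lte_fin => H; rewrite sube0 lee_fin /clamp_time ge_max normr_ge0 ge_min.
by rewrite ler_norm orbT.
Qed.

Let clock_uub : measure_fam_uub clock.
Proof.
exists (c%:num * `|T| + 1) => z; apply: le_lt_trans (clockT z) _.
by rewrite lte_fin ltrDl.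
Qed.

HB.instance Definition _ := Kernel_isFinite.Build _ _ Z RR R clock clock_uub.

Lemma ge0_integral_clock z (f : RR -> \bar R) :
  measurable_fun [set: RR] f -> (forall u, 0 <= f u)%E ->
  (\int[clock z]_u f u =
   c%:num%:E * \int[lebesgue_measure]_(u in jump_window z) f u)%E.
Proof.
by move=> mf f0; rewrite ge0_integral_mscale// ge0_integral_mrestr.
Qed.

Let measurable_jump_place : measurable_fun [set: Z * RR]
  (fun p : Z * RR => (p.2 : R, p.1.2)).
Proof.
apply: measurable_fun_pair.
  exact: (measurableT_comp measurable_RR (@measurable_snd _ _ Z RR)).
exact: (measurableT_comp (@measurable_snd _ _ _ _) (@measurable_fst _ _ _ _)).
Qed.

Let measurable_jump_pair : measurable_fun [set: (Z * RR) * S]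
  (fun p : (Z * RR) * S => (p.1.2 : R, p.2)).
Proof.
apply: measurable_fun_pair; last exact: measurable_snd.
apply: (measurableT_comp measurable_RR).
exact: (measurableT_comp (@measurable_snd _ _ Z RR) (@measurable_fst _ _ _ S)).
Qed.

Definition jump_measure : R.-sfker Z ~> Z :=
  mkcomp clock (mkcomp (kernel_precomp K measurable_jump_place)
    (kdirac measurable_jump_pair)).

Lemma ge0_integral_jump z (f : Z -> \bar R) :
  measurable_fun [set: Z] f -> (forall p, 0 <= f p)%E ->
  (\int[jump_measure z]_p f p =
   c%:num%:E * \int[lebesgue_measure]_(u in jump_window z)
     \int[K (u, z.2)]_y f (u, y))%E.
Proof.
move=> mf f0; rewrite integral_kcomp//.
rewrite -ge0_integral_clock; last 2 first.
- apply: (@measurable_fun_integral_sfinite_kernel _ _ R S R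
    (fun p => f p) (kernel_precomp K (@pair2_measurable _ _ _ _ z.2))).
    by move=> p.
  exact: mf.
- by move=> u; apply: integral_ge0 => y _.
apply: eq_integral => u _; rewrite integral_kcomp//.
apply: eq_integral => y _; rewrite integral_dirac//.
by rewrite diracT mul1e.
Qed.

Let measurable_regraft : measurable_fun [set: (Z * Z) * Om]
  (fun p : (Z * Z) * Om => graft p.1.2.1 p.1.1.2 p.2).
Proof.
have m1 : measurable_fun [set: (Z * Z) * Om] (fun p => p.1).
  exact: measurable_fst.
have mg : measurable_fun [set: (Z * Z) * Om]
    (fun p => ((p.1.2.1, p.1.1.2), p.2)).
  apply: measurable_fun_pair; last exact: measurable_snd.
  apply: measurable_fun_pair.
    apply: (measurableT_comp (@measurable_fst _ _ R S)).
    exact: (measurableT_comp (@measurable_snd _ _ Z Z)).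
  apply: (measurableT_comp (@measurable_snd _ _ R S)).
  exact: (measurableT_comp (@measurable_fst _ _ Z Z)).
exact: (measurableT_comp (@measurable_graft R _ S) mg).
Qed.

Let measurable_constant : measurable_fun [set: Z]
  (fun z : Z => cst_path R z.2 : Om).
Proof.
exact: (measurableT_comp (@measurable_cst_path R _ S) (@measurable_snd _ _ R S)).
Qed.

(** The number of jumps is n; a jump may stay in place. The recursion splits off the first jump
    rather than the last, so that the remaining path starts afresh from the jump point and grafting
    only touches the times already passed. *)
Fixpoint jump_law (n : nat) : R.-sfker Z ~> Om :=
  if n is m.+1 then
    mkcomp jump_measure (mkcomp (kernel_precomp (jump_law m) (@measurable_snd _ _ Z Z))
      (kdirac measurable_regraft))
  else kdirac measurable_constant.

Definition unnormalized_law : R.-sfker Z ~> Om := kseries jump_law.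
Local Notation Q := unnormalized_law.

Lemma measurable_integral_sfker d1 d2 (X : measurableType d1)
    (Y : measurableType d2) (k : R.-sfker X ~> Y) (f : X * Y -> \bar R) :
  (forall p, 0 <= f p)%E -> measurable_fun [set: X * Y] f ->
  measurable_fun [set: X] (fun x => \int[k x]_y f (x, y))%E.
Proof. by move=> f0 mf; exact: measurable_fun_integral_sfinite_kernel. Qed.

Lemma measurable_graft2 d1 (Y : measurableType d1) (G : Om -> Y) (x : S) :
  measurable_fun [set: Om] G ->
  measurable_fun [set: Z * Om] (fun p => G (graft p.1.1 x p.2)).
Proof.
move=> mG; apply: (measurableT_comp mG).
have mg : measurable_fun [set: Z * Om] (fun p => ((p.1.1, x), p.2)).
  apply: measurable_fun_pair; last exact: measurable_snd.
  apply: measurable_fun_pair => //.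
  exact: (measurableT_comp (@measurable_fst _ _ R S) (@measurable_fst _ _ Z Om)).
exact: (measurableT_comp (@measurable_graft R _ S) mg).
Qed.

(** Shifting the sum over the number of jumps by one and exchanging it with the integral over the
    first jump closes the recursion into an equation for the whole measure. *)
Lemma ge0_first_jump z (G : Om -> \bar R) :
  measurable_fun [set: Om] G -> (forall w, 0 <= G w)%E ->
  (\int[Q z]_w G w = G (cst_path R z.2) +
     \int[jump_measure z]_p \int[Q p]_w G (graft p.1 z.2 w))%E.
Proof.
move=> mG G0; rewrite integral_kseries// nneseries_recl//; last first.
  by move=> n _; exact: integral_ge0.
congr (_ + _)%E; first by rewrite integral_dirac// diracT mul1e.
rewrite -(@nneseries_addn _ _ 1%N)//=; last by move=> n; exact: integral_ge0.
under eq_eseriesr => n _.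
  rewrite addn1 integral_kcomp//.
  under eq_integral.
    move=> p _; rewrite integral_kcomp//.
    under eq_integral do rewrite integral_dirac// diracT mul1e /=.
    over.
  over.
rewrite -integral_nneseries//=; last 2 first.
- move=> n.
  apply: (@measurable_integral_sfker _ _ Z Om (jump_law n)
    (fun p => G (graft p.1.1 z.2 p.2))) => //.
  exact: measurable_graft2.
- by move=> n p _; apply: integral_ge0.
apply: eq_integral => p _.
rewrite integral_kseries//.
exact: (measurableT_comp (measurable_graft2 z.2 mG) (@pair1_measurable _ _ Z Om p)).
Qed.

End JumpKernels.

Lemma is_derive_exp_coeff (R : realType) (c x : R) (n : nat) :
  is_derive x (1 : R) (fun u : R => exp_coeff (c * u) n.+1)
    (c * exp_coeff (c * x) n).
Proof.
rewrite /exp_coeff /=.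
have h : is_derive x (1 : R) (fun u : R => c * u) c.
  by apply: is_derive_eq; rewrite /GRing.scale/= mulr1.
have hZ := is_deriveZ ((n.+1`!%:R)^-1) (is_deriveX n.+1 h).
have -> : (fun u : R => (c * u) ^+ n.+1 / n.+1`!%:R) =
    ((n.+1`!%:R)^-1 \*: ((fun u : R => c * u) ^+ n.+1)).
  by apply/funext => u /=; rewrite exprfctE /GRing.scale/= mulrC.
apply: (is_derive_eq hZ).
rewrite factS natrM invfM /GRing.scale/=.
have : n.+1%:R != 0 :> R by rewrite pnatr_eq0.
have : n`!%:R != 0 :> R by rewrite pnatr_eq0 -lt0n fact_gt0.
move: (n.+1%:R : R) (n`!%:R : R) ((c * x) ^+ n) => a b X b0 a0.
by field; rewrite a0 b0.
Qed.

Lemma integral_exp_coeff (R : realType) (c t : R) (n : nat) : 0 <= t ->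
  (\int[lebesgue_measure]_(u in `[0%R, t]) (c * exp_coeff (c * u) n)%:E =
   (exp_coeff (c * t) n.+1)%:E)%E.
Proof.
rewrite le_eqVlt => /predU1P[<-|t0].
  by rewrite set_itv1 integral_set1 mulr0 /exp_coeff/= expr0n mul0r.
have cF (k : nat) : continuous (fun u : R => exp_coeff (c * u) k).
  move=> u; case: k => [|k].
    by rewrite /exp_coeff /=; under eq_fun do rewrite expr0; exact: cvg_cst.
  apply: differentiable_continuous; apply/derivable1_diffP.
  exact: (@ex_derive _ _ _ _ _ _ _ (is_derive_exp_coeff c u k)).
rewrite (@continuous_FTC2 _ _ (fun u => exp_coeff (c * u) n.+1))//.
- by rewrite mulr0 [exp_coeff 0 _]/exp_coeff/= expr0n mul0r sube0.
- apply: continuous_subspaceT => u.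
  by apply: cvgM; [exact: cvg_cst|exact: cF].
- split.
  + move=> u _; exact: (@ex_derive _ _ _ _ _ _ _ (is_derive_exp_coeff c u n)).
  + by apply: cvg_at_right_filter; exact: cF.
  + by apply: cvg_at_left_filter; exact: cF.
- move=> u _; rewrite derive1E.
  exact: (@derive_val _ _ _ _ _ _ _ (is_derive_exp_coeff c u n)).
Qed.

(** * Masses and weighted means *)

Section Expectation.
Context (R : realType) d (S : measurableType d) (c : {posnum R}) (T : R)
  (K : R.-pker (R * S)%type ~> S).
Local Notation Z := (R * S)%type.
Local Notation Om := (path_space R S).
Local Notation RR := (measurableTypeR R).
Local Notation jump := (jump_measure c T K).
Local Notation Q := (unnormalized_law c T K).
Local Notation clamp := (clamp_time T).

Lemma clamp_ge0 t : 0 <= clamp t.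
Proof. by rewrite le_max lexx. Qed.

Lemma clampK t : clamp (clamp t) = clamp t.
Proof. by rewrite /clamp_time /Num.max /Num.min; do ! case: ifPn; lra. Qed.

Lemma clamp_id t : 0 <= t <= T -> clamp t = t.
Proof. by rewrite /clamp_time /Num.max /Num.min; do ! case: ifPn; lra. Qed.

Lemma le_clamp s t : s <= t -> clamp s <= clamp t.
Proof. by rewrite /clamp_time /Num.max /Num.min; do ! case: ifPn; lra. Qed.

Lemma clamp_le t : clamp t <= Num.max 0 T.
Proof. by rewrite /clamp_time /Num.max /Num.min; do ! case: ifPn; lra. Qed.

Lemma clamp_window u t : 0 <= u < clamp t -> clamp u = u.
Proof. by rewrite /clamp_time /Num.max /Num.min; do ! case: ifPn; lra. Qed.

Lemma measurable_clamp : measurable_fun [set: R] clamp.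
Proof. by apply: measurable_maxr => //; exact: measurable_minr. Qed.

(** The term (c t)^n / n! of the exponential series. It is the mass of the paths with n jumps, and
    integration against the jump measure sends it to the next term, which makes it the gauge in
    [volterra_eq0]. *)
Definition jump_count_bound (n : nat) (p : Z) : R := exp_coeff (c%:num * clamp p.1) n.

Lemma jump_bound_ge0 n p : 0 <= jump_count_bound n p.
Proof. by apply: exp_coeff_ge0; rewrite mulr_ge0 ?clamp_ge0. Qed.

Lemma measurable_jump_bound n : measurable_fun [set: Z] (jump_count_bound n).
Proof.
apply: measurable_funM => //; apply: measurable_funX.
apply: measurable_funM => //.
exact: (measurableT_comp measurable_clamp (@measurable_fst _ _ R S)).
Qed.

Lemma integral_jump_bound n z :
  (\int[jump z]_p (jump_count_bound n p)%:E = (jump_count_bound n.+1 z)%:E)%E.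
Proof.
rewrite ge0_integral_jump; last 2 first.
- by apply/measurable_EFinP; exact: measurable_jump_bound.
- by move=> p; rewrite lee_fin jump_bound_ge0.
have mE (t : R) (E : bool) : measurable_fun [set: RR]
    (fun u => (exp_coeff (c%:num * (if E then clamp u else u)) n)%:E).
  apply/measurable_EFinP; apply: measurable_funM => //; apply: measurable_funX.
  apply: measurable_funM => //.
  by case: E => //; exact: measurable_clamp.
rewrite /jump_count_bound /= -integral_exp_coeff ?clamp_ge0//.
under [RHS]eq_integral do rewrite EFinM.
rewrite ge0_integralZl//; last 2 first.
- by apply: measurable_funTS; exact: (mE 0 false).
- move=> u; rewrite /= in_itv/= => /andP[u0 _].
  by rewrite lee_fin exp_coeff_ge0// mulr_ge0.
congr (_ * _)%E.
rewrite /jump_window -integral_itv_bndo_bndc; last first.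
  by apply: measurable_funTS; exact: (mE 0 false).
apply: eq_integral => u; rewrite inE/= in_itv/= => u0t.
by rewrite integral_cst//= prob_kernel mule1 (clamp_window u0t).
Qed.

Lemma jump_lawT n z : (jump_law c T K n z setT = (jump_count_bound n z)%:E)%E.
Proof.
elim: n z => [|n IH] z; first by rewrite /= diracT /jump_count_bound /exp_coeff/= expr0 divr1.
rewrite -integral_jump_bound /=.
apply: eq_integral => p _; rewrite -IH -[RHS]mul1e -integral_cst//.
by apply: eq_integral => w _; exact: diracT.
Qed.

Definition total_mass (z : Z) : R := expR (c%:num * clamp z.1).

Lemma unnormalized_lawT z : (Q z setT = (total_mass z)%:E)%E.
Proof.
rewrite /unnormalized_law /= /mseries.
under eq_eseriesr do rewrite jump_lawT.
have := @is_cvg_series_exp_coeff R (c%:num * clamp z.1).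
move=> /EFin_lim; rewrite /total_mass /expR => <-.
congr (limn _); apply/funext => n /=.
by rewrite sumEFin.
Qed.

Lemma mass_ge0 z : 0 <= total_mass z.
Proof. exact: expR_ge0. Qed.

Definition total_mass_bound : R := expR (c%:num * Num.max 0 T).

Lemma mass_le z : total_mass z <= total_mass_bound.
Proof. by rewrite ler_expR ler_wpM2l// clamp_le. Qed.

Lemma measurable_mass : measurable_fun [set: Z] total_mass.
Proof.
apply: (measurableT_comp (@measurable_expR R)).
apply: measurable_funM => //.
exact: (measurableT_comp measurable_clamp (@measurable_fst _ _ R S)).
Qed.

Lemma unnormalized_lawT_lty z : (Q z setT < +oo)%E.
Proof. by rewrite unnormalized_lawT ltry. Qed.

Lemma jumpT z : (jump z setT = (jump_count_bound 1 z)%:E)%E.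
Proof.
rewrite -integral_jump_bound -[LHS]mul1e -integral_cst//.
by apply: eq_integral => p _; rewrite /jump_count_bound /exp_coeff/= expr0 divr1.
Qed.

Lemma jumpT_lty z : (jump z setT < +oo)%E.
Proof. by rewrite jumpT ltry. Qed.

Definition weighted_mean (z : Z) (G : Om -> R) : R := \int[Q z]_w G w.

Lemma wexp_integrable z (G : Om -> R) (M : R) : measurable_fun [set: Om] G ->
  (forall w, `|G w| <= M) -> (Q z).-integrable setT (EFin \o G).
Proof.
by move=> mG GM; apply: bounded_integrable mG GM => //; exact: unnormalized_lawT_lty.
Qed.

Lemma wexp_cst z (a : R) : weighted_mean z (fun=> a) = a * total_mass z.
Proof. by rewrite /weighted_mean Rintegral_cst//= unnormalized_lawT. Qed.

Lemma wexpD z (G H : Om -> R) (M N : R) : measurable_fun [set: Om] G ->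
  measurable_fun [set: Om] H -> (forall w, `|G w| <= M) ->
  (forall w, `|H w| <= N) ->
  weighted_mean z (fun w => G w + H w) = weighted_mean z G + weighted_mean z H.
Proof.
move=> mG mH GM HN; rewrite /weighted_mean RintegralD//.
- exact: wexp_integrable GM.
- exact: wexp_integrable HN.
Qed.

Lemma wexpZ z (G : Om -> R) (M a : R) : measurable_fun [set: Om] G ->
  (forall w, `|G w| <= M) -> weighted_mean z (fun w => a * G w) = a * weighted_mean z G.
Proof. by move=> mG GM; rewrite /weighted_mean RintegralZl//; exact: wexp_integrable GM. Qed.

Lemma wexp_le z (G : Om -> R) (M : R) : measurable_fun [set: Om] G ->
  (forall w, `|G w| <= M) -> `|weighted_mean z G| <= M * total_mass z.
Proof.
move=> mG GM; rewrite -wexp_cst /weighted_mean.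
apply: normr_Rintegral_le => //; first exact: wexp_integrable GM.
have M0 : 0 <= M by apply: le_trans (normr_ge0 _) (GM point).
by apply: (@wexp_integrable z (fun=> M) M) => // w; rewrite ger0_norm.
Qed.

Lemma measurable_wexp (H : Z * Om -> R) (M : R) : measurable_fun [set: Z * Om] H ->
  (forall p, `|H p| <= M) ->
  measurable_fun [set: Z] (fun p => weighted_mean p (fun w => H (p, w))).
Proof.
move=> mH HM.
have mp (h : Z * Om -> R) (p : Z) : measurable_fun [set: Z * Om] h ->
    measurable_fun [set: Om] (fun w => h (p, w)).
  by move=> mh; exact: (measurableT_comp mh (@pair1_measurable _ _ Z Om p)).
have M0 : 0 <= M by apply: le_trans (normr_ge0 _) (HM point).
(* Kernel integrals of nonnegative functions are measurable in the parameter; adding M reduces the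
   bounded case to these. *)
have -> : (fun p => weighted_mean p (fun w => H (p, w))) =
    (fun p => weighted_mean p (fun w => H (p, w) + M) - M * total_mass p).
  apply/funext => p; rewrite (@wexpD _ _ (fun=> M) M M)//.
  - by rewrite wexp_cst addrK.
  - exact: mp.
  - by move=> w; rewrite ger0_norm.
apply: measurable_funB; last first.
  by apply: measurable_funM => //; exact: measurable_mass.
apply: (measurableT_comp (@fine_measurable R setT measurableT)).
apply: (@measurable_integral_sfker _ _ _ Z Om Q (fun p => (H p + M)%:E)).
  move=> p; rewrite lee_fin; have := HM p; rewrite ler_norml; lra.
by apply/measurable_EFinP; apply: measurable_funD.
Qed.

End Expectation.

#[local] Opaque jump_measure unnormalized_law.

Lemma EFin_Rintegral d (T : measurableType d) (R : realType)
    (mu : {measure set T -> \bar R}) (D : set T) (f : T -> R) :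
  measurable D -> mu.-integrable D (EFin \o f) ->
  ((\int[mu]_(x in D) f x)%:E = \int[mu]_(x in D) (f x)%:E)%E.
Proof. by move=> mD fi; rewrite /Rintegral fineK//; exact: integrable_fin_num. Qed.

Lemma measure_integral_indic d (T : measurableType d) (R : realType)
    (mu : {measure set T -> \bar R}) (B : set T) : measurable B ->
  (mu B = \int[mu]_p (\1_B p : R)%:E)%E.
Proof. by move=> mB; rewrite integral_indic// setIT. Qed.

Lemma Rintegral_restricted d (T : measurableType d) (R : realType)
    (mu nu : {measure set T -> \bar R}) (D : set T) (f : T -> R) :
  measurable D -> (forall A, measurable A -> mu (A `&` D) = nu A) ->
  measurable_fun [set: T] f ->
  \int[mu]_(x in D) f x = \int[nu]_x f x.
Proof.
move=> mD munu mf.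
rewrite /Rintegral -(integral_mrestr _ mD); last exact/measurable_EFinP.
by congr fine; apply: eq_measure_integral => A mA _; exact: munu.
Qed.

(** * Decomposition at the first jump *)

Section FirstJump.
Context (R : realType) d (S : measurableType d) (c : {posnum R}) (T : R)
  (K : R.-pker (R * S)%type ~> S).
Local Notation Z := (R * S)%type.
Local Notation Om := (path_space R S).
Local Notation RR := (measurableTypeR R).
Local Notation jump := (jump_measure c T K).
Local Notation Q := (unnormalized_law c T K).
Local Notation clamp := (clamp_time T).
Local Notation wexp := (weighted_mean c T K).
Local Notation mass := (@total_mass R d S c T).
Local Notation mass_bound := (total_mass_bound c T).

Lemma measurable_graft1 d1 (Y : measurableType d1) (G : Om -> Y) (u : R) (x : S) :
  measurable_fun [set: Om] G -> measurable_fun [set: Om] (fun w => G (graft u x w)).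
Proof.
move=> mG.
exact: (measurableT_comp (measurable_graft2 x mG) (@pair1_measurable _ _ Z Om (u, x))).
Qed.

Lemma measurable_wexp_graft (G : Om -> R) (M : R) (x : S) : measurable_fun [set: Om] G ->
  (forall w, `|G w| <= M) ->
  measurable_fun [set: Z] (fun p : Z => wexp p (fun w => G (graft p.1 x w))).
Proof.
move=> mG GM.
apply: (@measurable_wexp _ _ _ c T K (fun q => G (graft q.1.1 x q.2)) M) => //.
exact: measurable_graft2.
Qed.

Lemma wexp_graft_le (G : Om -> R) (M : R) (x : S) (p : Z) : measurable_fun [set: Om] G ->
  (forall w, `|G w| <= M) ->
  `|wexp p (fun w => G (graft p.1 x w))| <= M * mass_bound.
Proof.
move=> mG GM; have M0 : 0 <= M by apply: le_trans (normr_ge0 _) (GM point).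
apply: (@le_trans _ _ (M * mass p)).
  by apply: wexp_le => //; exact: measurable_graft1.
by rewrite ler_wpM2l// mass_le.
Qed.

Lemma wexp_graft_integrable (G : Om -> R) (M : R) (x : S) z (D : set Z) : measurable D ->
  measurable_fun [set: Om] G -> (forall w, `|G w| <= M) ->
  (jump z).-integrable D
    (EFin \o (fun p : Z => wexp p (fun w => G (graft p.1 x w)))).
Proof.
move=> mD mG GM; apply: (@bounded_integrable _ _ _ _ _ (M * mass_bound)) => //.
- exact: jumpT_lty.
- exact: measurable_wexp_graft GM.
- by move=> p; exact: wexp_graft_le.
Qed.

Let wexp_first0 z (G : Om -> R) (M : R) : measurable_fun [set: Om] G ->
  (forall w, `|G w| <= M) -> (forall w, 0 <= G w) ->
  wexp z G = G (cst_path R z.2) +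
    \int[jump z]_p wexp p (fun w => G (graft p.1 z.2 w)).
Proof.
move=> mG GM G0; apply: EFin_inj; rewrite EFinD !EFin_Rintegral//; last 2 first.
- exact: wexp_graft_integrable GM.
- exact: wexp_integrable GM.
rewrite ge0_first_jump//; first last.
- by apply/measurable_EFinP.
- congr (_ + _)%E; apply: eq_integral => p _.
  rewrite EFin_Rintegral//; apply: (@wexp_integrable _ _ _ _ _ _ _ _ M) => //.
  exact: measurable_graft1.
Qed.

Lemma wexp_first z (G : Om -> R) (M : R) : measurable_fun [set: Om] G ->
  (forall w, `|G w| <= M) ->
  wexp z G = G (cst_path R z.2) +
    \int[jump z]_p wexp p (fun w => G (graft p.1 z.2 w)).
Proof.
move=> mG GM; have M0 : 0 <= M by apply: le_trans (normr_ge0 _) (GM point).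
have mH : measurable_fun [set: Om] (fun w => G w + M) by exact: measurable_funD.
have HM w : `|G w + M| <= M + M.
  by rewrite (le_trans (ler_normD _ _))// lerD// ger0_norm.
have MM (w : Om) : `|(fun=> M) w| <= M by rewrite ger0_norm.
have mM : measurable_fun [set: Om] (fun=> M) by [].
have H0 w : 0 <= G w + M by have := GM w; rewrite ler_norml => /andP[H _]; rewrite -lerBlDr sub0r.
have := wexp_first0 z mH HM H0.
have := wexp_first0 z mM MM (fun=> M0).
rewrite (wexpD _ _ _ _ mG mM GM MM).
under [X in _ -> _ = _ + X -> _]eq_Rintegral.
  move=> p _; rewrite (wexpD _ _ _ _ (measurable_graft1 p.1 z.2 mG) mM (fun w => GM _) MM).
  over.
rewrite (RintegralD measurableT (wexp_graft_integrable _ _ measurableT mG GM)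
  (wexp_graft_integrable z.2 z measurableT mM MM)).
by move=> -> H; apply: (addIr (M + \int[jump z]_p wexp p (fun=> M))); rewrite H addrACA.
Qed.

Definition later (r : R) : set Z := [set p | r <= p.1].

Lemma measurable_later r : measurable (later r).
Proof.
have := (@measurable_fst _ _ R S) measurableT `[r, +oo[%classic (measurable_itv _).
rewrite setTI; congr measurable; apply/seteqP; split => p /=;
  by rewrite in_itv/= andbT.
Qed.

(** Lack of memory: the start time enters the jump measure only through the window, and cutting the
    window of (t, x) at r gives that of (r, x). *)
Lemma jump_before r t x (A : set Z) : r <= t -> measurable A ->
  (jump (t, x) (A `&` ~` later r) = jump (r, x) A)%E.
Proof.
move=> rt mA; have mB : measurable (A `&` ~` later r).
  by apply: measurableI => //; apply: measurableC; exact: measurable_later.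
have mI (B : set Z) : measurable B -> measurable_fun [set: Z] (fun p => (\1_B p : R)%:E).
  by move=> mB'; apply/measurable_EFinP; exact: measurable_indic.
have jumpE q (B : set Z) : measurable B ->
    (jump q B = \int[jump q]_p (\1_B p : R)%:E)%E.
  exact: measure_integral_indic.
rewrite (jumpE _ _ mB) (jumpE _ _ mA).
rewrite (ge0_integral_jump _ _ _ _ (mI _ mB)); last by move=> p.
rewrite (ge0_integral_jump _ _ _ _ (mI _ mA)); last by move=> p.
congr (_ * _)%E; rewrite integral_mkcond [RHS]integral_mkcond /=.
apply: eq_integral => u _; rewrite !patchE /jump_window !mem_setE/= !in_itv/=.
have [ur|ru] := ltP u r.
  have -> : (0 <= u < clamp t) = (0 <= u < clamp r).
    by move: ur rt; rewrite /clamp_time /Num.max /Num.min;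
      do ! case: ifPn; rewrite -?leNgt => *; apply/idP/idP; lra.
  case: ifPn => // _; apply: eq_integral => y _.
  rewrite !indicE; congr ((_ : bool)%:R)%:E; apply/idP/idP; rewrite !inE.
    by case.
  by move=> Auy; split => //; apply/negP; rewrite -ltNge.
rewrite [RHS]ifF; last first.
  by move: ru; rewrite /clamp_time /Num.max /Num.min;
    do ! case: ifPn; rewrite -?leNgt => *; apply/negbTE; lra.
case: ifPn => // _; rewrite integral0_eq// => y _.
rewrite indicE memNset//= => -[_]; exact.
Qed.

Lemma Rintegral_before r t x (f : Z -> R) : r <= t ->
  measurable_fun [set: Z] f ->
  \int[jump (t, x)]_(p in ~` later r) f p = \int[jump (r, x)]_p f p.
Proof.
move=> rt mf; have mL := measurableC (measurable_later r).
exact: (Rintegral_restricted mL (fun A => jump_before x rt)).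
Qed.

(** A grafted path does not remember the start time. The constant path and the first jumps below r
    therefore contribute exactly the weighted mean from (r, x), and only first jumps in [r, t[
    remain. *)
Lemma wexp_restart r t x (G : Om -> R) (M : R) : r <= t ->
  measurable_fun [set: Om] G -> (forall w, `|G w| <= M) ->
  wexp (t, x) G = wexp (r, x) G +
    \int[jump (t, x)]_(p in later r) wexp p (fun w => G (graft p.1 x w)).
Proof.
move=> rt mG GM; rewrite !(wexp_first _ mG GM) /= -addrA; congr (_ + _).
rewrite -(Rintegral_before x rt); last exact: measurable_wexp_graft GM.
rewrite -[in LHS](setUv (later r)) Rintegral_setU.
- by rewrite addrC.
- exact: measurable_later.
- by apply: measurableC; exact: measurable_later.
- by rewrite setUv; exact: wexp_graft_integrable GM.
- by apply/disj_setPCl.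
Qed.

(** The paths from (r, x) rest at x on [r, oo[: by [Rintegral_before] with t = r, first jumps at
    times >= r carry no mass. *)
Lemma wexp_start r x (G H : Om -> R) (M : R) : measurable_fun [set: Om] G ->
  measurable_fun [set: Om] H -> (forall w, `|G w| <= M) ->
  (forall w, `|H w| <= M) ->
  (forall w : Om, (forall q, r <= q -> w q = x) -> G w = H w) ->
  wexp (r, x) G = wexp (r, x) H.
Proof.
move=> mG mH GM HM GH; rewrite (wexp_first _ mG GM) (wexp_first _ mH HM).
congr (_ + _); first exact: GH.
rewrite -!(Rintegral_before x (lexx r)); last 2 first.
- exact: measurable_wexp_graft HM.
- exact: measurable_wexp_graft GM.
apply: eq_Rintegral => p; rewrite inE => /negP; rewrite -ltNge => pr.
congr (wexp p _); apply/funext => w; apply: GH => q rq /=.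
by rewrite /graft_fun ifT// (lt_le_trans pr).
Qed.

End FirstJump.

(** * Uniqueness for the Volterra equation and the Markov property *)

Section MarkovProperty.
Context (R : realType) d (S : measurableType d) (c : {posnum R}) (T : R)
  (K : R.-pker (R * S)%type ~> S).
Local Notation Z := (R * S)%type.
Local Notation Om := (path_space R S).
Local Notation jump := (jump_measure c T K).
Local Notation Q := (unnormalized_law c T K).
Local Notation clamp := (clamp_time T).
Local Notation wexp := (weighted_mean c T K).
Local Notation mass := (@total_mass R d S c T).
Local Notation mass_bound := (total_mass_bound c T).
Local Notation jump_bound := (@jump_count_bound R d S c T).

Lemma Rintegral_jump_le z (A : set Z) (f : Z -> R) (M : R) n : measurable A ->
  measurable_fun [set: Z] f -> (forall p, A p -> `|f p| <= M * jump_bound n p) ->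
  0 <= M ->
  `|\int[jump z]_(p in A) f p| <= M * jump_bound n.+1 z.
Proof.
move=> mA mf fM M0; rewrite Rintegral_mkcond.
have mB := @measurable_jump_bound R d S c T n.
have iB : (jump z).-integrable setT (EFin \o (jump_bound n : Z -> R)).
  apply/integrableP; split; first exact/measurable_EFinP.
  under eq_integral do rewrite /= ger0_norm ?jump_bound_ge0//.
  by rewrite integral_jump_bound ltry.
have -> : M * jump_bound n.+1 z = \int[jump z]_p (M * jump_bound n p).
  by rewrite RintegralZl// /Rintegral integral_jump_bound.
have fM' p : `|(f \_ A) p| <= M * jump_bound n p.
  rewrite patchE; case: ifPn => [|_]; first by rewrite inE => /fM.
  by rewrite normr0 mulr_ge0// jump_bound_ge0.
have iMB : (jump z).-integrable setT (EFin \o (fun p : Z => M * jump_bound n p)).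
  exact: (integrableZl measurableT M iB).
apply: normr_Rintegral_le => //.
apply: le_integrable iMB => //.
  apply/measurable_EFinP/(measurable_restrictT _ _).1 => //.
  exact: measurable_funTS.
move=> p _ /=; rewrite lee_fin; apply: (le_trans (fM' p)); exact: ler_norm.
Qed.

(** The bounds M (c t)^n / n! tend to 0. The index type allows a family of unknowns to satisfy the
    step jointly, as happens when conditioning on the first jump changes the event under
    consideration. *)
Lemma volterra_eq0 (I : Type) (D : I -> Z -> R) (M : R) :
  (forall i z, `|D i z| <= M) ->
  (forall n, (forall i z, `|D i z| <= M * jump_bound n z) ->
    forall i z, `|D i z| <= M * jump_bound n.+1 z) ->
  forall i z, D i z = 0.
Proof.
move=> DM step i z; apply/eqP; rewrite -normr_le0.
have Dn n : forall i z, `|D i z| <= M * jump_bound n z.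
  elim: n => [j y|n IH]; last exact: step.
  by rewrite /jump_count_bound /exp_coeff/= expr0 divr1 mulr1.
have cv : (fun n => M * jump_bound n z) @ \oo --> M * 0.
  apply: cvgM; first exact: cvg_cst.
  apply: cvg_series_cvg_0; exact: is_cvg_series_exp_coeff.
rewrite -(mulr0 M) -(cvg_lim _ cv)//; apply: limr_ge; first by apply/cvg_ex; exists (M * 0).
by apply: nearW => n.
Qed.

Definition path_mean (z : Z) (G : Om -> R) : R := wexp z G / mass z.

Definition transition_mean (s : R) (f : S -> R) (z : Z) : R :=
  path_mean z (fun w => f (w s)).

(** The past at r, as time decreases. Invariance is used instead of a generated sigma-algebra
    because it is visibly preserved by preimages under grafting. *)
Definition determined_from (r : R) : set (set Om) :=
  [set B | measurable B /\
    forall w w' : Om, (forall q, r <= q -> w q = w' q) -> B w -> B w'].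

Lemma mass_gt0 z : 0 < mass z. Proof. exact: expR_gt0. Qed.

Lemma mass_ge1 z : 1 <= mass z.
Proof. by rewrite -expR0 ler_expR mulr_ge0// clamp_ge0. Qed.

Lemma pexp_le z (G : Om -> R) (M : R) : measurable_fun [set: Om] G ->
  (forall w, `|G w| <= M) -> `|path_mean z G| <= M.
Proof.
move=> mG GM; rewrite normrM normfV (ger0_norm (mass_ge0 _ _ _)).
by rewrite ler_pdivrMr ?mass_gt0//; exact: wexp_le.
Qed.

Section BoundedFunction.
Variables (f : S -> R) (M : R).
Hypotheses (mf : measurable_fun [set: S] f) (fM : forall y, `|f y| <= M).

Let M0 : 0 <= M. Proof. by apply: le_trans (normr_ge0 _) (fM point). Qed.

Lemma measurable_observe s : measurable_fun [set: Om] (fun w : Om => f (w s)).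
Proof. exact: (measurableT_comp mf (@measurable_eval R d S s)). Qed.

Let observe_le s (w : Om) : `|f (w s)| <= M. Proof. exact: fM. Qed.

Lemma measurable_transition s : measurable_fun [set: Z] (transition_mean s f).
Proof.
apply: measurable_funM; last first.
  apply: (@measurable_comp _ _ _ _ _ _ [set r : R | r != 0]) => //.
  - exact: open_measurable.
  - by move=> _ [p _ <-] /=; rewrite gt_eqF// mass_gt0.
  - apply: open_continuous_measurable_fun => //; apply/in_setP => x /= x0.
    exact: inv_continuous.
  - exact: measurable_mass.
apply: (@measurable_wexp _ _ _ c T K (fun q => f (q.2 s)) M) => //.
exact: (measurableT_comp (measurable_observe s) (@measurable_snd _ _ Z Om)).
Qed.

Lemma transition_le s z : `|transition_mean s f z| <= M.
Proof. by apply: pexp_le => //; exact: measurable_observe. Qed.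

Lemma wexp_observe s z : wexp z (fun w => f (w s)) = transition_mean s f z * mass z.
Proof. by rewrite /transition_mean /path_mean divfK// gt_eqF// mass_gt0. Qed.

Lemma transition_refl s x : transition_mean s f (s, x) = f x.
Proof.
rewrite /transition_mean /path_mean; apply: (mulIf (lt0r_neq0 (mass_gt0 (s, x)))).
rewrite divfK ?gt_eqF ?mass_gt0// -(wexp_cst c T K).
apply: (@wexp_start _ _ _ _ _ _ _ _ _ _ M) => //.
- exact: measurable_observe.
- by move=> w ws; rewrite ws.
Qed.

Lemma measurable_transition1 s r : measurable_fun [set: S] (fun y => transition_mean s f (r, y)).
Proof.
exact: (measurableT_comp (measurable_transition s) (@pair1_measurable _ _ R S r)).
Qed.

Lemma transition_restart s r t x : s <= r -> r <= t ->
  transition_mean s f (t, x) * mass (t, x) =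
  transition_mean s f (r, x) * mass (r, x) +
    \int[jump (t, x)]_(p in later r) (transition_mean s f p * mass p).
Proof.
move=> sr rt; rewrite -!wexp_observe.
rewrite (wexp_restart _ _ _ _ rt (measurable_observe s) (observe_le s)).
congr (_ + _); apply: eq_Rintegral => p; rewrite inE /= => rp.
rewrite -wexp_observe; congr (wexp p _); apply/funext => w.
by rewrite /= /graft_fun ifF// ltNge (le_trans sr rp).
Qed.

(** The restart equation at r is homogeneous here, and a first jump replaces B by its preimage under
    grafting, again an event of the past. The equation is therefore solved for all such events at
    once by [volterra_eq0]. *)
Lemma wexp_markov s r t x (B : set Om) : s <= r -> r <= t ->
  determined_from r B ->
  wexp (t, x) (fun w => \1_B w * (f (w s) - transition_mean s f (r, w r))) = 0.
Proof.
move=> sr rt dB.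
pose G (B : set Om) (w : Om) : R := \1_B w * (f (w s) - transition_mean s f (r, w r)).
have mdiff : measurable_fun [set: Om]
    (fun w : Om => f (w s) - transition_mean s f (r, w r)).
  apply: measurable_funB; first exact: measurable_observe.
  exact: (measurableT_comp (measurable_transition1 s r) (@measurable_eval R d S r)).
have diffM (w : Om) : `|f (w s) - transition_mean s f (r, w r)| <= M + M.
  by rewrite (le_trans (ler_normB _ _))// lerD// transition_le.
have mG B' : measurable B' -> measurable_fun [set: Om] (G B').
  by move=> mB'; apply: measurable_funM => //; exact: measurable_indic.
have GM B' w : `|G B' w| <= M + M.
  rewrite normrM -[leRHS]mul1r; apply: ler_pM => //.
  by rewrite indicE; case: (_ \in _); rewrite ?normr1 ?normr0.
pose D (B' : {B' | determined_from r B'}) (z : Z) : R :=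
  if r <= z.1 then wexp z (G (sval B')) else 0.
suff /(_ (exist _ B dB) (t, x)) : forall B' z, D B' z = 0 by rewrite /D rt.
apply: (@volterra_eq0 _ _ ((M + M) * mass_bound)).
  move=> [B' [mB' dB']] z; rewrite /D; case: ifPn => _; last first.
    by rewrite normr0 mulr_ge0 ?addr_ge0// expR_ge0.
  apply: (le_trans (wexp_le _ _ _ _ (mG _ mB') (GM _))).
  by rewrite ler_wpM2l ?addr_ge0// mass_le.
move=> n IH [B' [mB' dB']] [u y]; rewrite /D /=; case: ifPn => ru; last first.
  rewrite normr0 mulr_ge0 ?jump_bound_ge0// mulr_ge0 ?addr_ge0//; exact: expR_ge0.
rewrite (wexp_restart _ _ _ _ ru (mG _ mB') (GM _)).
(* From (r, y) the path equals y on [r, oo[, so membership in B' is the constant b, and what remains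
   is b times a mean minus itself. *)
have -> : wexp (r, y) (G B') = 0.
  pose b : R := \1_B' (cst_path R y : Om).
  transitivity (wexp (r, y) (fun w => b * (f (w s) - transition_mean s f (r, y)))).
    apply: (@wexp_start _ _ _ _ _ _ _ _ _ _ (M + M)).
    - exact: mG.
    - apply: measurable_funM => //; apply: measurable_funB => //.
      exact: measurable_observe.
    - exact: GM.
    - move=> w; rewrite normrM -[leRHS]mul1r; apply: ler_pM => //.
        by rewrite /b indicE; case: (_ \in _); rewrite ?normr1 ?normr0.
      by rewrite (le_trans (ler_normB _ _))// lerD// transition_le.
    - move=> w wr; rewrite /G /b (wr r)// !indicE; congr (_%:R * _).
      congr (nat_of_bool _).
      by apply/idP/idP; rewrite !inE; apply: dB' => q rq; rewrite wr.
  have mc (a : R) : measurable_fun [set: Om] (fun _ : Om => a) by [].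
  rewrite (@wexpZ _ _ _ _ _ _ _ _ (M + M))//; last 2 first.
  - by apply: measurable_funB => //; exact: measurable_observe.
  - by move=> w; rewrite (le_trans (ler_normB _ _))// lerD// transition_le.
  rewrite (@wexpD _ _ _ _ _ _ _ _ (fun=> - transition_mean s f (r, y)) M M)//.
  - by rewrite wexp_cst wexp_observe mulNr subrr mulr0.
  - exact: measurable_observe.
  - by move=> w; rewrite normrN transition_le.
rewrite add0r; apply: Rintegral_jump_le.
- exact: measurable_later.
- exact: (measurable_wexp_graft _ _ _ _ (mG _ mB') (GM _)).
- move=> p /= rp.
  have dg : determined_from r ((fun w => graft p.1 y w) @^-1` B').
    split.
      rewrite -[X in measurable X]setTI.
      exact: (measurable_graft1 p.1 y (@measurable_id _ Om setT)).
    move=> w w' ww'; apply: dB' => q rq /=.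
    by rewrite /graft_fun; case: ifP => // _; exact: ww'.
  have -> : (fun w => G B' (graft p.1 y w)) =
      G ((fun w => graft p.1 y w) @^-1` B').
    apply/funext => w; rewrite /G /= /graft_fun.
    by rewrite !ltNge rp (le_trans sr rp).
  by have := IH (exist _ _ dg) p; rewrite /D rp.
- by rewrite mulr_ge0 ?addr_ge0// expR_ge0.
Qed.

End BoundedFunction.

End MarkovProperty.

Lemma Rintegral_mscale d (T : measurableType d) (R : realType)
    (mu : {measure set T -> \bar R}) (k : {nonneg R}) (f : T -> R) :
  mu.-integrable setT (EFin \o f) ->
  \int[mscale k mu]_x f x = k%:num * \int[mu]_x f x.
Proof.
move=> fi; have mf : measurable_fun setT (EFin \o f) by case/integrableP: fi.
rewrite /Rintegral integralE !ge0_integral_mscale//; last 2 first.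
- exact: measurable_funeneg.
- exact: measurable_funepos.
rewrite -muleBr//; last exact: integrable_add_def.
by rewrite -integralE fineM//; exact: integrable_fin_num.
Qed.

Lemma expRN_lipschitz (R : realType) (a b : R) : 0 <= a -> a <= b ->
  `|expR (- b) - expR (- a)| <= b - a.
Proof.
move=> a0 ab; have eab : expR (- b) <= expR (- a) by rewrite ler_expR lerN2.
rewrite distrC ger0_norm ?subr_ge0//.
have -> : expR (- b) = expR (- a) * expR (a - b).
  by rewrite -expRD; congr expR; rewrite addrA addNr add0r.
rewrite -{1}[expR (- a)]mulr1 -mulrBr.
have e1 : expR (- a) <= 1 by rewrite -expR0 ler_expR oppr_le0.
have h := expR_ge1Dx (a - b).
have h2 : 0 <= 1 - expR (a - b) by rewrite subr_ge0 -expR0 ler_expR subr_le0.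
apply: (@le_trans _ _ (1 * (1 - expR (a - b)))); first by rewrite ler_wpM2r.
by rewrite mul1r; lra.
Qed.

Lemma clamp_lipschitz (R : realType) (T r t : R) : r <= t ->
  clamp_time T t - clamp_time T r <= t - r.
Proof.
by rewrite /clamp_time /Num.max /Num.min; do ! case: ifPn; rewrite -?leNgt => *; lra.
Qed.

Lemma measure_splitC d (T : measurableType d) (R : realType)
    (mu : {measure set T -> \bar R}) (A : set T) : measurable A ->
  (mu setT = mu A + mu (~` A))%E.
Proof.
move=> mA; rewrite -(setUv A) measureU//; first exact: measurableC.
by rewrite setICr.
Qed.

(** * Normalized laws and Lipschitz dependence on time *)

Section MarkovLaw.
Context (R : realType) d (S : measurableType d) (c : {posnum R}) (T : R)
  (K : R.-pker (R * S)%type ~> S).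
Local Notation Z := (R * S)%type.
Local Notation Om := (path_space R S).
Local Notation RR := (measurableTypeR R).
Local Notation jump := (jump_measure c T K).
Local Notation Q := (unnormalized_law c T K).
Local Notation clamp := (clamp_time T).
Local Notation wexp := (weighted_mean c T K).
Local Notation mass := (@total_mass R d S c T).
Local Notation mass_bound := (total_mass_bound c T).
Local Notation jump_bound := (@jump_count_bound R d S c T).
Local Notation pexp := (path_mean c T K).
Local Notation transition := (transition_mean c T K).

Let inv_mass_ge0 z : 0 <= (mass z)^-1.
Proof. by rewrite invr_ge0 mass_ge0. Qed.

Definition start_law (z : Z) : set Om -> \bar R := mscale (NngNum (inv_mass_ge0 z)) (Q z).

HB.instance Definition _ z := Measure.on (start_law z).

Let lawT z : start_law z setT = 1%E.
Proof.
rewrite /start_law /mscale unnormalized_lawT -EFinM /= mulVf// gt_eqF//.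
exact: mass_gt0.
Qed.

HB.instance Definition _ z := Measure_isProbability.Build _ Om R (start_law z) (lawT z).

Lemma measurable_law (B : set Om) : measurable B ->
  measurable_fun [set: Z] (fun z => start_law z B).
Proof.
move=> mB.
have mi : measurable_fun [set: Z] (fun z => ((mass z)^-1)%:E).
  apply/measurable_EFinP.
  apply: (@measurable_comp _ _ _ _ _ _ [set r : R | r != 0]) => //.
  - exact: open_measurable.
  - by move=> _ [p _ <-] /=; rewrite gt_eqF// mass_gt0.
  - apply: open_continuous_measurable_fun => //; apply/in_setP => x /= x0.
    exact: inv_continuous.
  - exact: measurable_mass.
have := emeasurable_funM mi (measurable_kernel Q B mB).
by apply: eq_measurable_fun.
Qed.

Lemma Rintegral_law z (G : Om -> R) (M : R) : measurable_fun [set: Om] G ->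
  (forall w, `|G w| <= M) -> \int[start_law z]_w G w = pexp z G.
Proof.
move=> mG GM; rewrite /start_law Rintegral_mscale; last exact: wexp_integrable GM.
by rewrite mulrC.
Qed.

Lemma law_integrable z (G : Om -> R) (M : R) : measurable_fun [set: Om] G ->
  (forall w, `|G w| <= M) -> (start_law z).-integrable setT (EFin \o G).
Proof.
move=> mG GM; apply: bounded_integrable GM => //=.
by rewrite probability_setT ltry.
Qed.

Section BoundedObservable.
Variables (f : S -> R) (M : R).
Hypotheses (mf : measurable_fun [set: S] f) (fM : forall y, `|f y| <= M).

Let M0 : 0 <= M. Proof. by apply: le_trans (normr_ge0 _) (fM point). Qed.

Lemma law_markov s r t x (B : set Om) : s <= r -> r <= t ->
  determined_from r B ->
  \int[start_law (t, x)]_w (\1_B w * f (w s)) =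
  \int[start_law (t, x)]_w (\1_B w * transition s f (r, w r)).
Proof.
move=> sr rt dB; have mB : measurable B by case: dB.
have mI : measurable_fun [set: Om] (\1_B : Om -> R) by exact: measurable_indic.
have IM (g : R) w : `|g| <= M -> `|\1_B w * g| <= M.
  move=> gM; rewrite normrM -[leRHS]mul1r; apply: ler_pM => //.
  by rewrite indicE; case: (_ \in _); rewrite ?normr1 ?normr0.
have m1 : measurable_fun [set: Om] (fun w => \1_B w * f (w s)).
  by apply: measurable_funM => //; exact: (measurable_observe mf s).
have m2 : measurable_fun [set: Om] (fun w => \1_B w * transition s f (r, w r)).
  apply: measurable_funM => //.
  exact: (measurableT_comp (measurable_transition1 _ _ _ mf fM s r)
    (@measurable_eval R d S r)).
have b1 w : `|\1_B w * f (w s)| <= M by exact: IM.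
have b2 w : `|\1_B w * transition s f (r, w r)| <= M.
  by apply: IM; exact: transition_le.
apply/eqP; rewrite -subr_eq0 -RintegralB//; last 2 first.
- exact: law_integrable m1 b1.
- exact: law_integrable m2 b2.
rewrite (@Rintegral_law _ _ (M + M)); last 2 first.
- exact: measurable_funB.
- by move=> w; rewrite (le_trans (ler_normB _ _))// lerD.
rewrite /path_mean; under eq_fun do rewrite -mulrBr.
by rewrite (wexp_markov _ _ _ mf fM)// mul0r.
Qed.

(** The restart equation splits the increment into the change of the normalizing factor and the
    jumps in [r, t[. Each is at most M * c * mass_bound * (t - r), whence the factor 2. *)
Lemma transition_lipschitz s r t x : s <= r -> r <= t ->
  `|transition s f (t, x) - transition s f (r, x)| <=
  2 * M * c%:num * mass_bound * (t - r).
Proof.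
move=> sr rt.
have := transition_restart c T K mf fM x sr rt.
set D := \int[_]_(_ in _) _ => eqD.
have crt : 0 <= clamp t - clamp r by rewrite subr_ge0 le_clamp.
have crt2 : clamp t - clamp r <= t - r.
  exact: clamp_lipschitz.
have mb1 : 1 <= mass_bound by apply: le_trans (mass_ge1 _ _ (t, x)) (mass_le _ _ _).
have DM : `|D| <= M * mass_bound * (c%:num * (clamp t - clamp r)).
  have mg : measurable_fun [set: Z] (fun p : Z => transition s f p * mass p).
    apply: measurable_funM; last exact: measurable_mass.
    exact: measurable_transition.
  have gM (p : Z) : `|transition s f p * mass p| <= M * mass_bound.
    rewrite normrM; apply: ler_pM => //; first exact: transition_le.
    by rewrite ger0_norm ?mass_ge0// mass_le.
  have mL := @measurable_later R d S r.
  apply: (@le_trans _ _ (\int[jump (t, x)]_(p in later r) (M * mass_bound))).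
    apply: normr_Rintegral_le => //.
    - apply: bounded_integrable gM => //; exact: jumpT_lty.
    - apply: (@bounded_integrable _ _ _ _ _ (M * mass_bound)) => //.
        exact: jumpT_lty.
      by move=> p; rewrite ger0_norm// mulr_ge0// (le_trans ler01 mb1).
  rewrite Rintegral_cst// ler_wpM2l//; first by rewrite mulr_ge0// (le_trans ler01 mb1).
  have jb := jump_before c T K x rt measurableT; rewrite setTI in jb.
  have := measure_splitC (jump (t, x)) mL.
  have := jumpT c T K (t, x); have := jumpT c T K (r, x).
  move: jb.
  move: (jump (t, x) setT) (jump (r, x) setT) (jump (t, x) (~` later r))
    (jump (t, x) (later r)) => a0 a1 a2 a3 -> -> ->.
  rewrite /jump_count_bound /exp_coeff /= !divr1 !expr1.
  by case: a3 => [a| |]//= [] ?; lra.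
have mE (q : R) : (mass (q, x))^-1 = expR (- (c%:num * clamp q)).
  by rewrite /total_mass expRN.
have -> : transition s f (t, x) - transition s f (r, x) =
    transition s f (r, x) * mass (r, x) *
      ((mass (t, x))^-1 - (mass (r, x))^-1) + D / mass (t, x).
  have mt0 : mass (t, x) != 0 by rewrite gt_eqF// mass_gt0.
  have mr0 : mass (r, x) != 0 by rewrite gt_eqF// mass_gt0.
  have -> : transition s f (t, x) = (transition s f (r, x) * mass (r, x) + D) / mass (t, x).
    by rewrite -eqD mulfK.
  rewrite mulrDl mulrBr mulfK//; move: (_ / _) (_ / _) => a b; lra.
apply: (le_trans (ler_normD _ _)).
have -> : 2 * M * c%:num * mass_bound * (t - r) =
    M * mass_bound * (c%:num * (t - r)) + M * mass_bound * (c%:num * (t - r)).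
  by ring.
have Mmb : 0 <= M * mass_bound by rewrite mulr_ge0// (le_trans ler01 mb1).
apply: lerD.
  rewrite normrM; apply: ler_pM => //.
    rewrite normrM; apply: ler_pM => //; first exact: transition_le.
    by rewrite ger0_norm ?mass_ge0// mass_le.
  rewrite !mE; apply: (le_trans (expRN_lipschitz _ _)).
  - by rewrite mulr_ge0// clamp_ge0.
  - by rewrite ler_wpM2l// le_clamp.
  - by rewrite -mulrBr ler_wpM2l.
rewrite normrM -[leRHS]mulr1; apply: ler_pM => //.
  by apply: (le_trans DM); rewrite ler_wpM2l// ler_wpM2l.
rewrite ger0_norm ?inv_mass_ge0// invf_le1 ?mass_gt0//.
exact: mass_ge1.
Qed.

End BoundedObservable.

End MarkovLaw.

Section LawProperties.
Context (R : realType) d (S : measurableType d) (c : {posnum R}) (T : R)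
  (K : R.-pker (R * S)%type ~> S).
Local Notation Z := (R * S)%type.
Local Notation Om := (path_space R S).
Local Notation RR := (measurableTypeR R).
Local Notation jump := (jump_measure c T K).
Local Notation clamp := (clamp_time T).
Local Notation mass := (@total_mass R d S c T).
Local Notation mass_bound := (total_mass_bound c T).
Local Notation jump_bound := (@jump_count_bound R d S c T).
Local Notation pexp := (path_mean c T K).
Local Notation transition := (transition_mean c T K).
Local Notation law := (start_law c T K).

Lemma Rintegral_law_le z (G : Om -> R) (M : R) : measurable_fun [set: Om] G ->
  (forall w, `|G w| <= M) -> `|\int[law z]_w G w| <= M.
Proof. by move=> mG GM; rewrite (Rintegral_law _ _ _ _ mG GM); exact: pexp_le. Qed.

Lemma law_pexp_indic z (B : set Om) : measurable B ->
  law z B = (pexp z (\1_B : Om -> R))%:E.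
Proof.
move=> mB; have mI : measurable_fun [set: Om] (\1_B : Om -> R).
  exact: measurable_indic.
have I1 w : `|(\1_B : Om -> R) w| <= 1.
  by rewrite indicE; case: (_ \in _); rewrite ?normr1 ?normr0.
rewrite (measure_integral_indic (law z) mB) -(Rintegral_law _ _ _ _ mI I1).
by rewrite EFin_Rintegral//; exact: law_integrable I1.
Qed.

Lemma law_start t x (B : set Om) : measurable B ->
  (forall w : Om, (forall q, t <= q -> w q = x) -> B w) -> law (t, x) B = 1%E.
Proof.
move=> mB Bx; rewrite law_pexp_indic//; congr (_%:E).
rewrite /path_mean (@wexp_start _ _ _ _ _ _ _ _ _ (fun=> 1) 1)//.
- by rewrite wexp_cst mul1r mulfV// gt_eqF// mass_gt0.
- by move=> w; rewrite indicE; case: (_ \in _); rewrite ?normr1 ?normr0.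
- by move=> w; rewrite normr1.
- by move=> w wt; rewrite indicE mem_set//; exact: Bx.
Qed.

(** By the Markov property both terms are means over the state y at time r: of the mean of [f] at s
    from (r, y), and of f y, which is the same mean from (s, y). The Lipschitz bound in the start
    time concludes. *)
Lemma transition_lipschitz_observe (f : S -> R) (M : R) s r t x :
  measurable_fun [set: S] f -> (forall y, `|f y| <= M) -> s <= r -> r <= t ->
  `|transition s f (t, x) - transition r f (t, x)| <=
  2 * M * c%:num * mass_bound * (r - s).
Proof.
move=> mf fM sr rt.
have mo q := measurable_observe mf q.
have m1 : measurable_fun [set: Om] (fun w : Om => transition s f (r, w r)).
  exact: (measurableT_comp (measurable_transition1 _ _ _ mf fM s r)
    (@measurable_eval R d S r)).
have b1 (w : Om) : `|transition s f (r, w r)| <= M by exact: transition_le.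
have oM q (w : Om) : `|f (w q)| <= M by [].
have dT : determined_from r [set: Om] by split.
have -> : transition s f (t, x) = \int[law (t, x)]_w transition s f (r, w r).
  rewrite /transition_mean -(Rintegral_law _ _ _ _ (mo s) (oM s)).
  have := law_markov c T K mf fM x sr rt dT.
  under eq_Rintegral do rewrite indicT mul1r.
  by under [X in _ = X -> _]eq_Rintegral do rewrite indicT mul1r.
rewrite {2}/transition_mean -(Rintegral_law _ _ _ _ (mo r) (oM r)).
rewrite -RintegralB//; last 2 first.
- exact: law_integrable b1.
- exact: law_integrable (oM r).
apply: Rintegral_law_le; first exact: measurable_funB.
move=> w; rewrite -(transition_refl c T K mf fM s (w r)).
exact: transition_lipschitz.
Qed.

(** The unknown is set to 0 away from [x]. Since [K] does not leave [x], jumps to other places are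
    negligible and the restart equation at [x] closes on this unknown. *)
Lemma transition_absorbing s t x : measurable [set x] ->
  (forall u, K (u, x) [set x] = 1%E) -> s <= t ->
  transition s (\1_(~` [set x]) : S -> R) (t, x) = 0.
Proof.
move=> mx Kx st; set f : S -> R := \1_(~` [set x]).
have mf : measurable_fun [set: S] f by apply: measurable_indic; exact: measurableC.
have fM y : `|f y| <= 1.
  by rewrite /f indicE; case: (_ \in _); rewrite ?normr1 ?normr0.
pose D (_ : unit) (z : Z) : R :=
  if (z.2 == x) && (s <= z.1) then transition s f z * mass z else 0.
have mg : measurable_fun [set: Z] (fun p : Z => transition s f p * mass p).
  apply: measurable_funM; last exact: measurable_mass.
  exact: measurable_transition mf fM _.
have gM (p : Z) : `|transition s f p * mass p| <= mass_bound.
  rewrite normrM -[leRHS]mul1r; apply: ler_pM => //; first exact: transition_le.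
  by rewrite ger0_norm ?mass_ge0// mass_le.
suff /(_ tt (t, x)) : forall i z, D i z = 0.
  rewrite /D /= eqxx st /= => /eqP; rewrite mulf_eq0 (gt_eqF (mass_gt0 _ _ _)) orbF.
  by move/eqP.
apply: (@volterra_eq0 _ _ _ c T _ _ mass_bound).
  by move=> [] z; rewrite /D; case: ifPn => _ //; rewrite normr0 expR_ge0.
move=> n IH [] [u y]; rewrite {1}/D /=.
case: ifPn => [/andP[/eqP -> su]|_]; last first.
  by rewrite normr0 mulr_ge0 ?jump_bound_ge0 ?expR_ge0.
rewrite (transition_restart _ _ _ mf fM _ (lexx s) su).
have fx0 : f x = 0 by rewrite /f indicE memNset//= => /(_ erefl).
rewrite (transition_refl _ _ _ mf fM) fx0 mul0r add0r.
pose N : set Z := [set p | p.2 != x].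
have mN : measurable N.
  have := (@measurable_snd _ _ R S) measurableT _ (measurableC mx).
  rewrite setTI; congr measurable; apply/seteqP; split => p /=; first by move/eqP.
  by move/eqP.
have N0 : jump (u, x) N = 0%E.
  rewrite (measure_integral_indic _ mN) ge0_integral_jump//; last first.
    by apply/measurable_EFinP; exact: measurable_indic.
  rewrite integral0_eq ?mule0// => v _.
  have -> : (\int[K (v, x)]_y0 (\1_N (v, y0) : R)%:E = K (v, x) (~` [set x]))%E.
    rewrite (measure_integral_indic (K (v, x)) (measurableC mx)).
    apply: eq_integral => y0 _; rewrite !indicE; congr (_%:R)%:E.
    by congr nat_of_bool; apply/idP/idP; rewrite !inE /N /= => /eqP.
  have := measure_splitC (K (v, x)) mx; rewrite prob_kernel Kx.
  by case: (K (v, x) (~` [set x])) => [a| |]//= [] ?; congr (_%:E); lra.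
have mL := @measurable_later R d S s.
have mg' : measurable_fun [set: Z] (fun p : Z => transition s f p * mass p * \1_(~` N) p).
  apply: measurable_funM => //; apply: measurable_indic; exact: measurableC.
have -> : \int[jump (u, x)]_(p in later s) (transition s f p * mass p) =
    \int[jump (u, x)]_(p in later s) (transition s f p * mass p * \1_(~` N) p).
  rewrite /Rintegral; congr fine.
  rewrite (negligible_integral mN mL _ N0); last first.
    by apply: bounded_integrable gM => //; exact: jumpT_lty.
  rewrite [RHS](negligible_integral mN mL _ N0); last first.
    apply: (@bounded_integrable _ _ _ _ _ mass_bound) => //; first exact: jumpT_lty.
    move=> p; rewrite normrM -[leRHS]mulr1; apply: ler_pM => //.
    by rewrite indicE; case: (_ \in _); rewrite ?normr1 ?normr0.
  apply: eq_integral => p; rewrite inE => -[_ Np].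
  by rewrite indicE mem_set//= mulr1.
apply: Rintegral_jump_le => //; last exact: expR_ge0.
move=> p /= sp; rewrite indicE.
case: (boolP (p \in ~` N)) => [|_]; last by rewrite mulr0 normr0 mulr_ge0 ?jump_bound_ge0 ?expR_ge0.
rewrite inE /N /= => /negP; rewrite negbK => /eqP px.
by have := IH tt p; rewrite /D px eqxx sp mulr1.
Qed.

Lemma Rintegral_jump_later s t x (g : Z -> R) (M : R) : 0 <= s -> s <= t ->
  t <= T -> measurable_fun [set: Z] g -> (forall p, `|g p| <= M) ->
  \int[jump (t, x)]_(p in later s) g p =
  c%:num * \int[lebesgue_measure]_(u in `[s, t]) \int[K (u, x)]_y g (u, y).
Proof.
move=> s0 st tT.
have mS (h : Z -> R) (u : RR) : measurable_fun [set: Z] h ->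
    measurable_fun [set: S] (fun y => h (u : R, y)).
  by move=> mh; exact: (measurableT_comp mh (@pair1_measurable _ _ R S u)).
have KT u : (K (u, x) setT < +oo)%E by rewrite prob_kernel ltry.
have Kint (h : Z -> R) (N : R) (u : R) : measurable_fun [set: Z] h -> (forall p, `|h p| <= N) ->
    (K (u, x)).-integrable setT (EFin \o (fun y => h (u, y))).
  by move=> mh hN; apply: (@bounded_integrable _ _ _ _ _ N) => //; exact: mS.
have mRR : measurable_fun [set: RR] (fun u : RR => (u : R, x)).
  exact: measurable_fun_pair.
have mRS : measurable_fun [set: RR * S] (fun p : RR * S => (p.1 : R, p.2)).
  apply: measurable_fun_pair; last exact: measurable_snd.
  have mi : measurable_fun [set: RR] (id : RR -> R).
    by move=> _ B mB; rewrite setTI preimage_id.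
  exact: (measurableT_comp mi (@measurable_fst _ _ RR S)).
have mI0 (h : Z -> R) : measurable_fun [set: Z] h -> (forall p, 0 <= h p) ->
    measurable_fun [set: RR] (fun u : RR => \int[K (u, x)]_y h (u : R, y)).
  move=> mh h0; apply: (measurableT_comp (@fine_measurable R setT measurableT)).
  apply: (@measurable_integral_sfker _ _ _ RR S (kernel_precomp K mRR)
    (fun p : RR * S => (h (p.1 : R, p.2))%:E)); first by move=> p; rewrite lee_fin.
  by apply/measurable_EFinP; exact: (measurableT_comp mh mRS).
have Ile (h : Z -> R) (N : R) (u : R) : measurable_fun [set: Z] h -> (forall p, `|h p| <= N) ->
    `|\int[K (u, x)]_y h (u, y)| <= N.
  move=> mh hN; have N0 : 0 <= N by apply: le_trans (normr_ge0 _) (hN point).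
  apply: (@le_trans _ _ (\int[K (u, x)]_y N)).
    apply: normr_Rintegral_le => //; first exact: Kint hN.
    by apply: (Kint (fun=> N) N) => // p; rewrite ger0_norm.
  by rewrite Rintegral_cst// prob_kernel mulr1.
have lebint (h : RR -> R) (N : R) : measurable_fun [set: RR] h -> (forall p, `|h p| <= N) ->
    (lebesgue_measure : {measure set RR -> \bar R}).-integrable `[s, t] (EFin \o h).
  move=> mh hN; apply: measurable_bounded_integrable => //.
  - change ((lebesgue_measure : set RR -> \bar R) [set` `[s, t]] < +oo)%E.
    by rewrite lebesgue_measure_itv/=; case: ifPn => // _; exact: ltry.
  - exact: measurable_funTS.
  - exists N; split => [|y Ny u _ /=]; first exact: num_real.
    exact: le_trans (hN u) (ltW Ny).
have nonneg (h : Z -> R) (N : R) : measurable_fun [set: Z] h -> (forall p, `|h p| <= N) ->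
    (forall p, 0 <= h p) ->
    \int[jump (t, x)]_(p in later s) h p =
    c%:num * \int[lebesgue_measure]_(u in `[s, t]) \int[K (u, x)]_y h (u, y).
  move=> mh hN h0.
  have I0 u : 0 <= \int[K (u, x)]_y h (u, y) by apply: Rintegral_ge0 => y _.
  have iI := lebint _ N (mI0 _ mh h0) (fun u => Ile _ _ u mh hN).
  rewrite Rintegral_mkcond.
  pose h' : Z -> R := h \_ (later s).
  have h'0 p : (0 <= (h' p)%:E)%E by rewrite lee_fin /h' patchE; case: ifPn.
  have mh' : measurable_fun [set: Z] (EFin \o h').
    apply/measurable_EFinP/(measurable_restrictT _ _).1; last exact: measurable_funTS.
    exact: measurable_later.
  rewrite -/h' /Rintegral (ge0_integral_jump _ _ _ _ mh' h'0).
  rewrite (_ : (\int[lebesgue_measure]_(u in jump_window T (t, x))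
      \int[K (u, (t, x).2)]_y (EFin \o h') (u, y))%E =
    (\int[lebesgue_measure]_(u in `[s, t]) (\int[K (u, x)]_y h (u, y))%R%:E)%E).
    by rewrite fineM//; exact: integrable_fin_num.
  (* The jump window is half-open while the segment is closed; the endpoint is a null set. *)
  rewrite -integral_itv_bndo_bndc; last first.
    by apply/measurable_EFinP; apply: measurable_funTS; exact: (mI0 _ mh h0).
  rewrite integral_mkcond [RHS]integral_mkcond; apply: eq_integral => u _.
  rewrite !patchE /jump_window !mem_setE/= !in_itv/= clamp_id ?(le_trans s0 st)//.
  have [su|us] := leP s u; last first.
    rewrite andFb; case: ifPn => // _; rewrite integral0_eq// => y _.
    by rewrite /h' patchE memNset//= /later /= => /(lt_le_trans us); rewrite ltxx.
  rewrite (le_trans s0 su)/=; case: ifPn => // _.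
  rewrite EFin_Rintegral//; last exact: Kint hN.
  by apply: eq_integral => y _; rewrite /h' /= patchE mem_set.
move=> mg gM.
have M0 : 0 <= M by apply: le_trans (normr_ge0 _) (gM point).
have MM (p : Z) : `|(fun=> M) p| <= M by rewrite ger0_norm.
have mM : measurable_fun [set: Z] (fun _ : Z => M) by [].
have mgM : measurable_fun [set: Z] (fun p => g p + M) by exact: measurable_funD.
have gM0 p : 0 <= g p + M.
  by have := gM p; rewrite ler_norml => /andP[H _]; rewrite -lerBlDr sub0r.
have gMM p : `|g p + M| <= M + M.
  by rewrite (le_trans (ler_normD _ _))// lerD// ger0_norm.
have iJ (h : Z -> R) : measurable_fun [set: Z] h -> (forall p, `|h p| <= M) ->
    (jump (t, x)).-integrable (later s) (EFin \o h).
  move=> mh hM; apply: bounded_integrable hM => //; last exact: jumpT_lty.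
  exact: measurable_later.
have := nonneg _ _ mgM gMM gM0; have := nonneg _ _ mM MM (fun=> M0).
rewrite (RintegralD (@measurable_later R d S s) (iJ _ mg gM) (iJ _ mM MM)).
move=> ->.
have -> : \int[lebesgue_measure]_(u in `[s, t]) \int[K (u, x)]_y (g (u, y) + M) =
    \int[lebesgue_measure]_(u in `[s, t])
      (\int[K (u, x)]_y g (u, y) + \int[K (u, x)]_y M).
  apply: eq_Rintegral => u _.
  by rewrite (RintegralD measurableT (Kint _ _ u mg gM) (Kint _ _ u mM MM)).
have mIg : measurable_fun [set: RR] (fun u : RR => \int[K (u, x)]_y g (u : R, y)).
  have -> : (fun u : RR => \int[K (u, x)]_y g (u : R, y)) =
      (fun u : RR => \int[K (u, x)]_y (g (u : R, y) + M) - M).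
    apply/funext => u.
    rewrite (RintegralD measurableT (Kint _ _ u mg gM) (Kint _ _ u mM MM)).
    by rewrite Rintegral_cst// prob_kernel mulr1 addrK.
  by apply: measurable_funB => //; exact: (mI0 _ mgM gM0).
rewrite RintegralD//; last 2 first.
- exact: (lebint _ M mIg (fun u => Ile _ _ u mg gM)).
- exact: (lebint _ M (mI0 _ mM (fun=> M0)) (fun u => Ile _ _ u mM MM)).
by rewrite mulrDr => /addIr.
Qed.

End LawProperties.

(** * Discretized stopping times *)

Section DyadicTimes.
Context (R : realType) (T : R).

(** Cells of mesh 1 / (n + 1). A time is rounded to the right endpoint of its cell, which is
    strictly later unless capped by T; this margin absorbs the right-continuous enlargement of the
    filtration. The meshes are not nested, so rounded times converge from above without being
    monotone in n. *)
Definition cell (n : nat) (v : R) : nat := Num.truncn (v * n.+1%:R).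

Definition grid (n k : nat) : R := Num.min (k.+1%:R / n.+1%:R) T.

Definition round_up (n : nat) (v : R) : R := grid n (cell n v).

Let n0 (n : nat) : 0 < n.+1%:R :> R. Proof. by rewrite ltr0n. Qed.

Lemma cellP n k v : 0 <= v ->
  (cell n v == k) = (k%:R / n.+1%:R <= v < k.+1%:R / n.+1%:R).
Proof.
move=> v0; rewrite /cell truncn_eq; last by rewrite mulr_ge0.
by rewrite ler_pdivrMr// ltr_pdivlMr.
Qed.

Lemma le_round_up n v : 0 <= v -> v <= T -> v <= round_up n v.
Proof.
move=> v0 vT; have := eqxx (cell n v); rewrite cellP// => /andP[_ /ltW h].
by rewrite /round_up /grid le_min h vT.
Qed.

Lemma round_up_le n v : 0 <= v -> round_up n v <= v + n.+1%:R^-1.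
Proof.
move=> v0; have := eqxx (cell n v); rewrite cellP// => /andP[h _].
rewrite /round_up /grid ge_min; apply/orP; left.
by rewrite -natr1 mulrDl mul1r lerD2r.
Qed.

Lemma round_up_cvg (v e : R) : 0 <= v -> v <= T -> 0 < e ->
  \forall n \near \oo, v <= round_up n v < v + e.
Proof.
move=> v0 vT e0; near=> n; rewrite le_round_up//=.
apply: (le_lt_trans (round_up_le n v0)); rewrite ltrD2l.
by near: n; exact: near_infty_natSinv_lt (PosNum e0).
Unshelve. all: by end_near. Qed.

Lemma grid_le n k l : (k <= l)%N -> grid n k <= grid n l.
Proof.
move=> kl; rewrite /grid le_min ge_min ge_min lexx orbT andbT.
by rewrite ler_wpM2r ?invr_ge0 ?(ltW (n0 n))// ler_nat ltnS kl.
Qed.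

Lemma cell_le n u v : 0 <= u -> u <= v -> (cell n u <= cell n v)%N.
Proof.
move=> u0 uv; rewrite /cell truncn_ge_nat.
  by apply: le_trans (_ : u * n.+1%:R <= _);
    [case/andP: (truncn_itv (mulr_ge0 u0 (ltW (n0 n))))|rewrite ler_wpM2r].
by rewrite mulr_ge0// (le_trans u0 uv).
Qed.

End DyadicTimes.

Lemma g_sigma_algebraI (T : pointedType) (G : set (set T)) (A B : set T) :
  <<s G >> A -> <<s G >> B -> <<s G >> (A `&` B).
Proof. exact: (@measurableI _ (g_sigma_algebraType G) A B). Qed.

Lemma g_sigma_algebraD (T : pointedType) (G : set (set T)) (A B : set T) :
  <<s G >> A -> <<s G >> B -> <<s G >> (A `\` B).
Proof. exact: (@measurableD _ (g_sigma_algebraType G) A B). Qed.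

Lemma g_sigma_algebra0 (T : pointedType) (G : set (set T)) : <<s G >> set0.
Proof. exact: (@measurable0 _ (g_sigma_algebraType G)). Qed.

Lemma g_sigma_algebra_le (R : realType) (T : pointedType) (G : set (set T))
    (D : set T) (f : T -> R) :
  <<s G >> D -> (forall b, <<s G >> (D `&` [set o | f o <= b])) ->
  forall C, measurable C -> <<s G >> (D `&` f @^-1` C).
Proof.
move=> GD Gf C mC.
suff : measurable_fun (D : set (g_sigma_algebraType G))
    (f : g_sigma_algebraType G -> R) by apply.
apply: (measurability _ (RGenOInfty.measurableE R)).
move=> _ [_ [b ->] <-].
have -> : D `&` f @^-1` `]b, +oo[ = D `\` (D `&` [set o | f o <= b]).
  apply/seteqP; split => o /=; rewrite in_itv/= andbT.
    by move=> [Do bf]; split => // -[_]; rewrite leNgt bf.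
  by move=> [Do nn]; split => //; rewrite ltNge; apply/negP => fb; exact: nn.
exact: g_sigma_algebraD.
Qed.

Lemma g_sigma_algebra_cvg (R : realType) (T : pointedType) (G : set (set T))
    (D : set T) (h : nat -> T -> R) (f : T -> R) :
  <<s G >> D ->
  (forall n C, measurable C -> <<s G >> (D `&` h n @^-1` C)) ->
  (forall x, D x -> h n x @[n --> \oo] --> f x) ->
  forall C, measurable C -> <<s G >> (D `&` f @^-1` C).
Proof.
move=> GD Gh hf C mC.
suff : measurable_fun (D : set (g_sigma_algebraType G))
    (f : g_sigma_algebraType G -> R) by apply.
apply: (@measurable_fun_cvg _ (g_sigma_algebraType G) R D h) => // m.
by move=> _; exact: Gh.
Qed.

(** * The coordinate process and its stopped sigma-algebras *)

Section CoordinateProcess.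
Context (R : realType) (E : topologicalType) (T : R).
Local Notation ED := (one_point_compactification E).
Local Notation S := (borel_space ED).
Local Notation Om := (path_space R S).

Definition position_at (t : R) (w : Om) : with_cemetery E := w t.
Local Notation Y := (fun r => position_at (T - r)).

Lemma position_right (w : Om) (v : R) :
  exists2 e, 0 < e & forall q, v <= q < v + e -> Y q w = Y v w.
Proof.
have [[e e0 we] _] := path_step w (T - v); exists e => // q qv.
by apply: we; lra.
Qed.

Lemma position_left (w : Om) (v : R) :
  exists2 e, 0 < e & exists y, forall q, v - e < q < v -> Y q w = y.
Proof.
have [_ [e e0 [y wy]]] := path_step w (T - v); exists e => //; exists y => q qv.
by apply: wy; lra.
Qed.

Lemma sigma_of_sub (X : R -> Om -> ED) (I J : set R) : I `<=` J ->
  sigma_of X I `<=` sigma_of X J.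
Proof.
move=> IJ; apply: smallest_sub; first exact: smallest_sigma_algebra.
move=> A [q Iq HA]; apply: sub_sigma_algebra; exists q => //; exact: IJ.
Qed.

(** [time] is the identity for [X] and [T - q] for the reversed process. Complements are harmless
    because the invariance is symmetric in the two paths. *)
Lemma sigma_of_determined (time : R -> R) (I : set R) r :
  (forall q, I q -> r <= time q) ->
  sigma_of (fun q => position_at (time q)) I `<=` determined_from r.
Proof.
move=> Ir; apply: smallest_sub.
  split.
  - by split=> [|w w' ww']; [exact: measurable0|].
  - move=> A [mA dA]; split; first exact: measurableD.
    move=> w w' ww' [_ nAw]; split => // Aw'; apply: nAw; apply: dA Aw' => q rq.
    by rewrite ww'.
  - move=> F FF; split; first by apply: bigcupT_measurable => n; case: (FF n).
    move=> w w' ww' [n _ Fw]; exists n => //.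
    by case: (FF n) => _; apply; [exact: ww'|].
move=> A [q Iq [B mB <-]]; split; first exact: (@measurable_eval R _ S (time q)).
by move=> w w' ww' [_ Bw]; split => //; move: Bw; rewrite /= /position_at ww'//; exact: Ir.
Qed.

Lemma sigma_of_position (X : R -> Om -> ED) (I : set R) q (B : set ED) : I q ->
  borel ED B -> sigma_of X I (X q @^-1` B).
Proof.
by move=> Iq mB; apply: sub_sigma_algebra; exists q => //; exists B; rewrite ?setTI.
Qed.

End CoordinateProcess.

Section StoppingTimes.
Context (R : realType) (E : topologicalType) (T a : R).
Hypotheses (a0 : 0 <= a) (aT : a <= T).
Local Notation ED := (one_point_compactification E).
Local Notation S := (borel_space ED).
Local Notation Om := (path_space R S).
Local Notation Y := (fun r => @position_at R E (T - r)).
Local Notation F r := (sigma_of Y [set q | a <= q <= r]).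

Lemma F_le r r' : r <= r' -> F r `<=` F r'.
Proof.
by move=> rr'; apply: sigma_of_sub => q /andP[aq qr]; rewrite /= aq (le_trans qr).
Qed.

Lemma F_measurable r (A : set Om) : F r A -> measurable A.
Proof.
move=> FA; suff : determined_from (T - r) A by case.
apply: (@sigma_of_determined R E (fun q => T - q) _ (T - r)) FA => q /andP[_ qr].
by rewrite lerD2l lerN2.
Qed.

Lemma filtration_plusI r (A B : set Om) : filtration_plus T Y a r A ->
  filtration_plus T Y a r B -> filtration_plus T Y a r (A `&` B).
Proof.
move=> FA FB e e0.
exact: g_sigma_algebraI (FA e e0) (FB e e0).
Qed.

Variable tau : Om -> R.
Hypothesis st : stopping_time T Y a tau.

Let at_ o : a <= tau o <= T. Proof. by case: st => + _; apply. Qed.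
Let tau0 o : 0 <= tau o. Proof. by case/andP: (at_ o) => h _; exact: le_trans h. Qed.
Let tauT o : tau o <= T. Proof. by case/andP: (at_ o). Qed.

Lemma stopped_sigmaI (A B : set Om) : stopped_sigma T Y a tau A ->
  stopped_sigma T Y a tau B -> stopped_sigma T Y a tau (A `&` B).
Proof.
move=> HA HB r ar; rewrite setIIl.
exact: filtration_plusI (HA r ar) (HB r ar).
Qed.

Lemma stopped_sigma_measurable (A : set Om) : stopped_sigma T Y a tau A ->
  measurable A.
Proof.
move=> /(_ T aT 1 ltr01) /F_measurable; congr measurable.
by apply/seteqP; split => o /=; [case|move=> Ao; split].
Qed.

Lemma stopping_time_stopped :
  measurable_wrt (stopped_sigma T Y a tau) (measurable : set (set R)) tau.
Proof.
move=> _ [C mC <-]; rewrite setTI => r ar e e0 /=.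
pose Fe := F (Num.min (r + e) T).
have m b : Fe ([set o | tau o <= r] `&` [set o | tau o <= b]).
  (* The condition on [tau] is available from time a on; below a the event is empty. *)
  have [ba|ab] := ltP (Num.min b r) a.
    have -> : [set o | tau o <= r] `&` [set o | tau o <= b] = set0.
      apply/seteqP; split => // o [/= tr tb].
      have : tau o <= Num.min b r by rewrite le_min tb.
      by case/andP: (at_ o) => h _ h2; move: (le_trans h h2); rewrite leNgt ba.
    exact: g_sigma_algebra0.
  have -> : [set o | tau o <= r] `&` [set o | tau o <= b] =
      [set o | tau o <= Num.min b r].
    apply/seteqP; split => o /=; first by rewrite le_min => -[-> ->].
    by rewrite le_min => /andP[].
  apply: F_le (st.2 _ ab e e0).
  by rewrite le_min ge_min lerD2r ge_min lexx orbT/= ge_min lexx orbT.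
have mr : Fe [set o | tau o <= r] by have := m r; rewrite setIid.
rewrite setIC; exact: g_sigma_algebra_le.
Qed.

(* On the cell [I_k = [k/(n+1), (k+1)/(n+1)[] the time [tau] stays strictly
   below the right endpoint, so no information after [grid n k] is used. *)
Lemma stopped_sigma_cell (A : set Om) n k : stopped_sigma T Y a tau A ->
  F (grid T n k) (A `&` [set o | cell n (tau o) = k]).
Proof.
move=> HA.
have HB : stopped_sigma T Y a tau (A `&` [set o | cell n (tau o) = k]).
  apply: stopped_sigmaI => //.
  have := stopping_time_stopped.
  move=> /(_ (tau @^-1` `[k%:R / n.+1%:R, k.+1%:R / n.+1%:R[%classic)).
  move=> H; have : stopped_sigma T Y a tau
      (tau @^-1` `[k%:R / n.+1%:R, k.+1%:R / n.+1%:R[%classic).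
    by apply: H; exists (`[k%:R / n.+1%:R, k.+1%:R / n.+1%:R[%classic); rewrite ?setTI.
  congr (stopped_sigma T Y a tau _); apply/seteqP; split => o /=.
    by rewrite in_itv/= -cellP// => /eqP.
  by rewrite in_itv/= -cellP// => /eqP.
set B := A `&` _ in HB *.
pose q : R := k.+1%:R / n.+1%:R.
have -> : B = \bigcup_m (B `&` [set o | tau o <= q - m.+1%:R^-1]).
  apply/seteqP; split => o; last by case=> m _ [].
  move=> Bo.
  have : tau o < q.
    by case: Bo => _ /= /eqP; rewrite cellP// => /andP[].
  rewrite -subr_gt0 => tq.
  have [m _ mq] := near_infty_natSinv_lt (PosNum tq).
  exists m => //; split => //=.
  by have := mq m (leqnn m); rewrite lerBrDr -lerBrDl => /ltW.
apply: sigma_algebra_bigcup => m.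
have [qa|aq] := ltP (q - m.+1%:R^-1) a.
  have -> : B `&` [set o | tau o <= q - m.+1%:R^-1] = set0.
    apply/seteqP; split => // o [_ /= tq].
    by case/andP: (at_ o) => h _; move: (le_trans h tq); rewrite leNgt qa.
  exact: g_sigma_algebra0.
have m0 : 0 < m.+1%:R^-1 :> R by rewrite invr_gt0 ltr0n.
by have := HB _ aq _ m0; rewrite /= subrK.
Qed.

Section TwoTimes.
Variable sigma : Om -> R.
Hypothesis sg : forall o, tau o <= sigma o <= T.
Hypothesis sm : measurable_wrt (stopped_sigma T Y a tau)
  (measurable : set (set R)) sigma.

Let sigma0 o : 0 <= sigma o.
Proof. by case/andP: (sg o) => h _; exact: le_trans (tau0 o) h. Qed.
Let sigmaT o : sigma o <= T. Proof. by case/andP: (sg o). Qed.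

Lemma stopped_sigma_cell2 n l :
  stopped_sigma T Y a tau [set o | cell n (sigma o) = l].
Proof.
have : stopped_sigma T Y a tau
    (sigma @^-1` `[l%:R / n.+1%:R, l.+1%:R / n.+1%:R[%classic).
  by apply: sm; exists (`[l%:R / n.+1%:R, l.+1%:R / n.+1%:R[%classic); rewrite ?setTI.
congr (stopped_sigma T Y a tau _); apply/seteqP; split => o /=;
  by rewrite in_itv/= -cellP// => /eqP.
Qed.

(** The expression is the limit of its values at rounded times. On the event tau <= r these involve
    the path up to r + e only, once the mesh is below e; as e is arbitrary, the limit lies in the
    right-continuous filtration. *)
Lemma measurable_stopped (psi : R -> R -> S -> R) :
  (forall u v, measurable_fun [set: S] (psi u v)) ->
  (forall u v y, a <= u -> u <= v -> v <= T ->
    psi (round_up T n u) (round_up T n v) y @[n --> \oo] --> psi u v y) ->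
  measurable_wrt (stopped_sigma T Y a tau) (measurable : set (set R))
    (fun o => psi (tau o) (sigma o) (Y (tau o) o)).
Proof.
move=> mpsi cpsi _ [C mC <-]; rewrite setTI => r ar e e0.
pose Fe := F (Num.min (r + e) T).
have plus A : filtration_plus T Y a r A -> Fe A by move=> /(_ e e0).
set D := [set o | tau o <= r].
have mD : Fe D by apply: plus; exact: st.2.
rewrite setIC; move: C mC.
have [n0 _ n0e] := near_infty_natSinv_lt (PosNum e0).
apply: (@g_sigma_algebra_cvg R _ _ _ (fun n o =>
    psi (round_up T (n + n0) (tau o)) (round_up T (n + n0) (sigma o))
      (Y (round_up T (n + n0) (tau o)) o))) => //; last first.
  move=> o _.
  have [e1 e10 He1] := position_right T o (tau o).
  case/andP: (at_ o) => h1 h2; case/andP: (sg o) => h3 h4.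
  have cv : psi (round_up T n (tau o)) (round_up T n (sigma o))
      (Y (round_up T n (tau o)) o) @[n --> \oo] -->
      psi (tau o) (sigma o) (Y (tau o) o).
    apply: cvg_trans (cpsi _ _ _ h1 h3 h4); apply: near_eq_cvg.
    near=> n; congr psi; apply/esym; apply: He1.
    by near: n; exact: round_up_cvg.
  by rewrite -(cvg_shiftn n0) in cv.
move=> m B mB; set n := (m + n0)%N.
have -> : D `&` (fun o => psi (round_up T n (tau o)) (round_up T n (sigma o))
      (Y (round_up T n (tau o)) o)) @^-1` B =
    \bigcup_k \bigcup_l
      ((D `&` [set o | cell n (tau o) = k] `&` [set o | cell n (sigma o) = l]) `&`
      (fun o => psi (grid T n k) (grid T n l) (Y (grid T n k) o)) @^-1` B).
  apply/seteqP; split => o.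
    by move=> [Do Bo]; exists (cell n (tau o)) => //; exists (cell n (sigma o)).
  by move=> [k _ [l _ [[[Do /= <-] <-] Bo]]].
apply: sigma_algebra_bigcup => k; apply: sigma_algebra_bigcup => l.
(* Cells ending after min (r + e, T) do not meet tau <= r, and cells ending before a contain no
   value of [tau]. At every other endpoint the position is known to [Fe]. *)
have [qr|rq] := leP (grid T n k) (Num.min (r + e) T); last first.
  have -> : D `&` [set o | cell n (tau o) = k] = set0.
    apply/seteqP; split => // o [/= tr /eqP].
    rewrite cellP// => /andP[k1 _]; move: rq; apply/negP; rewrite -leNgt le_min.
    apply/andP; split; last by rewrite /grid ge_min lexx orbT.
    rewrite /grid ge_min; apply/orP; left.
    have : n.+1%:R^-1 < e.
      by apply: n0e; rewrite /= /n leq_addl.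
    rewrite -[k.+1%:R]natr1 mulrDl mul1r => ne; apply: lerD (ltW ne).
    exact: le_trans k1 tr.
  by rewrite !set0I; exact: g_sigma_algebra0.
have [ka|ak] := ltP (grid T n k) a.
  have -> : D `&` [set o | cell n (tau o) = k] = set0.
    apply/seteqP; split => // o [_ /= /eqP].
    rewrite cellP// => /andP[_ k2]; move: ka; apply/negP; rewrite -leNgt.
    rewrite /grid le_min aT andbT; case/andP: (at_ o) => h _.
    exact: le_trans h (ltW k2).
  by rewrite !set0I; exact: g_sigma_algebra0.
apply: g_sigma_algebraI.
  have -> : D `&` [set o | cell n (tau o) = k] `&` [set o | cell n (sigma o) = l] =
      ([set o | cell n (tau o) = k] `&` D) `&` ([set o | cell n (sigma o) = l] `&` D).
    by rewrite setIACA setIid -setIA setIC -setIA.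
  apply: g_sigma_algebraI.
    apply: plus; have := stopping_time_stopped.
    move=> /(_ (tau @^-1` `[k%:R / n.+1%:R, k.+1%:R / n.+1%:R[%classic)).
    move=> H; have : stopped_sigma T Y a tau
        (tau @^-1` `[k%:R / n.+1%:R, k.+1%:R / n.+1%:R[%classic).
      by apply: H; exists (`[k%:R / n.+1%:R, k.+1%:R / n.+1%:R[%classic); rewrite ?setTI.
    move=> /(_ r ar); congr (filtration_plus T Y a r (_ `&` _)).
    by apply/seteqP; split => o /=; rewrite in_itv/= -cellP// => /eqP.
  by apply: plus; exact: stopped_sigma_cell2.
have -> : (fun o => psi (grid T n k) (grid T n l) (Y (grid T n k) o)) @^-1` B =
    Y (grid T n k) @^-1` (psi (grid T n k) (grid T n l) @^-1` B) by [].
apply: sigma_of_position; first by rewrite /= ak qr.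
by have := mpsi (grid T n k) (grid T n l) measurableT B mB; rewrite setTI.
Unshelve. all: by end_near. Qed.

End TwoTimes.

End StoppingTimes.

Section IntegralTools.
Context d (T : measurableType d) (R : realType) (mu : {measure set T -> \bar R}).

Lemma Rintegral_indicE (A : set T) (h : T -> R) :
  \int[mu]_(x in A) h x = \int[mu]_x (\1_A x * h x).
Proof.
rewrite Rintegral_mkcond; apply: eq_Rintegral => x _.
by rewrite patchE indicE; case: (_ \in _); rewrite ?mul1r ?mul0r.
Qed.

Lemma integral_cells0 (B : set T) (cl : T -> nat) (f : T -> R) :
  (forall k, measurable (B `&` [set x | cl x = k])) ->
  mu.-integrable B (EFin \o f) ->
  (forall k, \int[mu]_(x in B `&` [set x | cl x = k]) f x = 0) ->
  \int[mu]_(x in B) f x = 0.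
Proof.
move=> mB fi f0.
have BE : B = \bigcup_k (B `&` [set x | cl x = k]).
  by apply/seteqP; split => x; [move=> Bx; exists (cl x)|case=> k _ []].
have tB : trivIset setT (fun k => B `&` [set x | cl x = k]).
  by move=> i j _ _ [x [[_ /= <-] [_ /= <-]]].
rewrite /Rintegral [in LHS]BE integral_bigcup//; last by rewrite -BE.
rewrite eseries0//= => k _ _; apply/eqP.
have fk : mu.-integrable (B `&` [set x | cl x = k]) (EFin \o f).
  apply: integrableS fi => //; rewrite BE; exact: bigcupT_measurable.
by have := EFin_Rintegral (mB k) fk; rewrite f0 => <-.
Qed.

Lemma bounded_cvg_integral0 (B : set T) (h : nat -> T -> R) (f : T -> R) (M : R) :
  measurable B -> (mu setT < +oo)%E ->
  (forall n, measurable_fun [set: T] (h n)) -> (forall n x, `|h n x| <= M) ->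
  (forall x, h n x @[n --> \oo] --> f x) ->
  (forall n, \int[mu]_(x in B) h n x = 0) ->
  \int[mu]_(x in B) f x = 0.
Proof.
move=> mB muT mh hM hf h0.
have mf : measurable_fun [set: T] f.
  by apply: (@measurable_fun_cvg _ T R setT h) => // x _; exact: hf.
have iM : mu.-integrable B (EFin \o (fun=> M)).
  apply: (@bounded_integrable _ _ _ _ _ `|M|) => //.
have ih n : mu.-integrable B (EFin \o h n).
  exact: bounded_integrable (hM n).
have muB : measurable_fun B (EFin \o f).
  by apply/measurable_EFinP; exact: measurable_funTS.
have cf : {ae mu, forall x, B x -> (fun n => (h n x)%:E) @ \oo --> (f x)%:E}.
  by apply: aeW => x _; apply: cvg_EFin; [exact: nearW|exact: hf].
have dh : {ae mu, forall x n, B x -> (`|(h n x)%:E| <= M%:E)%E}.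
  by apply: aeW => x n _; rewrite lee_fin.
have mhB n : measurable_fun B (EFin \o h n).
  by apply/measurable_EFinP; exact: measurable_funTS.
have [_ _ cv] := dominated_convergence mB mhB muB cf iM dh.
have : (fun n => \int[mu]_(x in B) (h n x)%:E)%E = (fun=> 0%E).
  by apply/funext => n; rewrite -EFin_Rintegral// h0.
move=> E0; rewrite /Rintegral; move: cv; rewrite /= E0 => /cvg_lim.
by rewrite lim_cst// => <-.
Qed.

Lemma measurable_cells (c1 c2 : T -> nat) (h : nat -> nat -> T -> R) :
  (forall k, measurable [set x | c1 x = k]) ->
  (forall k, measurable [set x | c2 x = k]) ->
  (forall k l, measurable_fun [set: T] (h k l)) ->
  measurable_fun [set: T] (fun x => h (c1 x) (c2 x) x).
Proof.
move=> m1 m2 mh _ C mC; rewrite setTI.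
have -> : (fun x => h (c1 x) (c2 x) x) @^-1` C =
    \bigcup_k \bigcup_l ([set x | c1 x = k] `&` [set x | c2 x = l] `&`
      (h k l @^-1` C)).
  apply/seteqP; split => x.
    by move=> Cx; exists (c1 x) => //; exists (c2 x).
  by move=> [k _ [l _ [[/= <- <-]]]].
apply: bigcupT_measurable => k; apply: bigcupT_measurable => l.
apply: measurableI; first exact: measurableI.
by have := mh k l measurableT C mC; rewrite setTI.
Qed.

End IntegralTools.

(** * The strong Markov property *)

Section HuntProperties.
Context (R : realType) (E : topologicalType) (T : R) (c : {posnum R}).
Hypothesis T0 : 0 < T.
Local Notation ED := (one_point_compactification E).
Local Notation S := (borel_space ED).
Local Notation Om := (path_space R S).
Context (K : R.-pker (R * S)%type ~> S).
Local Notation transition := (transition_mean c T K).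
Local Notation position := (@position_at R E).
Local Notation Y := (fun r => position (T - r)).

Definition path_law (t : R) (x : with_cemetery E) : probability Om R :=
  start_law c T K (t, x).
Local Notation Q := (fun r => path_law (T - r)).

Lemma measurable_position t (g : S -> R) : measurable_fun [set: S] g ->
  measurable_fun [set: Om] (fun w => g (position t w)).
Proof. by move=> mg; exact: (measurable_observe mg t). Qed.

Section Bounded.
Variables (g : S -> R) (M : R).
Hypotheses (mg : measurable_fun [set: S] g) (gM : forall y, `|g y| <= M).

Let M0 : 0 <= M. Proof. by apply: le_trans (normr_ge0 _) (gM point). Qed.

(** The prediction in increasing time: the mean of [g] at time v given the state y at time u. *)
Let phi u v (y : S) := transition (T - v) g (T - u, y).

Let mphi u v : measurable_fun [set: S] (phi u v).
Proof. exact: measurable_transition1. Qed.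

Let phiM u v y : `|phi u v y| <= M.
Proof. exact: transition_le. Qed.

Let phi_cvg u v (u_ v_ : nat -> R) y : u <= v -> (forall n, u_ n <= v_ n) ->
  (forall n, u <= u_ n) -> (forall n, v <= v_ n) ->
  u_ n @[n --> \oo] --> u -> v_ n @[n --> \oo] --> v ->
  phi (u_ n) (v_ n) y @[n --> \oo] --> phi u v y.
Proof.
move=> uv uvn uun vvn uc vc.
pose L := 2 * M * c%:num * total_mass_bound c T.
have bound n : `|phi (u_ n) (v_ n) y - phi u v y| <=
    L * (u_ n - u) + L * (v_ n - v).
  rewrite -[_ - phi u v y](subrKA (phi u (v_ n) y)).
  apply: (le_trans (ler_normD _ _)); apply: lerD.
    rewrite distrC /phi.
    have -> : u_ n - u = (T - u) - (T - u_ n) by lra.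
    by apply: transition_lipschitz => //; rewrite lerD2l lerN2.
  rewrite distrC -[leLHS]distrC /phi.
  have -> : v_ n - v = (T - v) - (T - v_ n) by lra.
  apply: transition_lipschitz_observe => //; rewrite lerD2l lerN2 //.
have cb : L * (u_ n - u) + L * (v_ n - v) @[n --> \oo] --> (0 : R).
  have -> : (0 : R) = L * (u - u) + L * (v - v) by rewrite !subrr !mulr0 addr0.
  by apply: cvgD; apply: cvgM; try exact: cvg_cst; apply: cvgB => //; exact: cvg_cst.
apply/cvgrPdist_le => e e0.
move/cvgrPdist_le : cb => /(_ e e0) [N _ HN]; exists N => // n Nn /=.
rewrite distrC; apply: le_trans (bound n) _.
by have := HN n Nn; rewrite /= sub0r normrN => h; apply: le_trans (ler_norm _) h.
Qed.

Lemma law_markov_cell a u v x (A : set Om) : a <= u -> u <= v ->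
  sigma_of Y [set q | a <= q <= u] A ->
  \int[Q a x]_(o in A) (g (Y v o) - phi u v (Y u o)) = 0.
Proof.
move=> au uv FA.
have dA : determined_from (T - u) A.
  apply: (@sigma_of_determined R E (fun q => T - q) _ (T - u)) FA => q /andP[_ qr].
  by rewrite lerD2l lerN2.
have mA : measurable A by case: dA.
have i1 : (Q a x).-integrable A (EFin \o (fun o => g (Y v o))).
  apply: (@bounded_integrable _ _ _ _ _ M) => //.
  - by rewrite /= probability_setT ltry.
  - exact: measurable_position.
have i2 : (Q a x).-integrable A (EFin \o (fun o => phi u v (Y u o))).
  apply: (@bounded_integrable _ _ _ _ _ M) => //.
  - by rewrite /= probability_setT ltry.
  - exact: measurable_position.
rewrite RintegralB// Rintegral_indicE [X in _ - X]Rintegral_indicE.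
have vu : T - v <= T - u by rewrite lerD2l lerN2.
have ua : T - u <= T - a by rewrite lerD2l lerN2.
by rewrite [X in X - _](law_markov c T K mg gM x vu ua dA) subrr.
Qed.

Section Stopping.
Variables (a : R) (x : with_cemetery E) (tau sigma : Om -> R).
Hypotheses (a0T : 0 <= a <= T) (st : stopping_time T Y a tau)
  (sg : forall o, tau o <= sigma o <= T)
  (sm : measurable_wrt (stopped_sigma T Y a tau)
    (measurable : set (set R)) sigma).

Let a0 : 0 <= a. Proof. by case/andP: a0T. Qed.
Let aT : a <= T. Proof. by case/andP: a0T. Qed.
Let at_ o : a <= tau o. Proof. by case: st => /(_ o)/andP[]. Qed.
Let tau0 o : 0 <= tau o. Proof. exact: le_trans a0 (at_ o). Qed.
Let tauT o : tau o <= T. Proof. by case: st => /(_ o)/andP[]. Qed.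
Let ts o : tau o <= sigma o. Proof. by case/andP: (sg o). Qed.
Let sT o : sigma o <= T. Proof. by case/andP: (sg o). Qed.
Let s0 o : 0 <= sigma o. Proof. exact: le_trans (tau0 o) (ts o). Qed.

Let mct n k : measurable [set o | cell n (tau o) = k].
Proof.
apply: (stopped_sigma_measurable aT st).
apply: (stopped_sigma_cell2 a0 st); last exact: stopping_time_stopped.
by move=> o; rewrite lexx tauT.
Qed.

Let mcs n l : measurable [set o | cell n (sigma o) = l].
Proof.
apply: (stopped_sigma_measurable aT st).
exact: (stopped_sigma_cell2 a0 st sg sm).
Qed.

Let rcvg (v : R) : 0 <= v -> v <= T -> round_up T n v @[n --> \oo] --> v.
Proof.
move=> v0 vT; apply/cvgrPdist_le => e e0.
have [N _ HN] := round_up_cvg v0 vT e0.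
exists N => // n Nn /=; have /andP[h1 h2] := HN n Nn.
by rewrite distrC ger0_norm ?subr_ge0// lerBlDl ltW.
Qed.

(** The path is constant just after [v], so the sequence is eventually constant: convergence comes
    from the path and not from [h]. *)
Let Y_cvg (h : S -> R) (v : R) o : 0 <= v -> v <= T ->
  h (Y (round_up T n v) o) @[n --> \oo] --> h (Y v o).
Proof.
move=> v0 vT; apply: cvg_near_cst.
have [e e0 He] := position_right T o v.
near=> n; apply: (congr1 h); apply: He.
by near: n; exact: round_up_cvg.
Unshelve. all: by end_near. Qed.

Let H n o := g (Y (round_up T n (sigma o)) o) -
  phi (round_up T n (tau o)) (round_up T n (sigma o)) (Y (round_up T n (tau o)) o).

Let phi_stopped_cvg o :
  phi (round_up T n (tau o)) (round_up T n (sigma o)) (Y (round_up T n (tau o)) o)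
    @[n --> \oo] --> phi (tau o) (sigma o) (Y (tau o) o).
Proof.
have h := @phi_cvg _ _ (fun n => round_up T n (tau o))
  (fun n => round_up T n (sigma o)) (Y (tau o) o) (ts o).
apply: cvg_trans (h _ _ _ (rcvg (tau0 o) (tauT o)) (rcvg (s0 o) (sT o))).
- apply: near_eq_cvg; have [e e0 He] := position_right T o (tau o).
  near=> n; apply: (congr1 (phi _ _)); apply/esym; apply: He.
  by near: n; exact: round_up_cvg.
- by move=> n; apply: grid_le; exact: cell_le.
- by move=> n; exact: le_round_up.
- by move=> n; exact: le_round_up.
Unshelve. all: by end_near. Qed.

Let mH n : measurable_fun [set: Om] (H n).
Proof.
apply: (@measurable_cells _ Om R (fun o => cell n (tau o))
  (fun o => cell n (sigma o)) (fun k l o => g (Y (grid T n l) o) -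
    phi (grid T n k) (grid T n l) (Y (grid T n k) o))) => // k l.
apply: measurable_funB; first exact: measurable_position.
exact: measurable_position.
Qed.

(** For rounded times B splits into countably many cells on which both times are deterministic and
    which belong to the past of the first one, so the Markov property at fixed times applies.
    Dominated convergence removes the rounding: the observation converges by right-constancy, the
    prediction by its Lipschitz bounds. *)
Lemma strong_markov_bounded (B : set Om) : stopped_sigma T Y a tau B ->
  \int[Q a x]_(o in B)
    (g (Y (sigma o) o) - phi (tau o) (sigma o) (Y (tau o) o)) = 0.
Proof.
move=> HB; have mB : measurable B by exact: (stopped_sigma_measurable aT st HB).
have QT : (Q a x setT < +oo)%E by rewrite /= probability_setT ltry.
have HM n o : `|H n o| <= M + M.
  by rewrite (le_trans (ler_normB _ _))// lerD.
apply: (@bounded_cvg_integral0 _ Om R (Q a x) B H _ (M + M)) => //.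
  move=> o; apply: cvgB; first exact: Y_cvg.
  exact: phi_stopped_cvg.
move=> n; have iH : (Q a x).-integrable B (EFin \o H n).
  exact: (bounded_integrable mB QT (mH n) (HM n)).
have mk k : measurable (B `&` [set o | cell n (tau o) = k]) by exact: measurableI.
apply: (@integral_cells0 _ _ _ _ _ (fun o => cell n (tau o))) => // k.
apply: (@integral_cells0 _ _ _ _ _ (fun o => cell n (sigma o))).
- by move=> l; apply: measurableI.
- by apply: integrableS iH => //; exact: subIsetl.
move=> l; set A := (X in Rintegral _ X _).
have [->|/set0P] := eqVneq A set0; first by rewrite Rintegral_set0.
(* A path in the cell witnesses a <= grid n k <= grid n l. *)
move=> [w1 [[_ /= wk1] /= wl1]].
have FA : sigma_of Y [set q | a <= q <= grid T n k] A.
  rewrite /A setIAC; apply: stopped_sigma_cell => //.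
  apply: stopped_sigmaI => //.
  exact: (stopped_sigma_cell2 a0 st sg sm).
rewrite -(@law_markov_cell a (grid T n k) (grid T n l) x A _ _ FA).
- apply: eq_Rintegral => w; rewrite inE => -[[_ /= wk] /= wl].
  by rewrite /H /round_up wk wl.
- rewrite -wk1; apply: le_trans (at_ w1) _; exact: le_round_up.
- by rewrite -wk1 -wl1; apply: grid_le; exact: cell_le.
Qed.

Lemma measurable_stopped_observe :
  measurable_fun [set: Om] (fun o => g (Y (sigma o) o)).
Proof.
apply: (@measurable_fun_cvg _ Om R setT (fun n o => g (Y (round_up T n (sigma o)) o))).
  move=> n; apply: (@measurable_cells _ Om R (fun o => cell n (tau o))
    (fun o => cell n (sigma o)) (fun k l o => g (Y (grid T n l) o))) => // k l.
  exact: measurable_position.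
by move=> o _; exact: Y_cvg.
Qed.

Lemma stopped_prediction :
  measurable_wrt (stopped_sigma T Y a tau) (measurable : set (set R))
    (fun o => phi (tau o) (sigma o) (Y (tau o) o)).
Proof.
apply: (measurable_stopped a0 aT st sg sm (psi := phi)) => //.
move=> u v y au uv vT; apply: phi_cvg => //.
- by move=> n; apply: grid_le; apply: cell_le => //; exact: le_trans a0 au.
- move=> n; apply: le_round_up; first exact: le_trans a0 au.
  exact: le_trans uv vT.
- by move=> n; apply: le_round_up => //; rewrite (le_trans a0)// (le_trans au).
- by apply: rcvg; [exact: le_trans a0 au|exact: le_trans uv vT].
- by apply: rcvg => //; rewrite (le_trans a0)// (le_trans au).
Qed.

End Stopping.

End Bounded.

End HuntProperties.

(** * The Hunt property *)

Section OnePointCompactification.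
Context (E : topologicalType).
Local Notation ED := (one_point_compactification E).

Lemma borel_some (A : set E) : borel E A -> borel ED (Some @` A).
Proof.
apply: (@smallest_sub _ _ _ [set A | borel ED (Some @` A)]).
  have bT : borel ED (Some @` [set: E]).
    apply: sub_sigma_algebra; apply: one_point_compactification_open_some.
    exact: openT.
  split.
  - by rewrite /= image_set0; exact: g_sigma_algebra0.
  - move=> B /= bB; rewrite (_ : _ @` _ = Some @` [set: E] `\` Some @` B).
      exact: g_sigma_algebraD.
    apply/seteqP; split => [_ [x [_ nB] <-]|_ [[x _ <-] nB]].
      by split; [exists x|move=> [y By [yx]]; apply: nB; rewrite -yx].
    by exists x => //; split => // Bx; apply: nB; exists x.
  - move=> F bF; rewrite /= image_bigcup; exact: sigma_algebra_bigcup.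
move=> U oU; apply: sub_sigma_algebra.
exact: one_point_compactification_open_some.
Qed.

Lemma borel_None : borel ED [set None].
Proof.
rewrite (_ : [set None] = [set: ED] `\` Some @` [set: E]).
  apply: g_sigma_algebraD; first by apply: sub_sigma_algebra; exact: openT.
  by apply: borel_some; apply: sub_sigma_algebra; exact: openT.
apply/seteqP; split => [_ ->|[x [_ h]|//]]; first by split => // -[].
by case: h; exists x.
Qed.

Lemma measurable_extend0 (R : realType) (f : E -> R) :
  measurable_wrt (borel E) (measurable : set (set R)) f ->
  measurable_fun [set: borel_space ED] (extend0 f : borel_space ED -> R).
Proof.
move=> mf _ C mC; rewrite setTI.
have bf : borel ED (Some @` (f @^-1` C)).
  by apply: borel_some; apply: mf; exists C => //; rewrite setTI.
have [C0|nC0] := pselect (C 0).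
  rewrite (_ : _ @^-1` C = Some @` (f @^-1` C) `|` [set None]).
    by apply: (@measurableU _ (borel_space ED)) => //; exact: borel_None.
  apply/seteqP; split => [[x Cx|_]|_ [[x Cx <-]|->] //]; last by right.
  by left; exists x.
rewrite (_ : _ @^-1` C = Some @` (f @^-1` C)) //.
by apply/seteqP; split => [[x|] //= Cx|_ [x Cx <-] //]; exists x.
Qed.

Lemma extend0_bounded (R : realType) (f : E -> R) (M : R) :
  (forall x, `|f x| <= M) -> forall y, `|extend0 f y| <= Num.max M 0.
Proof.
move=> fM [x|] /=; first by rewrite le_max fM.
by rewrite normr0 le_max lexx orbT.
Qed.

End OnePointCompactification.

Lemma measure_liminf_le d (Omega : measurableType d) (R : realType)
    (mu : {measure set Omega -> \bar R}) (A : nat -> set Omega) (e : \bar R) :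
  (forall n, measurable (A n)) -> (forall n, (mu (A n) <= e)%E) ->
  (mu (\bigcup_N \bigcap_(n in [set n | (N <= n)%N]) A n) <= e)%E.
Proof.
move=> mA Ae; pose F N := \bigcap_(n in [set n | (N <= n)%N]) A n.
have mF N : measurable (F N) by apply: bigcap_measurableType => n _; exact: mA.
have ndF : nondecreasing_seq F.
  move=> m n mn; apply/subsetPset => x Fx k /= nk; apply: Fx => /=.
  exact: leq_trans mn nk.
have cF := nondecreasing_cvg_mu (mu := mu) mF (bigcupT_measurable _ mF) ndF.
rewrite -(cvg_lim _ cF)//; apply: lime_le; first by apply/cvg_ex; eexists; exact: cF.
apply: nearW => n /=; apply: le_trans (Ae n).
by apply: le_measure; rewrite ?inE// => x; apply; exact: leqnn.
Qed.

Section HuntProcess.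
Context (R : realType) (E : topologicalType) (T : R) (c : {posnum R}).
Local Notation ED := (one_point_compactification E).
Local Notation S := (borel_space ED).
Local Notation Om := (path_space R S).
Context (K : R.-pker (R * S)%type ~> S).
Hypothesis borel1 : forall x : ED, borel ED [set x].
Hypothesis separated : exists C : nat -> set ED, (forall n, borel ED (C n)) /\
  forall x y, x <> y -> exists n, C n x /\ ~ C n y.
Hypothesis KNone : forall u, K (u, None) [set None] = 1%E.
Local Notation transition := (transition_mean c T K).
Local Notation X := (@position_at R E).
Local Notation P := (@path_law R E T c K).
Local Notation Y := (fun r => X (T - r)).
Local Notation Q := (fun r => P (T - r)).

Lemma expectE (f : E -> R) s r (y : ED) : bounded_borel f ->
  expect X P r y f s = transition s (extend0 f) (r, y).
Proof.
move=> [mf [M fM]]; rewrite /expect.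
exact: (Rintegral_law c T K (r, y) (measurable_position s (measurable_extend0 mf))
  (fun w => extend0_bounded fM (w s))).
Qed.

Lemma strong_markov_position : strong_markov T Y Q.
Proof.
move=> a x tau sigma f a0T st sg sm bf.
have aT : a <= T by case/andP: a0T.
have [mf [M fM]] := bf.
have mF := measurable_extend0 mf; have FM := extend0_bounded fM.
have QT : (Q a x setT < +oo)%E by rewrite /= probability_setT ltry.
rewrite (_ : (fun o => expect _ _ _ _ _ _) = (fun o =>
    transition (T - sigma o) (extend0 f) (T - tau o, Y (tau o) o))); last first.
  by apply/funext => o; rewrite -expectE.
have mW := stopped_prediction (c := c) (K := K) mF FM a0T st sg sm.
have iZ B : measurable B ->
    (Q a x).-integrable B (EFin \o (fun o => extend0 f (Y (sigma o) o))).
  move=> mB; apply: (bounded_integrable mB QT _ (fun o => FM _)).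
  exact: (measurable_stopped_observe mF a0T st sg sm).
have iW B : measurable B -> (Q a x).-integrable B (EFin \o (fun o =>
    transition (T - sigma o) (extend0 f) (T - tau o, Y (tau o) o))).
  move=> mB; apply: (bounded_integrable mB QT _
    (fun o => transition_le c T K mF FM _ _)) => _ C mC; rewrite setTI.
  by apply: (stopped_sigma_measurable aT st); apply: mW; exists C => //; rewrite setTI.
split => [||//|B FB].
- exact: iZ.
- exact: iW.
have mB := stopped_sigma_measurable aT st FB.
have := strong_markov_bounded c K mF FM x a0T st sg sm FB.
rewrite RintegralB//; [|exact: iZ|exact: iW].
by move/eqP; rewrite subr_eq0 => /eqP.
Qed.

Lemma markov_process_position : markov_process T X P.
Proof.
split.
- move=> s _ _ [B mB <-]; exact: (@measurable_eval R _ S s).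
- move=> s t B s0 st tT mB _ [C mC <-].
  have mXB : measurable (X s @^-1` B : set Om).
    by rewrite -[_ @^-1` _]setTI; exact: (@measurable_eval R _ S s).
  suff : measurable_fun [set: S] (fun x => fine (P t x (X s @^-1` B))) by apply.
  apply: (measurableT_comp (@fine_measurable R setT measurableT)) => //.
  exact: (measurableT_comp (measurable_law c T K mXB) (measurable_pair1 t)).
- move=> t x t0T; apply: law_start; last by move=> w /(_ t (lexx t)).
  rewrite (_ : [set o | _] = [set: Om] `&` (fun w : Om => w t) @^-1` [set x]).
    by apply: (@measurable_eval R _ S t) => //; exact: borel1.
  by rewrite setTI.
- move=> s t s0 st tT.
  have mN : measurable ((fun w : Om => w s) @^-1` [set None]).
    rewrite -[X in measurable X]setTI.
    by apply: (@measurable_eval R _ S s) => //; exact: borel1.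
  have := transition_absorbing c T (borel1 None : measurable ([set None] : set S))
    KNone st.
  move=> H; have {H} PC0 : P t None (~` ((fun w : Om => w s) @^-1` [set None])) = 0%E.
    by rewrite [LHS](law_pexp_indic c T K (t, None) (measurableC mN)); congr EFin.
  by rewrite -[[set o | _]]setCK; rewrite probability_setC ?PC0 ?sube0//; exact: measurableC.
- move=> s r t x f s0 sr rt tT bf.
  have [mf [M fM]] := bf.
  have mF := measurable_extend0 mf; have FM := extend0_bounded fM.
  have PT : (P t x setT < +oo)%E by rewrite /= probability_setT ltry.
  rewrite (_ : (fun o => expect _ _ _ _ _ _) = (fun o =>
      transition s (extend0 f) (r, X r o))); last first.
    by apply/funext => o; rewrite -expectE.
  have mtr : measurable_fun [set: S] (fun y => transition s (extend0 f) (r, y)).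
    exact: measurable_transition1.
  split.
  + apply: (bounded_integrable measurableT PT _ (fun o => FM _)).
    exact: (measurable_position s mF).
  + apply: (bounded_integrable measurableT PT _
      (fun o => transition_le c T K mF FM _ _)).
    exact: (measurable_position r mtr).
  + move=> _ [C mC <-]; rewrite setTI.
    apply: (@sigma_of_position _ _ X _ r ((fun y => transition s (extend0 f) (r, y)) @^-1` C)).
      by rewrite /= lexx.
    by have := mtr measurableT C mC; rewrite setTI.
  + move=> B FB.
    have dB : determined_from r B.
      by apply: (@sigma_of_determined R E id _ r) FB => q /andP[].
    rewrite Rintegral_indicE [RHS]Rintegral_indicE.
    by rewrite [RHS](law_markov c T K mF FM x sr rt dB).
Qed.

Lemma cadlag_position : cadlag_paths T Y.
Proof.
move=> w; split => r r0T.
  apply: cvg_near_cst; have [e e0 He] := position_right T w r.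
  near=> q; apply: He; apply/andP; split; first by near: q; exact: nbhs_right_ge.
  by near: q; apply: nbhs_right_lt; rewrite ltrDl.
have [e e0 [y He]] := position_left T w r; exists y.
apply: cvg_near_cst; near=> q; apply: He; apply/andP; split.
  by near: q; apply: nbhs_left_gt; rewrite ltrBlDr ltrDl.
by near: q; exact: nbhs_left_lt.
Unshelve. all: by end_near. Qed.

Let L := 2 * 1 * c%:num * total_mass_bound c T.

(** The strong Markov property is applied to the indicator of the complement of C at the time min
    (tau + h, T). When the state at [tau] lies in C, the prediction for the time [tau] itself is 0,
    so the one for the later time is at most L h by the Lipschitz bound in the observation time. *)
Lemma early_exit_le a x (tau : Om -> R) (h : R) (C : set ED) : 0 <= a <= T ->
  stopping_time T Y a tau -> 0 <= h -> borel ED C ->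
  let A := [set o | C (Y (tau o) o) /\ ~ C (Y (Num.min (tau o + h) T) o)] in
  measurable A /\ (Q a x A <= (L * h)%:E)%E.
Proof.
move=> a0T st h0 bC A.
have /andP[a0 aT] := a0T.
pose sigma o := Num.min (tau o + h) T.
have tT o : tau o <= T by case: st => /(_ o)/andP[].
have sg o : tau o <= sigma o <= T.
  by rewrite /sigma le_min ge_min lexx orbT lerDl h0 tT.
have sm : measurable_wrt (stopped_sigma T Y a tau) (measurable : set (set R)) sigma.
  move=> _ [D mD <-]; rewrite setTI.
  apply: (stopping_time_stopped st).
  exists ((fun v : R => Num.min (v + h) T) @^-1` D); last by rewrite setTI.
  rewrite -[X in measurable X]setTI.
  have : measurable_fun [set: R] (fun v : R => Num.min (v + h) T).
    by apply: measurable_minr => //; exact: measurable_funD.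
  exact.
have mC : measurable (C : set S) by [].
pose g : S -> R := \1_(~` C).
have mg : measurable_fun [set: S] g by apply: measurable_indic; exact: measurableC.
have gM y : `|g y| <= 1 by rewrite /g indicE; case: (_ \in _); rewrite ?normr1 ?normr0.
pose B := [set o : Om | C (Y (tau o) o)].
have FB : stopped_sigma T Y a tau B.
  have mt : measurable_wrt (stopped_sigma T Y a tau) (measurable : set (set R)) tau.
    exact: stopping_time_stopped.
  have ot o : tau o <= tau o <= T by rewrite lexx tT.
  have := measurable_stopped a0 aT st ot mt (psi := fun _ _ => \1_C : S -> R).
  move=> H; have {}H := H (fun _ _ => measurable_indic mC) (fun _ _ _ _ _ _ => cvg_cst _).
  rewrite (_ : B = (fun o => \1_C (Y (tau o) o) : R) @^-1` [set 1]).
    by apply: H; exists [set 1]; rewrite ?setTI.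
  apply/seteqP; split => o /=; rewrite indicE /B /=.
    by move=> Co; rewrite mem_set.
  by case: (asboolP (C (Y (tau o) o))) => // nC /eqP; rewrite memNset// eq_sym oner_eq0.
have mB := stopped_sigma_measurable aT st FB.
have QT : (Q a x setT < +oo)%E by rewrite /= probability_setT ltry.
have mgs := measurable_stopped_observe mg a0T st sg sm.
have AE : A = B `&` (fun o => g (Y (sigma o) o)) @^-1` [set 1].
  apply/seteqP; split => o.
    by move=> [Co nC]; split => //=; rewrite /g indicE mem_set.
  move=> [Bo /=]; rewrite /g indicE => h1; split => //= Cs; move: h1.
  by rewrite memNset; [move/eqP; rewrite eq_sym oner_eq0|move=> /(_ Cs)].
have AI o : \1_A o = \1_B o * g (Y (sigma o) o) :> R.
  rewrite (_ : A = B `&` (fun o => Y (sigma o) o) @^-1` (~` C)) //.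
  by rewrite /g !indicE in_setI -natrM mulnb.
have mA : measurable A.
  by rewrite AE; apply: measurableI => //; rewrite -[X in measurable X]setTI; exact: mgs.
split => //.
pose phi o := transition (T - sigma o) g (T - tau o, Y (tau o) o).
have mphi : measurable_fun [set: Om] phi.
  move=> _ D mD; rewrite setTI; apply: (stopped_sigma_measurable aT st).
  apply: (stopped_prediction (c := c) (K := K) mg gM a0T st sg sm).
  by exists D; rewrite ?setTI.
have ig : (Q a x).-integrable B (EFin \o (fun o => g (Y (sigma o) o))).
  exact: (bounded_integrable mB QT mgs (fun o => gM _)).
have iphi : (Q a x).-integrable B (EFin \o phi).
  exact: (bounded_integrable mB QT mphi (fun o => transition_le c T K mg gM _ _)).
have H := strong_markov_bounded c K mg gM x a0T st sg sm FB.
rewrite RintegralB// in H; move/eqP: H; rewrite subr_eq0 => /eqP H.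
have QA : Q a x A = (\int[Q a x]_(o in B) g (Y (sigma o) o))%:E.
  rewrite (measure_integral_indic _ mA) Rintegral_indicE EFin_Rintegral//.
    by apply: eq_integral => o _; rewrite AI.
  apply: (bounded_integrable measurableT QT (M := 1)).
    by apply: measurable_funM => //; exact: measurable_indic.
  by move=> o; rewrite -AI indicE normr_nat; case: (_ \in _).
rewrite QA H lee_fin; apply: le_trans (ler_norm _) _.
have Lh0 : 0 <= L * h by rewrite mulr_ge0// /L !mulr_ge0// expR_ge0.
apply: (@le_trans _ _ (\int[Q a x]_(o in B) (L * h))); last first.
  rewrite Rintegral_cst// -[leRHS]mulr1 ler_wpM2l//.
  by rewrite -[leRHS]/(fine 1) fine_le ?probability_le1// fin_num_measure.
apply: normr_Rintegral_le => //.
  apply: (bounded_integrable mB QT (M := `|L * h|)) => //; exact: measurable_cst.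
move=> o Bo.
have -> : `|phi o| = `|phi o - transition (T - tau o) g (T - tau o, Y (tau o) o)|.
  rewrite (transition_refl c T K mg gM) /g indicE memNset ?subr0//; exact: (fun h => h Bo).
have /andP[ts sT] := sg o.
apply: (le_trans (transition_lipschitz_observe c T K _ mg gM _ _)).
- by rewrite lerD2l lerN2.
- by [].
rewrite ler_wpM2l// ?/L ?mulr_ge0// ?expR_ge0//.
by rewrite /sigma opprB addrC addrA subrK lerBlDl ge_min lexx.
Qed.

(** If convergence fails, all tau_n stay strictly below tau, and the left limit y of the path at tau
    differs from its value there. Some C k contains y but not this value, so for every small h the
    path leaves C k between tau_n and min (tau_n + h, T) for all large n. The latter has probability
    at most L h, and only countably many k and h are involved. *)
Lemma quasi_left_continuous_position : quasi_left_continuous T Y Q.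
Proof.
move=> a x tau_ tau a0T st tau_nd tau_cvg.
have /andP[a0 aT] := a0T.
have [C [bC sepC]] := separated.
pose h m : R := m.+1%:R^-1.
have h0 m : 0 < h m by rewrite invr_gt0 ltr0n.
pose A k m n := [set o | C k (Y (tau_ n o) o) /\
  ~ C k (Y (Num.min (tau_ n o + h m) T) o)].
have mA k m n : measurable (A k m n).
  by have [] := early_exit_le x a0T (st n) (ltW (h0 m)) (bC k).
have Ale k m n : (Q a x (A k m n) <= (L * h m)%:E)%E.
  by have [] := early_exit_le x a0T (st n) (ltW (h0 m)) (bC k).
pose I k m := \bigcup_N \bigcap_(n in [set n | (N <= n)%N]) A k m n.
have mI k m : measurable (I k m).
  by apply: bigcupT_measurable => N; apply: bigcap_measurableType => n _; exact: mA.
have Ile k m : (Q a x (I k m) <= (L * h m)%:E)%E by exact: measure_liminf_le (mA k m) (Ale k m).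
have J0 k N : Q a x (\bigcap_(m in [set m | (N <= m)%N]) I k m) = 0%E.
  set J := \bigcap_(_ in _) _.
  have mJ : measurable J by apply: bigcap_measurableType => m _; exact: mI.
  have JI m : (N <= m)%N -> (Q a x J <= (L * h m)%:E)%E.
    move=> Nm; apply: le_trans (Ile k m); apply: le_measure; rewrite ?inE//.
    by move=> o; apply.
  apply/eqP; rewrite eq_le measure_ge0 andbT; apply/lee_addgt0Pr => e e0.
  rewrite add0e.
  have L0 : 0 <= L by rewrite /L !mulr_ge0// expR_ge0.
  have Le : 0 < e / (L + 1) by rewrite divr_gt0// ltr_wpDl.
  have [m0 _ Hm] := near_infty_natSinv_lt (PosNum Le).
  apply: (le_trans (JI (maxn N m0) (leq_maxl _ _))); rewrite lee_fin.
  have /ltW /= hm := Hm (maxn N m0) (leq_maxr _ _).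
  apply: (@le_trans _ _ ((L + 1) * h (maxn N m0))).
    by rewrite ler_wpM2r ?(ltW (h0 _))// lerDl.
  by rewrite -ler_pdivlMl ?ltr_wpDl// mulrC.
suff sub : ~` [set o | Y (tau_ n o) o @[n --> \oo] --> Y (tau o) o] `<=`
    \bigcup_k \bigcup_N \bigcap_(m in [set m | (N <= m)%N]) I k m.
  apply: negligibleS sub _; apply: negligible_bigcup => k.
  apply: negligible_bigcup => N; apply/negligibleP; last exact: J0.
  by apply: bigcap_measurableType => m _; exact: mI.
move=> o /= ncv.
have le_tau n : tau_ n o <= tau o.
  rewrite -(cvg_lim _ (tau_cvg o))//; apply: nondecreasing_cvgn_le.
    by move=> m p mp; exact: tau_nd.
  by apply/cvg_ex; exists (tau o); exact: tau_cvg.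
have lt_tau n : tau_ n o < tau o.
  rewrite lt_neqAle le_tau andbT; apply/eqP => E0; apply: ncv.
  apply: cvg_near_cst; exists n => // p /= np.
  suff -> : tau_ p o = tau o by [].
  by apply/eqP; rewrite eq_le le_tau -E0 tau_nd.
have tauT : tau o <= T.
  by rewrite -(cvg_lim _ (tau_cvg o))//; apply: limr_le;
    [apply/cvg_ex; exists (tau o); exact: tau_cvg|apply: nearW => n; case: (st n) => /(_ o)/andP[]].
have [e1 e10 [y Hy]] := position_left T o (tau o).
have [e2 e20 He2] := position_right T o (tau o).
have near_tau e : 0 < e -> \forall n \near \oo, tau o - e < tau_ n o.
  move=> e0; have := cvgr_gt _ (tau_cvg o) (tau o - e); apply.
  by rewrite ltrBlDr ltrDl.
have [N1 _ HN1] := near_tau _ e10.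
have Yy n : (N1 <= n)%N -> Y (tau_ n o) o = y.
  by move=> Nn; apply: Hy; rewrite lt_tau andbT; exact: HN1.
have yY : y <> Y (tau o) o.
  move=> E0; apply: ncv; apply: cvg_near_cst; exists N1 => // n /= Nn.
  by rewrite Yy.
have [k [Cy nCY]] := sepC _ _ yY; exists k => //.
have [M0 _ HM] := near_infty_natSinv_lt (PosNum e20).
exists M0 => // m /= Mm.
have [N2 _ HN2] := near_tau _ (h0 m).
exists (maxn N1 N2) => // n /= Nn.
have Nn1 : (N1 <= n)%N by apply: leq_trans Nn; exact: leq_maxl.
have Nn2 : (N2 <= n)%N by apply: leq_trans Nn; exact: leq_maxr.
split; first by rewrite Yy.
(* From tau - h m < tau_n < tau and h m < e2, the time tau_n + h m capped at T lies in [tau, tau +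
   e2[, where the path keeps its value at tau. *)
rewrite He2//; apply/andP; split.
  by rewrite le_min tauT andbT -lerBlDr ltW//; exact: HN2.
rewrite gt_min; apply/orP; left; apply: ltr_leD; first exact: lt_tau.
by have /ltW := HM m Mm.
Qed.

Theorem hunt_process_position : hunt_process T X P.
Proof.
split; first by split; [exact: markov_process_position|exact: strong_markov_position].
- exact: cadlag_position.
- exact: quasi_left_continuous_position.
Qed.

End HuntProcess.

(** * Continuity of mean values in space and their derivative in time *)

Lemma bounded_cvg_Rintegral d (X : measurableType d) (R : realType)
    (mu : {measure set X -> \bar R}) (B : set X) (h : nat -> X -> R)
    (f : X -> R) (M : R) :
  measurable B -> (mu B < +oo)%E ->
  (forall n, measurable_fun B (h n)) ->
  (forall n x, B x -> `|h n x| <= M) ->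
  (forall x, B x -> h n x @[n --> \oo] --> f x) ->
  \int[mu]_(x in B) h n x @[n --> \oo] --> \int[mu]_(x in B) f x.
Proof.
move=> mB muB mh hM hf.
have iM : mu.-integrable B (EFin \o (fun=> M)).
  apply: measurable_bounded_integrable => //.
  by exists `|M|; split; [exact: num_real|move=> y My x _; exact: ltW].
have mhB n : measurable_fun B (EFin \o h n) by exact/measurable_EFinP.
have mf : measurable_fun B (EFin \o f).
  by apply/measurable_EFinP; apply: (measurable_fun_cvg mh) => x Bx; exact: hf.
have cf : {ae mu, forall x, B x -> (fun n => (h n x)%:E) @ \oo --> (f x)%:E}.
  by apply: aeW => x Bx; apply: cvg_EFin; [exact: nearW|exact: hf].
have dh : {ae mu, forall x n, B x -> (`|(h n x)%:E| <= M%:E)%E}.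
  by apply: aeW => x n Bx; rewrite lee_fin; exact: hM.
have [fi _ cv] := dominated_convergence mB mhB mf cf iM dh.
by rewrite /Rintegral; apply: fine_cvg; rewrite fineK//; exact: integrable_fin_num.
Qed.

(** Both bounds come from 1 + z <= exp z, at z = - y and at z = y. The second gives exp (- y) * (1 +
    y) <= 1, and |y| <= 1/2 keeps 1 + y positive and 1 + 2 y nonnegative. *)
Lemma sub_expR_le (R : realType) (y : R) : `|y| <= 2^-1 ->
  `|1 - expR (- y) - y| <= 2 * y ^+ 2.
Proof.
rewrite ler_norml => /andP[h1 h2].
have e1 := expR_ge1Dx (- y); have e2 := expR_ge1Dx y.
have ey : expR (- y) * expR y = 1 by rewrite expRN mulVf// gt_eqF// expR_gt0.
have e0 := expR_gt0 (- y).
have e3 : expR (- y) * (1 + y) <= 1 by rewrite -[leRHS]ey ler_wpM2l// ltW.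
have y2 : 0 <= y ^+ 2 by rewrite sqr_ge0.
have e4 : expR (- y) <= 1 - y + 2 * y ^+ 2.
  have p : 0 < 1 + y by lra.
  rewrite -(ler_pM2r p); apply: (le_trans e3).
  have -> : (1 - y + 2 * y ^+ 2) * (1 + y) = 1 + y ^+ 2 * (1 + 2 * y) by ring.
  by rewrite lerDl mulr_ge0//; lra.
by rewrite ler_norml; apply/andP; split; lra.
Qed.

Section TransitionEquation.
Context (R : realType) d (S : measurableType d) (c : {posnum R}) (T : R)
  (K : R.-pker (R * S)%type ~> S).
Local Notation Z := (R * S)%type.
Local Notation RR := (measurableTypeR R).
Local Notation transition := (transition_mean c T K).
Local Notation mass := (@total_mass R d S c T).
Local Notation jump := (jump_measure c T K).

Lemma kernel_integrable u x (g : S -> R) (M : R) : measurable_fun [set: S] g ->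
  (forall y, `|g y| <= M) -> (K (u, x)).-integrable setT (EFin \o g).
Proof.
move=> mg gM; apply: (bounded_integrable measurableT _ mg gM).
by rewrite prob_kernel ltry.
Qed.

Lemma kernel_integral_le u x (g : S -> R) (M : R) : measurable_fun [set: S] g ->
  (forall y, `|g y| <= M) -> `|\int[K (u, x)]_y g y| <= M.
Proof.
move=> mg gM; have M0 : 0 <= M by apply: le_trans (normr_ge0 _) (gM point).
rewrite (_ : M = \int[K (u, x)]_y M); last by rewrite Rintegral_cst// prob_kernel mulr1.
apply: normr_Rintegral_le => //; first exact: kernel_integrable gM.
by apply: (@kernel_integrable _ _ _ M) => // y; rewrite ger0_norm.
Qed.

Lemma kernel_integralB u x (g h : S -> R) (M N : R) : measurable_fun [set: S] g ->
  measurable_fun [set: S] h -> (forall y, `|g y| <= M) -> (forall y, `|h y| <= N) ->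
  \int[K (u, x)]_y (g y - h y) = \int[K (u, x)]_y g y - \int[K (u, x)]_y h y.
Proof.
move=> mg mh gM hN.
by rewrite RintegralB//; [exact: kernel_integrable gM|exact: kernel_integrable hN].
Qed.

Lemma measurable_section (g : Z -> R) (u : R) : measurable_fun [set: Z] g ->
  measurable_fun [set: S] (fun y => g (u, y)).
Proof. by move=> mg; exact: (measurableT_comp mg (@pair1_measurable _ _ R S u)). Qed.

Lemma measurable_kernel_integral x (g : Z -> R) (M : R) :
  measurable_fun [set: Z] g -> (forall p, `|g p| <= M) ->
  measurable_fun [set: RR] (fun u : RR => \int[K (u, x)]_y g (u : R, y)).
Proof.
move=> mg gM.
have mRR : measurable_fun [set: RR] (fun u : RR => (u : R, x)).
  exact: measurable_fun_pair.
have mRS : measurable_fun [set: RR * S] (fun p : RR * S => (p.1 : R, p.2)).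
  apply: measurable_fun_pair; last exact: measurable_snd.
  have mi : measurable_fun [set: RR] (id : RR -> R).
    by move=> _ B mB; rewrite setTI preimage_id.
  exact: (measurableT_comp mi (@measurable_fst _ _ RR S)).
have mgM : measurable_fun [set: Z] (fun p => g p + M) by exact: measurable_funD.
have gM0 p : 0 <= g p + M.
  by have := gM p; rewrite ler_norml => /andP[H _]; rewrite -lerBlDr sub0r.
have M0 : 0 <= M by apply: le_trans (normr_ge0 _) (gM point).
have -> : (fun u : RR => \int[K (u, x)]_y g (u : R, y)) =
    (fun u : RR => \int[K (u, x)]_y (g (u : R, y) + M) - M).
  apply/funext => u; rewrite RintegralD//.
  - by rewrite [X in _ + X - _]Rintegral_cst// prob_kernel mulr1 addrK.
  - by apply: (@kernel_integrable _ _ _ M) => //; exact: measurable_section.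
  - by apply: (@kernel_integrable _ _ _ M) => // y; rewrite ger0_norm.
apply: measurable_funB => //.
apply: (measurableT_comp (@fine_measurable R setT measurableT)).
apply: (@measurable_integral_sfker _ _ _ RR S (kernel_precomp K mRR)
  (fun p : RR * S => (g (p.1 : R, p.2) + M)%:E)); first by move=> p; rewrite lee_fin.
by apply/measurable_EFinP; exact: (measurableT_comp mgM mRS).
Qed.

(** The restart equation for the constant observable 1, whose mean is 1. *)
Lemma mass_restart r t x : r <= t ->
  mass (t, x) = mass (r, x) + \int[jump (t, x)]_(p in later r) mass p.
Proof.
move=> rt.
have m1 : measurable_fun [set: S] (fun=> 1 : R) by [].
have b1 (y : S) : `|(1 : R)| <= 1 by rewrite normr1.
have t1 p : transition r (fun=> 1) p = 1.
  by rewrite /transition_mean /path_mean wexp_cst mul1r divff// gt_eqF// mass_gt0.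
have := transition_restart c T K m1 b1 x (lexx r) rt; rewrite !t1 !mul1r => ->.
by congr (_ + _); apply: eq_Rintegral => p _; rewrite t1 mul1r.
Qed.

Section Observable.
Variables (f : S -> R) (M : R) (s r t : R) (x : S).
Hypotheses (mf : measurable_fun [set: S] f) (fM : forall y, `|f y| <= M).
Hypotheses (s0 : 0 <= s) (sr : s <= r) (rt : r <= t) (tT : t <= T).

Let r0 : 0 <= r. Proof. exact: le_trans s0 sr. Qed.
Let M0 : 0 <= M. Proof. by apply: le_trans (normr_ge0 _) (fM point). Qed.

Let iJ (h : Z -> R) (N : R) : measurable_fun [set: Z] h -> (forall p, `|h p| <= N) ->
  (jump (t, x)).-integrable (later r) (EFin \o h).
Proof.
move=> mh hN; apply: (bounded_integrable _ _ mh hN); first exact: measurable_later.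
exact: jumpT_lty.
Qed.

Let massM p : `|mass p| <= total_mass_bound c T.
Proof. by rewrite ger0_norm ?mass_ge0// mass_le. Qed.

(* Both sides of the equation are compared with a constant [G], whose
   contribution is exact because the kernel is a probability kernel. *)
Lemma transition_increment_le (G eta : R) :
  (forall u, r <= u <= t -> `|\int[K (u, x)]_y transition s f (u, y) - G| <= eta) ->
  `|mass (t, x) * (transition s f (t, x) - G) -
    mass (r, x) * (transition s f (r, x) - G)| <= eta * (mass (t, x) - mass (r, x)).
Proof.
move=> HG.
pose g p := (transition s f p - G) * mass p.
have mtr := measurable_transition c T K mf fM s.
have mg : measurable_fun [set: Z] g.
  apply: measurable_funM; first exact: measurable_funB.
  exact: measurable_mass.
have gM p : `|g p| <= (M + `|G|) * total_mass_bound c T.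
  rewrite normrM; apply: ler_pM => //.
  by apply: (le_trans (ler_normB _ _)); rewrite lerD2r; exact: transition_le.
have E : mass (t, x) * (transition s f (t, x) - G) -
    mass (r, x) * (transition s f (r, x) - G) = \int[jump (t, x)]_(p in later r) g p.
  rewrite (_ : \int[_]_(_ in _) _ = \int[jump (t, x)]_(p in later r)
      (transition s f p * mass p - G * mass p)); last first.
    by apply: eq_Rintegral => p _; rewrite /g mulrBl.
  have i1 : (jump (t, x)).-integrable (later r) (EFin \o (fun p => transition s f p * mass p)).
    apply: (iJ (N := M * total_mass_bound c T)).
      by apply: measurable_funM => //; exact: measurable_mass.
    by move=> p; rewrite normrM; apply: ler_pM => //; exact: transition_le.
  have i2 : (jump (t, x)).-integrable (later r) (EFin \o mass).
    by apply: (iJ (N := total_mass_bound c T)) => //; exact: measurable_mass.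
  rewrite RintegralB//; [|exact: measurable_later|]; last first.
    apply: (iJ (N := `|G| * total_mass_bound c T)).
      by apply: measurable_funM => //; exact: measurable_mass.
    by move=> p; rewrite normrM ler_wpM2l.
  rewrite RintegralZl//; last exact: measurable_later.
  have e1 := transition_restart c T K mf fM x sr rt.
  have e2 := mass_restart x rt.
  transitivity (transition s f (t, x) * mass (t, x) -
    transition s f (r, x) * mass (r, x) - G * (mass (t, x) - mass (r, x))); first by ring.
  by rewrite e1 e2; ring.
rewrite {}E (Rintegral_jump_later c K x r0 rt tT mg gM).
have -> : mass (t, x) - mass (r, x) = \int[jump (t, x)]_(p in later r) mass p.
  by rewrite (mass_restart x rt) addrAC subrr add0r.
rewrite (Rintegral_jump_later c K x r0 rt tT (@measurable_mass _ _ S c T) massM).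
rewrite normrM ger0_norm// mulrCA ler_wpM2l//.
have leb (h : RR -> R) (N : R) : measurable_fun [set: RR] h -> (forall p, `|h p| <= N) ->
    (lebesgue_measure : {measure set RR -> \bar R}).-integrable `[r, t] (EFin \o h).
  move=> mh hN; apply: measurable_bounded_integrable => //.
  - change ((lebesgue_measure : set RR -> \bar R) [set` `[r, t]] < +oo)%E.
    by rewrite lebesgue_measure_itv/=; case: ifPn => // _; exact: ltry.
  - exact: measurable_funTS.
  - exists N; split => [|y Ny u _ /=]; first exact: num_real.
    exact: le_trans (hN u) (ltW Ny).
have im : (lebesgue_measure : {measure set RR -> \bar R}).-integrable `[r, t]
    (EFin \o (fun u : RR => \int[K (u, x)]_y mass (u : R, y))).
  apply: (leb _ (total_mass_bound c T)).
    exact: (measurable_kernel_integral x (@measurable_mass _ _ S c T) massM).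
  by move=> u; apply: kernel_integral_le => // ; exact: measurable_section (@measurable_mass _ _ S c T).
rewrite -RintegralZl//.
apply: normr_Rintegral_le => //.
- apply: (leb _ ((M + `|G|) * total_mass_bound c T)).
    exact: (measurable_kernel_integral x mg gM).
  by move=> u; apply: kernel_integral_le => //; exact: measurable_section.
- apply: (leb _ (`|eta| * total_mass_bound c T)).
    apply: measurable_funM => //.
    exact: (measurable_kernel_integral x (@measurable_mass _ _ S c T) massM).
  move=> u; rewrite normrM ler_wpM2l//; apply: kernel_integral_le => //.
  exact: measurable_section (@measurable_mass _ _ S c T).
move=> u; rewrite /= in_itv/= => rut.
have -> : \int[K (u, x)]_y mass (u, y) = mass (u, x).
  change (\int[K (u, x)]_y mass (u, x) = mass (u, x)).
  by rewrite Rintegral_cst// prob_kernel mulr1.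
have -> : \int[K (u, x)]_y g (u, y) =
    (\int[K (u, x)]_y transition s f (u, y) - G) * mass (u, x).
  transitivity (\int[K (u, x)]_y (mass (u, x) * (transition s f (u, y) - G))).
    by apply: eq_Rintegral => y _; rewrite /g mulrC.
  have its : (K (u, x)).-integrable setT (EFin \o (fun y => transition s f (u, y))).
    by apply: (kernel_integrable _ _ _ (M := M)); [exact: measurable_section|
      move=> y; exact: transition_le].
  have iG : (K (u, x)).-integrable setT (EFin \o (fun=> G)).
    exact: (kernel_integrable _ _ _ (M := `|G|)).
  rewrite RintegralZl//; last first.
    apply: (kernel_integrable _ _ _ (M := M + `|G|)).
      by apply: measurable_funB => //; exact: measurable_section.
    move=> y; apply: (le_trans (ler_normB _ _)); rewrite lerD2r; exact: transition_le.
  by rewrite RintegralB// [X in _ - X]Rintegral_cst// prob_kernel mulr1 mulrC.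
by rewrite normrM (ger0_norm (mass_ge0 _ _ _)) ler_wpM2r ?mass_ge0//; exact: HG.
Qed.

End Observable.

End TransitionEquation.

Lemma continuous_borel_measurable (R : realType) (D : ptopologicalType) (g : D -> R) :
  continuous g -> measurable_fun [set: borel_space D] (g : borel_space D -> R).
Proof.
move=> cg; apply: (measurability _ (RGenOInfty.measurableE R)).
move=> _ [_ [b ->] <-]; rewrite setTI; apply: sub_sigma_algebra.
by apply: open_comp => [x _|]; [exact: cg|exact: rray_open].
Qed.

Section Feller.
Context (R : realType) (D : ptopologicalType) (c : {posnum R}) (T : R).
Local Notation S := (borel_space D).
Context (K : R.-pker (R * S)%type ~> S).
Local Notation Z := (R * S)%type.
Local Notation RR := (measurableTypeR R).
Local Notation transition := (transition_mean c T K).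
Local Notation mass := (@total_mass R _ S c T).
Local Notation jump := (jump_measure c T K).

Lemma measurable_jump_integral (h : Z -> R) (N : R) : measurable_fun [set: Z] h ->
  (forall p, `|h p| <= N) ->
  measurable_fun [set: Z] (fun z => \int[jump z]_p h p).
Proof.
move=> mh hN; have N0 : 0 <= N by apply: le_trans (normr_ge0 _) (hN point).
have ij (g : Z -> R) z : measurable_fun [set: Z] g -> (forall p, `|g p| <= N) ->
    (jump z).-integrable setT (EFin \o g).
  by move=> mg gN; apply: (bounded_integrable measurableT _ mg gN); exact: jumpT_lty.
rewrite (_ : (fun z => \int[jump z]_p h p) = (fun z => \int[jump z]_p (h p + N) - N * jump_count_bound c T 1 z)).
  apply: measurable_funB.
    apply: (measurableT_comp (@fine_measurable R setT measurableT)).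
    apply: (@measurable_integral_sfker _ _ _ Z Z jump (fun p => (h p.2 + N)%:E)).
      by move=> p; rewrite lee_fin; have := hN p.2; rewrite ler_norml; lra.
    apply/measurable_EFinP; apply: measurable_funD => //.
    exact: (measurableT_comp mh (@measurable_snd _ _ Z Z)).
  by apply: measurable_funM => //; exact: measurable_jump_bound.
apply/funext => z; rewrite RintegralD//.
- by rewrite [X in _ + X - _]Rintegral_cst// [jump z setT]jumpT /= addrK.
- exact: ij.
- by apply: ij => // p; rewrite ger0_norm.
Qed.

Hypothesis sequential : forall g : D -> R,
  (forall (x : D) (u : nat -> D), u n @[n --> \oo] --> x ->
    g (u n) @[n --> \oo] --> g x) -> continuous g.
Hypothesis K_feller : forall u (g : D -> R) (M : R), continuous g ->
  (forall y, `|g y| <= M) -> continuous (fun x : D => \int[K (u, x)]_y g y : R).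

Variables (f : D -> R) (M s : R).
Hypotheses (cf : continuous f) (fM : forall y, `|f y| <= M).
Hypotheses (s0 : 0 <= s).

Let mf : measurable_fun [set: S] f. Proof. exact: continuous_borel_measurable. Qed.
Let M0 : 0 <= M. Proof. by apply: le_trans (normr_ge0 _) (fM point). Qed.

(** Iterates of the restart equation from time s, started at 0. They inherit continuity in the state
    step by step, whereas the mean itself is so far only known to be Borel. *)
Fixpoint picard (n : nat) : Z -> R :=
  if n is m.+1 then fun z =>
    (f z.2 * mass (s, z.2) + \int[jump z]_(p in later s) (picard m p * mass p)) / mass z
  else fun=> 0.

Let picardP n : measurable_fun [set: Z] (picard n) /\
  exists N, forall z, `|picard n z| <= N.
Proof.
elim: n => [|n [mp [N pN]]].
  by split; [exact: measurable_cst|exists 0 => z; rewrite normr0].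
have mm : measurable_fun [set: Z] mass by exact: measurable_mass.
have massM p : `|mass p| <= total_mass_bound c T by rewrite ger0_norm ?mass_ge0// mass_le.
pose h (p : Z) : R := \1_(later s) p * (picard n p * mass p).
have mh : measurable_fun [set: Z] h.
  apply: measurable_funM; first by apply: measurable_indic; exact: measurable_later.
  exact: measurable_funM.
have hN p : `|h p| <= N * total_mass_bound c T.
  rewrite /h !normrM -[leRHS]mul1r; apply: ler_pM => //.
    by rewrite indicE; case: (_ \in _); rewrite ?normr1 ?normr0.
  exact: ler_pM.
have E : picard n.+1 = fun z => (f z.2 * mass (s, z.2) + \int[jump z]_p h p) / mass z.
  by apply/funext => z /=; rewrite Rintegral_indicE.
split; rewrite E.
  apply: measurable_funM; last first.
    rewrite (_ : (fun z => _) = (fun z => expR (- (c%:num * clamp_time T z.1)))).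
      apply: (measurableT_comp (@measurable_expR R)); apply: (measurableT_comp (@oppr_measurable R setT)).
      apply: measurable_funM => //.
      exact: (measurableT_comp (@measurable_clamp R T) (@measurable_fst _ _ R S)).
    by apply/funext => z; rewrite expRN.
  apply: measurable_funD; last exact: measurable_jump_integral hN.
  apply: measurable_funM; first exact: (measurableT_comp mf (@measurable_snd _ _ R S)).
  change (measurable_fun [set: Z] (fun=> expR (c%:num * clamp_time T s))).
  exact: measurable_cst.
have NM : 0 <= N * total_mass_bound c T by apply: le_trans (normr_ge0 _) (hN point).
exists (M * total_mass_bound c T + N * total_mass_bound c T * total_mass_bound c T) => z.
rewrite normrM -[leRHS]mulr1; apply: ler_pM => //; last first.
  by rewrite ger0_norm ?invr_ge0 ?mass_ge0// invf_le1 ?mass_gt0// mass_ge1.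
apply: (le_trans (ler_normD _ _)); apply: lerD.
  by rewrite normrM; exact: ler_pM.
apply: (@le_trans _ _ (N * total_mass_bound c T * jump_count_bound c T 1 z)).
  apply: (Rintegral_jump_le K z measurableT mh _ NM) => p _.
  by rewrite /jump_count_bound /exp_coeff/= expr0 divr1 mulr1.
rewrite ler_wpM2l//; apply: le_trans (mass_le _ _ z).
rewrite /jump_count_bound /exp_coeff/= expr1 divr1 /total_mass.
by apply: le_trans (expR_ge1Dx _); rewrite lerDr.
Qed.

(** Contraction factor of a Picard step: an error is multiplied by 1 - mass s / mass t at most,
    where mass s >= 1 and mass t <= [total_mass_bound]. *)
Let q : R := 1 - (total_mass_bound c T)^-1.

Let picard_cvg n p : s <= p.1 -> `|transition s f p - picard n p| <= M * q ^+ n.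
Proof.
have mb1 : 1 <= total_mass_bound c T.
  exact: (le_trans (mass_ge1 c T (point : Z)) (mass_le c T _)).
have q0 : 0 <= q by rewrite /q subr_ge0 invf_le1// (lt_le_trans _ mb1).
elim: n p => [|n IH] [t x] /= st.
  by rewrite expr0 mulr1 subr0; exact: transition_le.
have [mp [N pN]] := picardP n.
have massM p : `|mass p| <= total_mass_bound c T by rewrite ger0_norm ?mass_ge0// mass_le.
have mm : measurable_fun [set: Z] mass by exact: measurable_mass.
have ij (g : Z -> R) B : measurable_fun [set: Z] g -> (forall p, `|g p| <= B) ->
    (jump (t, x)).-integrable (later s) (EFin \o g).
  move=> mg gN; apply: (bounded_integrable _ _ mg gN); first exact: measurable_later.
  exact: jumpT_lty.
have mtr := measurable_transition c T K mf fM s.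
have i1 : (jump (t, x)).-integrable (later s)
    (EFin \o (fun p => transition s f p * mass p)).
  apply: (ij _ (M * total_mass_bound c T)); first exact: measurable_funM.
  by move=> p; rewrite normrM; apply: ler_pM => //; exact: transition_le.
have i2 : (jump (t, x)).-integrable (later s)
    (EFin \o (fun p => picard n p * mass p)).
  apply: (ij _ (N * total_mass_bound c T)); first exact: measurable_funM.
  by move=> p; rewrite normrM; apply: ler_pM.
have i3 : (jump (t, x)).-integrable (later s) (EFin \o mass) by exact: ij massM.
have Mq : 0 <= M * q ^+ n by rewrite mulr_ge0// exprn_ge0.
have e1 := transition_restart c T K mf fM x (lexx s) st.
rewrite (transition_refl c T K mf fM) in e1.
have m0 := mass_gt0 c T (t, x).
rewrite -[transition s f (t, x)](mulfK (lt0r_neq0 m0)) e1 -mulrBl opprD addrACA subrr add0r.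
rewrite -RintegralB//; last exact: measurable_later.
rewrite normrM [`|_^-1|]ger0_norm ?invr_ge0 ?mass_ge0// ler_pdivrMr//.
apply: (@le_trans _ _ (M * q ^+ n * (mass (t, x) - mass (s, x)))).
  rewrite (mass_restart c T K x st) [X in _ * X]addrAC subrr add0r -RintegralZl//; last exact: measurable_later.
  apply: normr_Rintegral_le => //.
  - exact: measurable_later.
  - apply: (ij _ ((M + N) * total_mass_bound c T)).
      by apply: measurable_funB; exact: measurable_funM.
    move=> p; rewrite -mulrBl normrM; apply: ler_pM => //.
    by apply: (le_trans (ler_normB _ _)); apply: lerD => //; exact: transition_le.
  - apply: (ij _ (M * q ^+ n * total_mass_bound c T)); first exact: measurable_funM.
    by move=> p; rewrite normrM (ger0_norm Mq) ler_wpM2l.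
  move=> p sp; rewrite -mulrBl normrM (ger0_norm (mass_ge0 _ _ _)).
  by rewrite ler_wpM2r ?mass_ge0//; exact: IH.
rewrite exprS [q * _]mulrC mulrA -[leRHS]mulrA ler_wpM2l// /q mulrBl mul1r lerD2l lerN2.
rewrite ler_pdivrMl ?(lt_le_trans _ mb1)//.
apply: le_trans (mass_le _ _ (t, x)) _; rewrite -[leLHS]mulr1 ler_wpM2l ?(le_trans _ mb1)//.
exact: mass_ge1.
Qed.

(** For each jump time the integrand is continuous in the state by the Feller property of [K].
    Dominated convergence carries this through the time integral along sequences, which is the
    purpose of [sequential]. *)
Let picard_continuous n t : s <= t -> t <= T -> continuous (fun x : D => picard n (t, x)).
Proof.
elim: n t => [|n IH] t st tT; first by move=> x; exact: cvg_cst.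
have [mp [N pN]] := picardP n.
have massM p : `|mass p| <= total_mass_bound c T by rewrite ger0_norm ?mass_ge0// mass_le.
have mm : measurable_fun [set: Z] mass by exact: measurable_mass.
pose g (p : Z) := picard n p * mass p.
have mg : measurable_fun [set: Z] g by exact: measurable_funM.
have gN p : `|g p| <= N * total_mass_bound c T by rewrite normrM; exact: ler_pM.
have E : (fun x : D => picard n.+1 (t, x)) = (fun x : D => (f x * expR (c%:num * clamp_time T s) +
    c%:num * \int[lebesgue_measure]_(u in `[s, t]) \int[K (u, x)]_y g (u, y)) /
    expR (c%:num * clamp_time T t)).
  by apply/funext => x /=; rewrite (Rintegral_jump_later c K x s0 st tT mg gN).
rewrite E; apply: sequential => x u ux.
apply: cvgM; last exact: cvg_cst.
apply: cvgD.
  by apply: cvgM; [apply: (cvg_comp u f ux); exact: cf|exact: cvg_cst].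
apply: cvgM; first exact: cvg_cst.
apply: (@bounded_cvg_Rintegral _ RR R lebesgue_measure `[s, t]%classic
  (fun m (v : RR) => \int[K (v, u m)]_y g (v, y)) _ (N * total_mass_bound c T)).
- exact: measurable_itv.
- change ((lebesgue_measure : set RR -> \bar R) [set` `[s, t]] < +oo)%E.
  by rewrite lebesgue_measure_itv/=; case: ifPn => // _; exact: ltry.
- by move=> m; apply: measurable_funTS; exact: measurable_kernel_integral gN.
- move=> m v _; apply: kernel_integral_le => //; exact: measurable_section.
move=> v; rewrite /= in_itv/= => /andP[sv vt].
have cg : continuous (fun y : D => g (v, y)).
  move=> y; apply: (cvgM (g := fun=> expR (c%:num * clamp_time T v))); last exact: cvg_cst.
  by apply: IH => //; exact: le_trans vt tT.
apply: (cvg_comp u (fun x : D => \int[K (v, x)]_y g (v, y)) ux).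
exact: (K_feller (u := v) cg (fun y => gN (v, y))).
Qed.

Lemma transition_continuous t : s <= t -> t <= T ->
  continuous (fun x : D => transition s f (t, x)).
Proof.
move=> st tT x; apply/(@cvgrPdist_le _ R) => e e0.
have mb1 : 1 <= total_mass_bound c T.
  exact: (le_trans (mass_ge1 c T (point : Z)) (mass_le c T _)).
have q01 : `|q| < 1.
  have i0 : 0 < (total_mass_bound c T)^-1 by rewrite invr_gt0 (lt_le_trans _ mb1).
  have i1 : (total_mass_bound c T)^-1 <= 1 by rewrite invf_le1// (lt_le_trans _ mb1).
  by rewrite /q ger0_norm; lra.
have e3 : 0 < e / 3 / (M + 1) by rewrite !divr_gt0// ltr_wpDl.
have /cvgrPdist_lt/(_ _ e3)[n _ /(_ n (leqnn n))/=] := cvg_expr q01.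
rewrite sub0r normrN ltr_pdivlMr ?ltr_wpDl// => qn.
have Mq : M * q ^+ n <= e / 3.
  apply: ltW; apply: le_lt_trans qn; rewrite mulrC.
  apply: (le_trans (ler_norm _)); rewrite normrM ler_wpM2l// ger0_norm// lerDl.
  exact: ler01.
have e30 : 0 < e / 3 by rewrite divr_gt0.
have /(@cvgrPdist_le _ R)/(_ _ e30) := @picard_continuous n t st tT x.
apply: filterS => y /= xy.
have h1 := le_trans (@picard_cvg n (t, x) st) Mq.
have h2 := le_trans (@picard_cvg n (t, y) st) Mq.
move: xy h1 h2; rewrite !ler_norml; lra.
Qed.

Hypothesis K_time : forall (g : D -> R) (N : R), continuous g ->
  (forall y, `|g y| <= N) -> forall t e, 0 < e -> exists2 h, 0 < h &
    forall u x, `|u - t| < h -> `|\int[K (u, x)]_y g y - \int[K (t, x)]_y g y| <= e.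

(** With G the value of K_t F_t at x and y = c (r - t), [transition_increment_le] says that F_r - G
    is exp (- y) (F_t - G) up to a small error, and expanding exp (- y) gives the slope c (G - F_t).
    All thresholds are uniform in x, as differentiability in supremum norm requires. *)
Lemma transition_derivative t e : s <= t -> t <= T -> 0 < e ->
  exists2 h, 0 < h & forall r x, s <= r <= T -> `|r - t| < h ->
    `|transition s f (r, x) - transition s f (t, x) -
      (r - t) * (c%:num * (\int[K (t, x)]_y transition s f (t, y) -
        transition s f (t, x)))| <= e * `|r - t|.
Proof.
move=> st tT e0.
pose F u x := transition s f (u, x).
have FM u x : `|F u x| <= M by exact: transition_le.
have mF u : measurable_fun [set: S] (F u) by exact: measurable_transition1.
have cF u : s <= u -> u <= T -> continuous (F u : D -> R) by exact: transition_continuous.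
pose L := 2 * M * c%:num * total_mass_bound c T.
have L0 : 0 <= L by rewrite !mulr_ge0// expR_ge0.
have lip u x : s <= u -> `|F u x - F t x| <= L * `|u - t|.
  move=> su; have [ut|tu] := leP u t.
    rewrite distrC [`|u - t|]distrC [`|t - u|]ger0_norm ?subr_ge0//.
    exact: (transition_lipschitz c T K mf fM x su ut).
  rewrite [`|u - t|]gtr0_norm ?subr_gt0//.
  exact: (transition_lipschitz c T K mf fM x st (ltW tu)).
have c0 : 0 < c%:num by [].
(* The thresholds h1 and h2 keep K_u F_u within [eta] of G, one half for the variation of K and one
   for that of F; h3 gives |y| <= 1/2; h4 bounds the quadratic remainder by e / 2 * |r - t|. As |1 -
   exp (- y)| <= 2 |y|, the error [eta] costs the other e / 2 * |r - t|. *)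
pose eta := e / (4 * c%:num).
have eta0 : 0 < eta by rewrite divr_gt0// mulr_gt0.
have eta2 : 0 < eta / 2 by rewrite divr_gt0.
have [h1 h10 H1] := K_time (cF t st tT) (FM t) t eta2.
pose h2 := eta / 2 / (L + 1).
have h20 : 0 < h2 by rewrite divr_gt0// ltr_wpDl.
pose h3 := (2 * c%:num)^-1.
have h30 : 0 < h3 by rewrite invr_gt0 mulr_gt0.
pose h4 := e / 2 / (4 * M * c%:num ^+ 2 + 1).
have h40 : 0 < h4 by rewrite !divr_gt0// ltr_wpDl// !mulr_ge0// sqr_ge0.
exists (Num.min (Num.min h1 h2) (Num.min h3 h4)); first by rewrite !lt_min h10 h20 h30.
move=> r x /andP[sr rT]; rewrite !lt_min => /andP[/andP[rh1 rh2] /andP[rh3 rh4]].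
pose G := \int[K (t, x)]_y F t y.
have KF u : s <= u -> `|u - t| <= `|r - t| -> `|\int[K (u, x)]_y F u y - G| <= eta.
  move=> su ur; rewrite /G -[X in `|X - _|](subrK (\int[K (u, x)]_y F t y)) -addrA.
  apply: (le_trans (ler_normD _ _)); rewrite [leRHS]splitr; apply: lerD; last first.
    by apply: H1; exact: le_lt_trans ur rh1.
  rewrite -(kernel_integralB K u x (mF u) (mF t) (FM u) (FM t)).
  apply: kernel_integral_le; first exact: measurable_funB.
  move=> y; apply: (le_trans (lip u y su)); apply: (@le_trans _ _ (L * h2)).
    by rewrite ler_wpM2l//; exact: (le_trans ur (ltW rh2)).
  by rewrite /h2 mulrA ler_pdivrMr ?ltr_wpDl// mulrC ler_wpM2l ?(ltW eta2)// lerDl.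
have GM : `|G| <= M by exact: kernel_integral_le.
have r0 : 0 <= r by exact: le_trans sr.
have t0 : 0 <= t by exact: le_trans st.
have inc : `|mass (r, x) * (F r x - G) - mass (t, x) * (F t x - G)| <=
    eta * `|mass (r, x) - mass (t, x)|.
  have [rt|tr] := leP r t.
    rewrite distrC [X in _ <= eta * X]distrC [X in _ <= eta * X]ger0_norm; last first.
      by rewrite subr_ge0 ler_expR ler_wpM2l ?(ltW c0)//= !clamp_id ?r0 ?t0.
    apply: (transition_increment_le mf fM s0 sr rt tT) => u /andP[ru ut].
    apply: KF; first exact: le_trans ru.
    by rewrite !ler0_norm ?subr_le0// lerN2 lerD2r.
  rewrite [X in _ <= eta * X]ger0_norm; last first.
    by rewrite subr_ge0 ler_expR ler_wpM2l ?(ltW c0)//= !clamp_id ?r0 ?t0 ?(ltW tr).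
  apply: (transition_increment_le mf fM s0 st (ltW tr) rT) => u /andP[tu ur].
  apply: KF; first exact: le_trans tu.
  by rewrite !ger0_norm ?subr_ge0// ?(ltW tr)// lerD2r.
pose y := c%:num * (r - t).
have mE : mass (t, x) = mass (r, x) * expR (- y).
  rewrite /total_mass /= !clamp_id ?r0 ?t0// -expRD; congr expR; rewrite /y; ring.
have {}inc : `|F r x - G - expR (- y) * (F t x - G)| <= eta * `|1 - expR (- y)|.
  have m0 := mass_gt0 c T (r, x).
  rewrite -(ler_pM2l m0) mulrCA.
  have nm a : mass (r, x) * `|a| = `|mass (r, x) * a| by rewrite normrM gtr0_norm.
  rewrite !nm.
  have -> : mass (r, x) * (F r x - G - expR (- y) * (F t x - G)) =
    mass (r, x) * (F r x - G) - mass (t, x) * (F t x - G) by rewrite mE; ring.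
  have -> : mass (r, x) * (1 - expR (- y)) = mass (r, x) - mass (t, x).
    by rewrite mE; ring.
  exact: inc.
have yb : `|y| <= 2^-1.
  rewrite /y normrM (gtr0_norm c0) -ler_pdivlMl// mulrC.
  by rewrite -invfM; exact: ltW rh3.
have ye := sub_expR_le yb.
have y2 : y ^+ 2 = `|y| ^+ 2 by rewrite real_normK ?num_real.
have ye1 : `|1 - expR (- y)| <= 2 * `|y|.
  rewrite -[1 - _](subrK y); apply: (le_trans (ler_normD _ _)).
  have : 2 * y ^+ 2 <= `|y|.
    rewrite y2 expr2 mulrA -[leRHS]mul1r ler_wpM2r//.
    by rewrite -ler_pdivlMl// mulr1.
  lra.
have -> : F r x - F t x - (r - t) * (c%:num * (G - F t x)) =
    (F r x - G - expR (- y) * (F t x - G)) + (1 - expR (- y) - y) * (G - F t x).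
  by rewrite /y; ring.
apply: (le_trans (ler_normD _ _)).
have ny : `|y| = c%:num * `|r - t| by rewrite normrM gtr0_norm.
apply: (@le_trans _ _ (e / 2 * `|r - t| + e / 2 * `|r - t|)); last first.
  by rewrite -mulrDl -splitr.
apply: lerD.
  apply: (le_trans inc); apply: (le_trans (ler_wpM2l (ltW eta0) ye1)).
  by rewrite ny /eta le_eqVlt; apply/orP; left; apply/eqP; field; rewrite lt0r_neq0.
rewrite normrM; apply: (@le_trans _ _ (2 * y ^+ 2 * (2 * M))).
  apply: ler_pM => //; apply: (le_trans (ler_normB _ _)).
  by have := FM t x; lra.
rewrite y2 ny expr2.
have : `|r - t| * (4 * M * c%:num ^+ 2 + 1) <= e / 2.
  by rewrite -ler_pdivlMr ?(ltW rh4)// ltr_wpDl// !mulr_ge0// sqr_ge0.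
move=> hh; have := ler_wpM2r (normr_ge0 (r - t)) hh.
have := mulr_ge0 (normr_ge0 (r - t)) (normr_ge0 (r - t)); lra.
Qed.

End Feller.

(** * Generators and solutions in the space of continuous functions *)

Section SupNorm.
Context {R : realType} {E : compactSpaceType}.
Local Notation C := (cfun R E).
Implicit Types (f g : C) (x : E).

Lemma cfunDE f g x : cfun_fun (f + g) x = (f x : R[i]) + g x :> R[i]. Proof. by []. Qed.

Lemma cfunBE f g x : cfun_fun (f - g) x = (f x : R[i]) - g x :> R[i]. Proof. by []. Qed.

Lemma cfunZE (a : R[i]) f x : cfun_fun (a *: f) x = a * (f x : R[i]) :> R[i]. Proof. by []. Qed.

Lemma supnorm_triangle f g : supnorm (f + g) <= supnorm f + supnorm g.
Proof. by rewrite -lecR rmorphD; exact: supnormD. Qed.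

Lemma supnormZr (a : R) f : supnorm (a%:C%C *: f) = `|a| * supnorm f.
Proof.
apply: complexI; rewrite rmorphM supnormZ; congr (_ * _).
by rewrite normc_def /= expr0n /= addr0 sqrtr_sqr.
Qed.

Lemma supnormN f : supnorm (- f) = supnorm f.
Proof. by apply: complexI; rewrite -!cfun_normE normrN. Qed.

Lemma supnorm_distC f g : supnorm (f - g) = supnorm (g - f).
Proof. by rewrite -supnormN opprB. Qed.

Lemma supnorm_dist f g h : supnorm (f - h) <= supnorm (f - g) + supnorm (g - h).
Proof. by rewrite -[f - h](subrKA g); exact: supnorm_triangle. Qed.

Lemma supnorm0 : supnorm (0 : C) = 0.
Proof. by apply: complexI; rewrite -cfun_normE normr0. Qed.

Lemma supnorm0_eq f : supnorm f <= 0 -> f = 0.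
Proof.
move=> f0; apply: supnorm_eq0; congr real_complex_def.
by apply/eqP; rewrite eq_le f0 supnorm_ge0.
Qed.

Lemma Re_norm_ge (z : R[i]) : `|complex.Re z| <= complex.Re `|z|.
Proof. by have := normc_ge_Re z; rewrite normcRe lecR. Qed.

Lemma Im_norm_ge (z : R[i]) : `|complex.Im z| <= complex.Re `|z|.
Proof.
by rewrite normc_def /= -sqrtr_sqr ler_wsqrtr// lerDr sqr_ge0.
Qed.

Lemma Re_le_supnorm f x : `|complex.Re (f x : R[i])| <= supnorm f.
Proof. exact: le_trans (Re_norm_ge _) (supnorm_ge f x). Qed.

Lemma Im_le_supnorm f x : `|complex.Im (f x : R[i])| <= supnorm f.
Proof. exact: le_trans (Im_norm_ge _) (supnorm_ge f x). Qed.

End SupNorm.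

Section ComplexParts.
Context (R : realType).
Implicit Types z w : R[i].

Lemma ReD z w : complex.Re (z + w) = complex.Re z + complex.Re w.
Proof. by case: z w => [? ?] []. Qed.

Lemma ImD z w : complex.Im (z + w) = complex.Im z + complex.Im w.
Proof. by case: z w => [? ?] []. Qed.

Lemma ReB z w : complex.Re (z - w) = complex.Re z - complex.Re w.
Proof. by case: z w => [? ?] []. Qed.

Lemma ImB z w : complex.Im (z - w) = complex.Im z - complex.Im w.
Proof. by case: z w => [? ?] []. Qed.

Lemma ReZ (a : R) z : complex.Re (a%:C%C * z) = a * complex.Re z.
Proof. by case: z => b d /=; rewrite mul0r subr0. Qed.

Lemma ImZ (a : R) z : complex.Im (a%:C%C * z) = a * complex.Im z.
Proof. by case: z => b d /=; rewrite mul0r addr0. Qed.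

End ComplexParts.

Section RealFunctions.
Context {R : realType} {E : compactSpaceType}.
Local Notation C := (cfun R E).

Lemma real_complex_continuous : continuous (fun a : R => a%:C%C : R[i]^o).
Proof.
move=> a; apply/(@cvgrPdist_lt _ _ _ (nbhs (a : R))) => e e0.
have [e1 ee] : exists e1 : R, e = e1%:C%C.
  by exists (complex.Re e); rewrite [e in LHS]complexE (_ : complex.Im e = 0) ?mulr0 ?addr0//;
    move: e0; rewrite ltcE => /andP[/eqP ->].
have e10 : 0 < e1 by move: e0; rewrite ee ltcR.
apply/nbhs_ballP; exists e1 => //= b ab.
by rewrite -rmorphB normc_def /= expr0n /= addr0 sqrtr_sqr ee ltcR.
Qed.

Lemma Re_continuous : continuous (fun z : R[i]^o => complex.Re z : R^o).
Proof.
move=> z; apply/(@cvgrPdist_lt _ _ _ (nbhs (z : R[i]^o))) => e e0.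
have e0C : 0 < e%:C%C :> R[i] by rewrite ltcR.
apply/nbhs_ballP; exists e%:C%C => //= w zw; rewrite -ltcR.
apply: le_lt_trans zw; rewrite -ReB.
exact: normc_ge_Re.
Qed.

Lemma Im_continuous : continuous (fun z : R[i]^o => complex.Im z : R^o).
Proof.
move=> z; apply/(@cvgrPdist_lt _ _ _ (nbhs (z : R[i]^o))) => e e0.
have e0C : 0 < e%:C%C :> R[i] by rewrite ltcR.
apply/nbhs_ballP; exists e%:C%C => //= w zw; rewrite -ltcR.
apply: le_lt_trans zw; rewrite -ImB.
by rewrite [in leRHS]normcRe lecR; exact: Im_norm_ge.
Qed.

Lemma cfun_Re_continuous (f : C) : continuous (fun x => complex.Re (f x : R[i]) : R).
Proof.
by move=> x; exact: (continuous_comp (@cfun_continuous _ _ f x) (@Re_continuous (f x))).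
Qed.

Lemma cfun_Im_continuous (f : C) : continuous (fun x => complex.Im (f x : R[i]) : R).
Proof.
by move=> x; exact: (continuous_comp (@cfun_continuous _ _ f x) (@Im_continuous (f x))).
Qed.

Lemma realfun_continuous (g : E -> R) : continuous g ->
  continuous (fun x => (g x)%:C%C : R[i]^o).
Proof.
by move=> cg x; exact: (continuous_comp (cg x) (@real_complex_continuous (g x))).
Qed.

Fact realfun_subproof : {F : (E -> R) -> C | forall g, continuous g ->
  forall x, cfun_fun (F g) x = (g x)%:C%C :> R[i]}.
Proof.
exists (fun g => if pselect (continuous (fun x => (g x)%:C%C : R[i]^o)) is left cg
  then cfun_of cg else 0) => g /realfun_continuous cg x.
by case: pselect => // ncg; case: ncg.
Qed.

(* Meaningful for continuous [g] only; opaque, since unification would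
   otherwise unfold the case analysis. *)
Definition realfun (g : E -> R) : C := sval realfun_subproof g.

Lemma realfunE (g : E -> R) x : continuous g ->
  cfun_fun (realfun g) x = (g x)%:C%C :> R[i].
Proof. by move=> cg; exact: (svalP realfun_subproof). Qed.

Lemma realfunD (g h : E -> R) : continuous g -> continuous h ->
  realfun (fun x => g x + h x) = realfun g + realfun h.
Proof.
move=> cg ch; apply: cfunP => x.
have cgh : continuous ((fun x => g x + h x) : E -> R).
  by move=> y; apply: cvgD; [exact: cg|exact: ch].
apply: (etrans (realfunE x cgh)); apply: esym; apply: (etrans (cfunDE _ _ x)).
by rewrite (realfunE x cg) (realfunE x ch) -rmorphD.
Qed.

Lemma realfunZ (a : R) (g : E -> R) : continuous g ->
  realfun (fun x => a * g x) = a%:C%C *: realfun g.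
Proof.
move=> cg; apply: cfunP => x.
have cag : continuous ((fun x => a * g x) : E -> R).
  by move=> y; apply: cvgM; [exact: cvg_cst|exact: cg].
apply: (etrans (realfunE x cag)); apply: esym; apply: (etrans (cfunZE _ _ x)).
by rewrite (realfunE x cg) -rmorphM.
Qed.

Lemma supnorm_realfun_le (g : E -> R) M : 0 <= M -> continuous g ->
  (forall x, `|g x| <= M) -> supnorm (realfun g) <= M.
Proof.
move=> M0 cg gM; apply: supnorm_le => // x.
by rewrite realfunE// normc_def /= expr0n /= addr0 sqrtr_sqr.
Qed.

Lemma cfun_ReIm (f : C) : f = realfun (fun x => complex.Re (f x : R[i])) +
  'i%C *: realfun (fun x => complex.Im (f x : R[i])).
Proof.
apply: cfunP => x.
apply: esym; apply: (etrans (cfunDE _ _ x)).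
rewrite cfunZE; apply: esym; apply: (etrans (complexE _)); congr (_ + _ * _).
  by rewrite (realfunE x (@cfun_Re_continuous f)).
by rewrite (realfunE x (@cfun_Im_continuous f)).
Qed.

End RealFunctions.

(** Continuous induction: consider the t such that phi stays below the line of slope e > 0 through
    (s, phi s) on all of [s, t]. Continuity puts the supremum of these t into the set, and the
    one-sided hypothesis pushes it beyond any point below T. *)
Lemma dini_le (R : realType) (phi : R -> R) (s T : R) : s <= T ->
  (forall t e, s <= t <= T -> 0 < e -> exists2 h, 0 < h &
    forall r, s <= r <= T -> `|r - t| < h -> `|phi r - phi t| <= e) ->
  (forall t e, s <= t < T -> 0 < e -> exists2 h, 0 < h &
    forall r, t < r <= T -> r - t < h -> phi r <= phi t + e * (r - t)) ->
  phi T <= phi s.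
Proof.
move=> sT cphi dphi; apply/ler_addgt0Pr => e0 e00.
pose e := e0 / (T - s + 1).
have e_gt0 : 0 < e by rewrite divr_gt0// ltr_wpDl// subr_ge0.
pose ok t := forall r, s <= r <= t -> phi r <= phi s + e * (r - s).
pose I := [set t | s <= t <= T /\ ok t].
have Is : I s.
  split; first by rewrite lexx.
  by move=> r; rewrite -eq_le => /eqP <-; rewrite subrr mulr0 addr0.
have ubI : has_ubound I by exists T => t [/andP[]].
pose b := sup I.
have sb : s <= b by apply: (ub_le_sup ubI).
have bT : b <= T by apply: ge_sup => [|t [/andP[]]//]; exists s.
have below r : s <= r -> r < b -> phi r <= phi s + e * (r - s).
  move=> sr rb; have [t It rt] := sup_gt (ex_intro _ s Is) rb.
  by apply: It.2; rewrite sr ltW.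
have atb : phi b <= phi s + e * (b - s).
  apply/ler_addgt0Pr => eta eta0.
  have [->|bs] := eqVneq b s; first by rewrite subrr mulr0 addr0 lerDl ltW.
  have sltb : s < b by rewrite lt_neqAle eq_sym bs sb.
  have sbT : s <= b <= T by rewrite sb bT.
  have [h h0 H] := cphi b eta sbT eta0.
  pose r := Num.max s (b - h / 2).
  have rb : r < b by rewrite gt_max sltb ltrBlDr ltrDl divr_gt0.
  have sr : s <= r by rewrite le_max lexx.
  have rh : `|r - b| < h.
    rewrite ltr0_norm ?subr_lt0// opprB ltrBlDr -ltrBlDl lt_max; apply/orP; right.
    by rewrite ltrD2l ltrN2 ltr_pdivrMr// ltr_pMr// ltr1n.
  have srT : s <= r <= T by rewrite sr (le_trans (ltW rb)).
  have := H r srT rh; rewrite ler_norml => /andP[h2 _].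
  have h1 := below r sr rb.
  have : e * (r - s) <= e * (b - s) by rewrite ler_wpM2l ?(ltW e_gt0)// lerD2r ltW.
  lra.
have okb : ok b.
  move=> r /andP[sr]; rewrite le_eqVlt => /predU1P[->//|]; exact: below.
have bET : b = T.
  apply/eqP; rewrite eq_le bT /= leNgt; apply/negP => bltT.
  have sbT : s <= b < T by rewrite sb bltT.
  have [h h0 H] := dphi b e sbT e_gt0.
  pose t := Num.min T (b + h / 2).
  have bt : b < t by rewrite lt_min bltT ltrDl divr_gt0.
  have It : I t.
    split; first by rewrite (le_trans sb (ltW bt)) ge_min lexx.
    move=> r /andP[sr rt]; have [rb|br] := leP r b.
      by apply: okb; rewrite sr.
    have brT : b < r <= T by rewrite br (le_trans rt)// ge_min lexx.
    have rbh : r - b < h.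
      rewrite ltrBlDl; apply: (le_lt_trans rt); rewrite gt_min; apply/orP; right.
      by rewrite ltrD2l ltr_pdivrMr// ltr_pMr// ltr1n.
    have := H r brT rbh.
    have : e * (r - s) = e * (r - b) + e * (b - s) by ring.
    by move: atb; lra.
  by have := ub_le_sup ubI It; rewrite leNgt bt.
rewrite -bET; apply: (le_trans atb); rewrite lerD2l bET /e mulrAC ler_pdivrMr.
  by rewrite ler_wpM2l ?(ltW e00)// lerDl.
by rewrite ltr_wpDl// subr_ge0.
Qed.

Section Generators.
Context {R : realType} {E : compactSpaceType}.
Local Notation C := (cfun R E).

Lemma le0_eps (a : R) : (forall e, 0 < e -> - e <= a) -> 0 <= a.
Proof.
move=> ae; rewrite -[0]/(0 : R) leNgt; apply/negP => a0.
by have := ae (- (a / 2)); rewrite oppr_gt0 pmulr_llt0// => /(_ a0); lra.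
Qed.

Lemma generator_expansion (L : {linear C -> C}) (S : R -> {linear C -> C}) f e :
  is_generator L S -> 0 < e -> exists2 h0, 0 < h0 & forall h, 0 < h -> h < h0 ->
    supnorm (S h f - f - h%:C%C *: L f) <= e * h.
Proof.
move=> /(_ f) Sf e0.
have e0C : 0 < e%:C%C :> R[i] by rewrite ltcR.
move/cvgrPdist_le : Sf => /(_ _ e0C) N0.
 have [h0 /= h00 H] := (nbhs_ballP (0 : R) _).1 N0; exists h0 => // h hp hh.
have {}H : `|L f - (h^-1)%:C%C *: (S h f - f)| <= e%:C%C.
  by apply: H => //; rewrite /ball/= sub0r normrN gtr0_norm.
rewrite cfun_normE lecR in H.
have hne : h%:C%C != 0 :> R[i] by rewrite (inj_eq (@complexI R) h 0) gt_eqF.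
have -> : S h f - f - h%:C%C *: L f = (- h)%:C%C *: (L f - (h^-1)%:C%C *: (S h f - f)).
  rewrite rmorphN scaleNr scalerBr opprB scalerA.
  by rewrite -rmorphM divff ?gt_eqF// scale1r.
by rewrite supnormZr normrN gtr0_norm// mulrC ler_wpM2r// ltW.
Qed.

Section PositiveContraction.
Variables (L : {linear C -> C}) (S : R -> {linear C -> C}).
Hypotheses (Spos : forall h, 0 <= h -> positive_operator (S h))
  (Scon : forall h, 0 <= h -> contraction_operator (S h))
  (LS : is_generator L S).

(** The positive minimum principle: S h f >= 0 = f at x, so the difference quotients at x are
    nonnegative. *)
Lemma generator_ge0 (f : C) x : (forall y, 0 <= (f y : R[i])) -> (f x : R[i]) = 0 ->
  0 <= complex.Re (cfun_fun (L f) x : R[i]).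
Proof.
move=> f0 fx; apply: le0_eps => e e0.
have [h0 h00 H] := generator_expansion f LS e0.
have hp : 0 < h0 / 2 by rewrite divr_gt0.
have hh : h0 / 2 < h0 by rewrite ltr_pdivrMr// ltr_pMr// ltr1n.
have := le_trans (Re_le_supnorm _ x) (H _ hp hh).
rewrite !cfunBE cfunZE fx subr0 ReB ReZ ler_norml => /andP[_ h2].
have := Spos (ltW hp) f0 x; rewrite lecE => /andP[_ /= h3].
have : - (e * (h0 / 2)) <= h0 / 2 * complex.Re (cfun_fun (L f) x : R[i]) by lra.
by rewrite -mulNr mulrC ler_pM2l.
Qed.

Lemma generator_one_le0 x :
  complex.Re (cfun_fun (L (realfun (fun=> 1 : R))) x : R[i]) <= 0.
Proof.
have c1 : continuous ((fun=> 1) : E -> R) by move=> y; exact: cvg_cst.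
set f := realfun _.
rewrite -oppr_ge0; apply: le0_eps => e e0.
have [h0 h00 H] := generator_expansion f LS e0.
have hp : 0 < h0 / 2 by rewrite divr_gt0.
have hh : h0 / 2 < h0 by rewrite ltr_pdivrMr// ltr_pMr// ltr1n.
have := le_trans (Re_le_supnorm _ x) (H _ hp hh).
have fx : (f x : R[i]) = 1%:C%C by exact: realfunE.
rewrite !cfunBE cfunZE fx !ReB ReZ ler_norml => /andP[h2 _].
have f1 : supnorm f <= 1.
  by apply: supnorm_realfun_le => // y; rewrite normr1.
have := le_trans (le_trans (Re_le_supnorm (S (h0 / 2) f) x) (Scon (ltW hp) f)) f1.
rewrite ler_norml => /andP[_ h3].
have : - (e * (h0 / 2)) <= h0 / 2 * - complex.Re (cfun_fun (L f) x : R[i]).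
  by move: h2; rewrite /=; lra.
by rewrite -mulNr mulrC ler_pM2l.
Qed.

(** Positivity speaks about nonnegative functions. A real function becomes one when its norm is
    added, and the added constant has a real image for the same reason. *)
Lemma positive_Im (h : R) (g : E -> R) x : 0 <= h -> continuous g ->
  complex.Im (cfun_fun (S h (realfun g)) x : R[i]) = 0.
Proof.
move=> h0 cg; set f := realfun g; pose M := supnorm f.
have cM : continuous ((fun=> M) : E -> R) by move=> y; exact: cvg_cst.
have pos (k : C) : (forall y, 0 <= (k y : R[i])) -> complex.Im (cfun_fun (S h k) x : R[i]) = 0.
  by move=> k0; have := Spos h0 k0 x; rewrite lecE => /andP[/eqP + _].
have M0 : complex.Im (cfun_fun (S h (realfun (fun=> M))) x : R[i]) = 0.
  by apply: pos => y; rewrite realfunE// lecR supnorm_ge0.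
have : complex.Im (cfun_fun (S h (f + realfun (fun=> M))) x : R[i]) = 0.
  apply: pos => y; rewrite cfunDE realfunE// realfunE// -rmorphD lecR.
  have := Re_le_supnorm f y; rewrite (realfunE y cg) /= -/M ler_norml => /andP[h1 _].
  by rewrite -lerBlDr sub0r.
by rewrite linearD cfunDE ImD M0 addr0.
Qed.

Lemma generator_Im (g : E -> R) x : continuous g ->
  complex.Im (cfun_fun (L (realfun g)) x : R[i]) = 0.
Proof.
move=> cg; set f := realfun g.
(* The signs b = 1 and b = -1 turn the inequality into the equality. *)
suff H b : `|b| = 1 -> 0 <= b * complex.Im (cfun_fun (L f) x : R[i]).
  have h1 := H 1 (normr1 _); have h2 := H (-1) (normrN1 _).
  by apply/eqP; rewrite eq_le; apply/andP; split; lra.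
move=> b1; apply: le0_eps => e e0.
have [h0 h00 H] := generator_expansion f LS e0.
have hp : 0 < h0 / 2 by rewrite divr_gt0.
have hh : h0 / 2 < h0 by rewrite ltr_pdivrMr// ltr_pMr// ltr1n.
have := le_trans (Im_le_supnorm _ x) (H _ hp hh).
rewrite !cfunBE cfunZE !ImB ImZ positive_Im ?(ltW hp)//.
rewrite (realfunE x cg) /= subrr sub0r normrN normrM (gtr0_norm hp) mulrC ler_pM2r//.
rewrite -[X in X <= _]mul1r -b1 -normrM ler_norml => /andP[h1 _].
exact: h1.
Qed.

(** The part g - min (g, g x) is nonnegative and vanishes at x, so the minimum principle applies to
    it. The other part has norm at most g x, so the bound on L costs at most kappa * g x there. *)
Lemma generator_lower (kappa : R) (g : E -> R) x :
  (forall f, supnorm (L f) <= kappa * supnorm f) -> 0 <= kappa -> continuous g ->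
  (forall y, 0 <= g y) -> - (kappa * g x) <= complex.Re (cfun_fun (L (realfun g)) x : R[i]).
Proof.
move=> Lk k0 cg g0.
pose m y := Num.min (g y) (g x); pose d y := g y - m y.
have cm : continuous (m : E -> R).
  by move=> y; apply: continuous_min; [exact: cg|exact: cvg_cst].
have cd : continuous (d : E -> R).
  by move=> y; apply: cvgB; [exact: cg|exact: cm].
have -> : realfun g = realfun d + realfun m.
  rewrite -realfunD//; congr realfun; apply/funext => y.
  by rewrite /d subrK.
rewrite linearD cfunDE ReD.
have d0 : 0 <= complex.Re (cfun_fun (L (realfun d)) x : R[i]).
  apply: generator_ge0 => [y|]; rewrite realfunE//.
    by rewrite lecR subr_ge0 ge_min lexx.
  by rewrite /d /m minxx subrr.
have := le_trans (Re_le_supnorm (L (realfun m)) x) (Lk _).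
have mg : supnorm (realfun m) <= g x.
  apply: supnorm_realfun_le => // y.
  by rewrite ger0_norm ?le_min ?g0//= /m ge_min lexx orbT.
have := ler_wpM2l k0 mg; rewrite ler_norml => h1 /andP[h2 _]; lra.
Qed.

End PositiveContraction.

End Generators.

(** * First-order solutions and their uniqueness *)

Section Slopes.
Context {R : realType} {E : compactSpaceType}.
Local Notation C := (cfun R E).
Variable A : R -> {linear C -> C}.

(** The equation w' = A w on [s, T] as a first-order expansion. Real bounds avoid complex radii and
    quotients, and the finite interval lets solutions over different horizons be compared and
    glued. *)
Definition has_slope (s T : R) (w : R -> C) : Prop :=
  forall t e, s <= t <= T -> 0 < e -> exists2 h, 0 < h &
    forall r, s <= r <= T -> `|r - t| < h ->
      supnorm (w r - w t - (r - t)%:C%C *: A t (w t)) <= e * `|r - t|.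

Lemma has_slope_sub s T s' T' w : s <= s' -> T' <= T -> has_slope s T w ->
  has_slope s' T' w.
Proof.
move=> ss TT H t e /andP[st tT] e0.
have [|h h0 Hh] := H t e _ e0; first by rewrite (le_trans ss st) (le_trans tT).
exists h => // r /andP[sr rT] rt.
by apply: Hh => //; rewrite (le_trans ss sr) (le_trans rT).
Qed.

Lemma has_slopeD s T w1 w2 : has_slope s T w1 -> has_slope s T w2 ->
  has_slope s T (fun t => w1 t + w2 t).
Proof.
move=> H1 H2 t e tsT e0; have e2 : 0 < e / 2 by rewrite divr_gt0.
have [h1 h10 K1] := H1 t _ tsT e2; have [h2 h20 K2] := H2 t _ tsT e2.
exists (Num.min h1 h2); first by rewrite lt_min h10.
move=> r rsT; rewrite lt_min => /andP[r1 r2] /=.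
rewrite (_ : _ - _ = (w1 r - w1 t - (r - t)%:C%C *: A t (w1 t)) +
  (w2 r - w2 t - (r - t)%:C%C *: A t (w2 t))); last first.
  rewrite [A t (_ + _)]linearD scalerDr !opprD [RHS]addrACA; congr (_ + _).
  by rewrite addrACA.
apply: (le_trans (supnorm_triangle _ _)).
by rewrite [e]splitr mulrDl lerD ?K1 ?K2.
Qed.

Lemma has_slopeZ s T (a : R[i]) w : has_slope s T w -> has_slope s T (fun t => a *: w t).
Proof.
move=> H t e tsT e0.
have a0 : 0 <= complex.Re `|a| by rewrite -lecR -normcRe normr_ge0.
have e1 : 0 < e / (complex.Re `|a| + 1) by rewrite divr_gt0// ltr_wpDl.
have [h h0 K] := H t _ tsT e1; exists h => // r rsT rt /=.
rewrite (_ : _ - _ = a *: (w r - w t - (r - t)%:C%C *: A t (w t))); last first.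
  by rewrite [A t (_ *: _)]linearZ !scalerBr !scalerA [a * _]mulrC.
have -> g : supnorm (a *: g) = complex.Re `|a| * supnorm g.
  by apply: complexI; rewrite rmorphM supnormZ; congr (_ * _); exact: normcRe.
apply: (le_trans (ler_wpM2l a0 (K r rsT rt))).
rewrite mulrA ler_wpM2r// mulrCA -[leRHS]mulr1 ler_wpM2l ?(ltW e0)//.
by rewrite ler_pdivrMr ?mul1r ?lerDl// ltr_wpDl.
Qed.

Lemma has_slopeB s T w1 w2 : has_slope s T w1 -> has_slope s T w2 ->
  has_slope s T (fun t => w1 t - w2 t).
Proof.
move=> H1 H2; have {}H2 := has_slopeZ (-1) H2.
have := has_slopeD H1 H2; congr has_slope; apply/funext => t.
by rewrite scaleN1r.
Qed.

Lemma has_slope_continuous s T w t e : has_slope s T w -> s <= t <= T -> 0 < e ->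
  exists2 h, 0 < h & forall r, s <= r <= T -> `|r - t| < h -> supnorm (w r - w t) <= e.
Proof.
move=> H tsT e0; have [h h0 K] := H t 1 tsT ltr01.
pose N := supnorm (A t (w t)) + 1.
have N0 : 0 < N by rewrite ltr_wpDl// supnorm_ge0.
exists (Num.min h (e / N)); first by rewrite lt_min h0 divr_gt0.
move=> r rsT; rewrite lt_min => /andP[r1 r2].
rewrite -[w r - w t](subrK ((r - t)%:C%C *: A t (w t))).
apply: (le_trans (supnorm_triangle _ _)); rewrite supnormZr.
have := K r rsT r1; move: r2; rewrite ltr_pdivlMr// /N mulrDr; lra.
Qed.

Hypothesis A_generates : forall t, 0 <= t ->
  generates_positive_contraction_semigroup (A t).

(* The semigroup generated by [A t] is a contraction and follows [w] to first
   order, so the upper right Dini derivative of the norm is nonpositive. *)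
Lemma has_slope_contraction s T w : 0 <= s -> s <= T -> has_slope s T w ->
  supnorm (w T) <= supnorm (w s).
Proof.
move=> s0 sT H; apply: (@dini_le _ (fun t => supnorm (w t))) => // t e tsT e0.
  have [h h0 K] := has_slope_continuous H tsT e0; exists h => // r rsT rt.
  apply: le_trans (K r rsT rt).
  have h1 := supnorm_triangle (w r - w t) (w t); have h2 := supnorm_triangle (w t - w r) (w r).
  rewrite subrK in h1; rewrite subrK supnorm_distC in h2.
  by rewrite ler_norml; apply/andP; split; lra.
have /andP[st tT] := tsT.
have [S [_ Spos Scon LS]] := A_generates (le_trans s0 st).
have e2 : 0 < e / 2 by rewrite divr_gt0.
have tsT' : s <= t <= T by rewrite st ltW.
have [h1 h10 K1] := H t _ tsT' e2.
have [h2 h20 K2] := generator_expansion (w t) LS e2.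
exists (Num.min h1 h2); first by rewrite lt_min h10.
move=> r /andP[tr rT]; rewrite lt_min => /andP[r1 r2].
have rt0 : 0 < r - t by rewrite subr_gt0.
have rsT : s <= r <= T by rewrite (le_trans st (ltW tr)).
have := K1 r rsT; rewrite (gtr0_norm rt0) => /(_ r1) k1.
have k2 := K2 _ rt0 r2.
have k3 := Scon _ (ltW rt0) (w t).
have -> : w r = (w r - w t - (r - t)%:C%C *: A t (w t)) -
    (S (r - t) (w t) - w t - (r - t)%:C%C *: A t (w t)) + S (r - t) (w t).
  by rewrite opprB addrA subrK opprB addrA subrK subrK.
apply: (le_trans (supnorm_triangle _ _)).
have := supnorm_triangle (w r - w t - (r - t)%:C%C *: A t (w t))
  (- (S (r - t) (w t) - w t - (r - t)%:C%C *: A t (w t))).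
rewrite supnormN; lra.
Qed.

Lemma has_slope_unique s T w1 w2 : 0 <= s -> has_slope s T w1 -> has_slope s T w2 ->
  w1 s = w2 s -> forall t, s <= t <= T -> w1 t = w2 t.
Proof.
move=> s0 H1 H2 e t /andP[st tT].
have := has_slope_contraction s0 st (has_slope_sub (lexx s) tT (has_slopeB H1 H2)).
rewrite e subrr supnorm0 => /supnorm0_eq/eqP.
by rewrite subr_eq0 => /eqP.
Qed.

End Slopes.

(** * Uniform bounds from norm continuity *)

Section OperatorNorm.
Context {R : realType} {E : compactSpaceType}.
Local Notation C := (cfun R E).

(** Boundedness makes the supremum meaningful, and f is scaled into the unit ball. Homogeneity
    stands in for a linear structure so that the difference of two operators, a bare function,
    qualifies. *)
Lemma le_opnorm (L : C -> C) f : bounded_operator L ->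
  (forall (a : R) f, L (a%:C%C *: f) = a%:C%C *: L f) ->
  supnorm (L f) <= opnorm L * supnorm f.
Proof.
move=> [K LK] Lhom.
have ub : has_ubound [set supnorm (L f) | f in [set f : C | supnorm f <= 1]].
  exists `|K| => _ [g /= g1 <-]; apply: (le_trans (LK g)).
  apply: (le_trans (ler_norm _)); rewrite normrM -[leRHS]mulr1 ler_wpM2l//.
  by rewrite ger0_norm// supnorm_ge0.
have L0 : L 0 = 0 by have := Lhom 0 0; rewrite !scale0r.
have [->|f0] := eqVneq f 0; first by rewrite L0 supnorm0 mulr0.
have sf0 : 0 < supnorm f.
  by rewrite lt_neqAle supnorm_ge0 andbT eq_sym; apply: contraNneq f0 => e0;
    apply/eqP; apply: supnorm0_eq; rewrite e0.
rewrite -ler_pdivrMr// mulrC.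
have -> : (supnorm f)^-1 * supnorm (L f) = supnorm (L ((supnorm f)^-1%:C%C *: f)).
  by rewrite Lhom supnormZr ger0_norm// invr_ge0 ltW.
apply: ub_le_sup => //; exists ((supnorm f)^-1%:C%C *: f) => //=.
by rewrite supnormZr ger0_norm ?invr_ge0 ?(ltW sf0)// mulVf// gt_eqF.
Qed.

Variable A : R -> {linear C -> C}.
Hypothesis A_bounded : forall t, 0 <= t -> bounded_operator (A t).
Hypothesis A_continuous : opnorm_continuous A.

Lemma operator_continuous t e : 0 <= t -> 0 < e -> exists2 h, 0 < h &
  forall r, 0 <= r -> `|r - t| < h -> forall f,
    supnorm (A r f - A t f) <= e * supnorm f.
Proof.
move=> t0 e0; have /(@cvgrPdist_le _ R) := A_continuous t0.
move=> /(_ _ e0) N0; have [h /= h0 H] := (nbhs_ballP (t : R) _).1 N0.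
exists h => // r r0 rt f.
have rt' : ball (t : R) h r by rewrite /ball /= distrC.
have := H r rt' r0.
rewrite sub0r normrN => He; apply: (@le_trans _ _
  (opnorm (fun f => A r f - A t f) * supnorm f)).
  apply: (le_opnorm (L := fun f => A r f - A t f)).
    have [K1 AK1] := A_bounded r0; have [K2 AK2] := A_bounded t0.
    exists (K1 + K2) => g; apply: (le_trans (supnorm_triangle _ _)).
    by rewrite supnormN mulrDl lerD.
  by move=> a g; rewrite [A r (_ *: _)]linearZ [A t (_ *: _)]linearZ scalerBr.
rewrite ler_wpM2r ?supnorm_ge0//; exact: le_trans (ler_norm _) He.
Qed.

Lemma operator_bounded T : exists2 kappa, 0 <= kappa & forall t, 0 <= t <= T ->
  forall f, supnorm (A t f) <= kappa * supnorm f.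
Proof.
have /compact_near_coveringP H : compact `[(0 : R), T] by exact: segment_compact.
(* Neighbourhoods of 0 contain negative times, where nothing is known about A; hence the guard. Near
   x the bound K + 1 works if K bounds A x, and compactness of [0, T] makes it uniform. *)
pose P (i t : R) := 0 <= t -> forall f, supnorm (A t f) <= i * supnorm f.
have /H : forall x : R, `[(0 : R), T]%classic x -> \forall x' \near x & i \near +oo, P i x'.
  move=> x; rewrite /= in_itv/= => /andP[x0 xT].
  have [K AK] := A_bounded x0.
  have [h h0 Hh] := operator_continuous x0 ltr01.
  exists (ball x h, [set i : R | K + 1 < i]).
    split => /=; first exact: nbhsx_ballx.
    by apply: nbhs_pinfty_gt; exact: num_real.
  move=> [t i] /= [xt Ki] t0 f.
  rewrite -[A t f](subrK (A x f)); apply: (le_trans (supnorm_triangle _ _)).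
  apply: (@le_trans _ _ (1 * supnorm f + K * supnorm f)).
    by apply: lerD; [apply: Hh => //; rewrite distrC|exact: AK].
  by rewrite -mulrDl ler_wpM2r ?supnorm_ge0// addrC ltW.
move=> NN.
have [k [k0 Hk]] : exists k : R, 0 <= k /\ `[(0 : R), T]%classic `<=` P k.
  near (pinfty_nbhs R) => k; exists k; split.
    by near: k; apply: nbhs_pinfty_ge; exact: num_real.
  by near: k.
exists k => // t tT f; apply: Hk; first by rewrite /= in_itv.
by case/andP: tT.
Unshelve. all: by end_near. Qed.

End OperatorNorm.

(** * The state space with cemetery *)

Section MetrizableCompact.
Context {R : realType} {E : compactSpaceType} (dist : E -> E -> R).
Hypotheses (dist_ge0 : forall x y, 0 <= dist x y)
  (dist_eq0 : forall x y, dist x y = 0 <-> x = y)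
  (dist_sym : forall x y, dist x y = dist y x)
  (dist_triangle : forall x y z, dist x z <= dist x y + dist y z)
  (nbhs_dist : forall x : E, nbhs x =
     filter_from [set e : R | 0 < e] (fun e => [set y | dist x y < e])).
Local Notation ED := (one_point_compactification E).

Let distxx x : dist x x = 0. Proof. by apply/dist_eq0. Qed.

Let nearP (x : E) (P : set E) :
  (exists2 e, 0 < e & forall y, dist x y < e -> P y) -> nbhs x P.
Proof. by rewrite nbhs_dist. Qed.

Lemma open_dist_ball x e : open [set y | dist x y < e].
Proof.
rewrite openE => y /= xy; rewrite /interior nbhs_dist.
exists (e - dist x y); first by rewrite /= subr_gt0.
move=> z /= yz; apply: le_lt_trans (dist_triangle x y z) _.
by rewrite -ltrBrDl.
Qed.

(** As E is compact, the complement of E is a neighbourhood of [None]: the cemetery is isolated. *)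
Lemma continuous_with_cemetery (g : ED -> R) :
  continuous (fun x : E => g (Some x)) -> continuous g.
Proof.
move=> cg [x|] U /=; first exact: cg.
move=> gU; exists setT; first by split; [exact: compact_setT|exact: closedT].
move=> y [[z nz]|->]; first by case: nz.
exact: nbhs_singleton gU.
Qed.

(** The distance to the complement is 1-Lipschitz and positive exactly on U. The case U = E is
    treated apart because an infimum over the empty set carries no information. *)
Lemma open_positive_set (U : set E) : open U -> exists h : E -> R,
  [/\ continuous h, forall x, 0 <= h x & U = [set x | 0 < h x]].
Proof.
move=> oU; have [U0|/set0P[z0 Uz0]] := eqVneq (~` U) set0.
  exists (fun=> 1); split => // [x|]; first exact: cvg_cst.
  by rewrite -[U]setCK U0 setC0; apply/seteqP; split => // x _ /=; exact: ltr01.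
pose D x := [set dist x z | z in ~` U].
have lbD x : lbound (D x) 0 by move=> _ [z _ <-].
have infD x : has_inf (D x) by split; [exists (dist x z0), z0|exists 0; exact: lbD].
have inf_le x z : (~` U) z -> inf (D x) <= dist x z.
  by move=> Uz; apply: ge_inf; [exists 0; exact: lbD|exists z].
have lip x y : inf (D x) <= inf (D y) + dist x y.
  rewrite -lerBlDr; apply: lb_le_inf; first exact: (infD y).1.
  move=> _ [z Uz <-]; rewrite lerBlDr; apply: (le_trans (inf_le x z Uz)).
  by rewrite addrC; exact: dist_triangle.
exists (fun x => inf (D x)); split.
- move=> x; apply/(@cvgrPdist_lt _ R) => e e0; apply: nearP.
  exists e => // y /= xy; apply: le_lt_trans xy; rewrite ler_norml.
  have h1 := lip x y; have h2 := lip y x; rewrite dist_sym in h2.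
  by apply/andP; split; lra.
- by move=> x; apply: lb_le_inf; [exact: (infD x).1|exact: lbD].
apply/seteqP; split => x /=.
  move=> Ux; have : nbhs x U by exact: open_nbhs_nbhs.
  rewrite nbhs_dist => -[e /= e0 eU]; apply: (lt_le_trans e0).
  apply: lb_le_inf; first exact: (infD x).1.
  move=> _ [z nUz <-]; rewrite leNgt; apply/negP => xz; exact/nUz/eU.
move=> h0; apply: contrapT => nUx; have := inf_le x x nUx.
by rewrite distxx leNgt h0.
Qed.

Lemma open_positive_set_cemetery (U : set ED) : open U -> exists h : ED -> R,
  [/\ continuous h, forall x, 0 <= h x & U = [set x | 0 < h x]].
Proof.
move=> oU.
have oUE : open [set x : E | U (Some x)].
  apply: (@open_comp _ _ (Some : E -> ED)) => // x _.
  exact: one_point_compactification_some_continuous.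
have [h [ch h0 Uh]] := open_positive_set oUE.
exists (fun y => if y is Some x then h x else \1_U (None : ED)); split.
- exact: continuous_with_cemetery.
- by move=> [x|] //; rewrite indicE.
apply/seteqP; split => [[x|]|[x|]] /=.
- by move=> Ux; have : [set x : E | U (Some x)] x by []; rewrite Uh.
- by move=> UN; rewrite indicE mem_set.
- by move=> hx; have : [set x | 0 < h x] x by []; rewrite -Uh.
- by rewrite indicE; case: (boolP (_ \in _)) => [/set_mem|_]; rewrite ?ltxx.
Qed.

Lemma borel_singleton_cemetery (x : ED) : borel ED [set x].
Proof.
case: x => [x|]; last exact: borel_None.
rewrite (_ : [set Some x] = Some @` [set x]); last by rewrite image_set1.
apply: borel_some.
suff o : open (~` [set x]).
  have [_ hC _] := smallest_sigma_algebra [set: E] (@open E).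
  rewrite -[[set x]]setCK -[~` ~` _]setTD; apply: hC; exact: sub_sigma_algebra.
rewrite openE => y /= yx; rewrite /interior nbhs_dist.
exists (dist y x); last by move=> z /= yz zx; move: yz; rewrite zx ltxx.
by rewrite /= lt_neqAle dist_ge0 andbT eq_sym; apply/eqP => /dist_eq0.
Qed.

(** Balls of radius 1 / (k + 1) about a dense sequence, together with the cemetery. A ball that
    contains x and has radius below half of dist x y misses y. *)
Lemma separating_cemetery : separable E -> exists U : nat -> set ED,
  (forall n, borel ED (U n)) /\ forall x y, x <> y -> exists n, U n x /\ ~ U n y.
Proof.
move=> [D cD dD].
(* An empty dense set means that E is empty; then the cemetery is the only state and there is
   nothing to separate. *)
have [D0|/set0P[z0 Dz0]] := eqVneq D set0.
  have noE (x : E) : False.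
    have [|y [_]] := dD setT _ openT; first by exists x.
    by rewrite D0.
  exists (fun=> setT); split.
    by move=> _; apply: sub_sigma_algebra; exact: openT.
  by move=> [x|] [y|] //.
have /pfcard_geP[D0|[u]] : (D #<= [set: nat])%card by exact: cD.
  by move: Dz0; rewrite D0.
pose B i k : set E := [set y | dist (u i) y < k.+1%:R^-1].
pose U n : set ED := if @unpickle (option (nat * nat)) n is Some (Some (i, k))
  then Some @` B i k else [set None].
have bU n : borel ED (U n).
  rewrite /U; case: unpickle => [[[i k]|]|]; [|exact: borel_None|exact: borel_None].
  by apply: borel_some; apply: sub_sigma_algebra; exact: open_dist_ball.
exists U; split => //.
have approx (x : E) k : exists i, B i k x.
  have [|y [xy Dy]] := dD [set y | dist x y < k.+1%:R^-1] _ (open_dist_ball x _).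
    by exists x; rewrite /= distxx invr_gt0 ltr0n.
  have [i _ iy] := @surj _ _ _ _ u y Dy; exists i; rewrite /B /= iy dist_sym.
  exact: xy.
move=> [x|] [y|] // xy.
- have d0 : 0 < dist x y.
    rewrite lt_neqAle dist_ge0 andbT eq_sym; apply/eqP => /dist_eq0 e.
    by apply: xy; rewrite e.
  have d2 : 0 < dist x y / 2 by rewrite divr_gt0.
  have [k _ /(_ k (leqnn k))/= Hk] := near_infty_natSinv_lt (PosNum d2).
  have [i Bix] := approx x k.
  exists (pickle (Some (i, k))); rewrite /U pickleK; split; first by exists x.
  move=> [z Biz [zy]]; rewrite zy in Biz.
  have := dist_triangle x (u i) y; rewrite (dist_sym x (u i)).
  move: Bix Biz Hk; rewrite /B /=; move: (k.+1%:R^-1) => q; lra.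
- have [i Bix] := approx x 0%N.
  by exists (pickle (Some (i, 0%N))); rewrite /U pickleK; split; [exists x|case].
- by exists (pickle (None : option (nat * nat))); rewrite /U pickleK.
Qed.

Lemma sequential_cemetery (g : ED -> R) :
  (forall (x : ED) (u : nat -> ED), u n @[n --> \oo] --> x ->
    g (u n) @[n --> \oo] --> g x) -> continuous g.
Proof.
move=> sg; apply: continuous_with_cemetery => x.
apply/(@cvgrPdist_lt _ R) => e e0; apply: contrapT => nN.
have H n : exists y, dist x y < n.+1%:R^-1 /\ e <= `|g (Some x) - g (Some y)|.
  apply: contrapT => H; apply: nN; apply: nearP.
  exists n.+1%:R^-1; first by rewrite /= invr_gt0 ltr0n.
  move=> y /= xy; rewrite ltNge; apply/negP => ey; apply: H; by exists y.
have [u Hu] := choice H.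
have ux : (Some (u n) : ED) @[n --> \oo] --> (Some x : ED).
  move=> V /= xV; have : nbhs x (Some @^-1` V) by exact: xV.
  rewrite nbhs_dist => -[d /= d0 dV].
  have [N _ HN] := near_infty_natSinv_lt (PosNum d0).
  by exists N => // n /= Nn; apply: dV => /=; apply: lt_trans (Hu n).1 (HN n Nn).
have /(@cvgrPdist_lt _ R)/(_ _ e0)[N _ HN] := sg _ _ ux.
by have := HN N (leqnn N); rewrite /= ltNge (Hu N).2.
Qed.

End MetrizableCompact.

(** The indicator of an open set is the limit of the continuous functions min (1, n h), which
    settles open sets. These are stable under intersection and generate the Borel sets, and the sets
    with the property form a lambda-system. *)
Lemma measurable_probability_family d (X : measurableType d) (R : realType)
    (D : ptopologicalType) (mu : X -> probability (borel_space D) R) :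
  (forall U : set D, open U -> exists h : D -> R,
    [/\ continuous h, forall x, 0 <= h x & U = [set x | 0 < h x]]) ->
  (forall g : D -> R, continuous g -> (forall x, `|g x| <= 1) ->
    measurable_fun [set: X] (fun z => \int[mu z]_x g x)) ->
  forall U : set (borel_space D), measurable U -> measurable_fun [set: X] (fun z => mu z U).
Proof.
move=> oD mg.
suff H : <<s @open D >> `<=` [set U | measurable (U : set (borel_space D)) /\
    measurable_fun [set: X] (fun z => fine (mu z U))].
  move=> U mU; have [_ mf] := H U mU.
  rewrite (_ : (fun z => mu z U) = EFin \o (fun z => fine (mu z U))).
    exact/measurable_EFinP.
  by apply/funext => z /=; rewrite fineK// fin_num_measure.
apply: lambda_system_subset => //; first by move=> A B oA oB; exact: openI.
  split => //.
  - by split => //; under eq_fun do rewrite probability_setT; exact: measurable_cst.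
  - move=> A B BA [mA fA] [mB fB]; split; first exact: measurableD.
    rewrite (_ : (fun z => _) = (fun z => fine (mu z A) - fine (mu z B))).
      exact: measurable_funB.
    apply/funext => z; rewrite measureD// ?fin_num_measure//; last first.
      by rewrite ltey_eq fin_num_measure.
    by rewrite setIC setIidl// fineB// fin_num_measure.
  - move=> F ndF HF; have mF n : measurable (F n : set (borel_space D)) by case: (HF n).
    have mUF : measurable (\bigcup_n F n : set (borel_space D)).
      exact: bigcupT_measurable.
    split => //; apply: (@measurable_fun_cvg _ X R setT (fun n z => fine (mu z (F n)))).
      by move=> n; case: (HF n).
    move=> z _; apply: fine_cvg; rewrite fineK ?fin_num_measure//.
    exact: nondecreasing_cvg_mu.
move=> U oU; split; first exact: sub_sigma_algebra.
have [h [ch h0 Uh]] := oD U oU.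
pose g n x := Num.min 1 (n%:R * h x).
have cg n : continuous (g n : D -> R).
  move=> x; apply: (continuous_min (f := fun=> 1) (g := fun x => n%:R * h x)); first exact: cvg_cst.
  by apply: cvgM; [exact: cvg_cst|exact: ch].
have g1 n x : `|g n x| <= 1.
  by rewrite ger0_norm /g ?ge_min ?lexx// le_min ler01 mulr_ge0.
apply: (@measurable_fun_cvg _ X R setT (fun n z => \int[mu z]_x g n x)).
  by move=> n; apply: mg.
move=> z _.
have -> : fine (mu z U) = \int[mu z]_x \1_U x.
  by rewrite /Rintegral integral_indic ?setIT//; exact: sub_sigma_algebra.
apply: (@bounded_cvg_Rintegral _ (borel_space D) R (mu z) setT (fun n x => g n x) _ 1) => //.
- by rewrite /= probability_setT ltry.
- by move=> n; exact: continuous_borel_measurable.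
move=> x _; rewrite indicE; case: (boolP (x \in U)) => xU.
  have hx : 0 < h x by move/set_mem : xU; rewrite Uh.
  apply: cvg_near_cst.
  have [N _ HN] := near_infty_natSinv_lt (PosNum hx).
  exists N.+1 => // -[//|n] /= Nn; rewrite /g; apply/min_idPl.
  have /= := HN n Nn; rewrite -[n.+1%:R * _]mulrC -ler_pdivrMr ?ltr0n// mul1r.
  exact: ltW.
have hx : h x = 0.
  apply/eqP; rewrite eq_le h0 andbT leNgt; apply/negP => hp.
  by move/negP : xU; apply; rewrite inE Uh.
by apply: cvg_near_cst; apply: nearW => n; rewrite /g hx mulr0 min_r// ler01.
Qed.

Lemma continuous_addZ (R : realType) (D : topologicalType) (a : R) (f g : D -> R) :
  continuous f -> continuous g -> continuous (fun x => f x + a * g x).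
Proof.
move=> cf cg x; apply: cvgD; first exact: cf.
by apply: cvgM; [exact: cvg_cst|exact: cg].
Qed.

(** * The jump kernel *)

Section CemeteryGenerator.
Context {R : realType} {E : compactSpaceType}.
Local Notation C := (cfun R E).
Local Notation ED := (one_point_compactification E).

Definition above_cemetery (G : ED -> R) (x : E) : R := G (Some x) - G None.

(** Subtracting [G None] kills the constants, so that I + L / c has total mass 1 with the defect
    sent to the cemetery. The value 0 at [None] makes the cemetery absorbing. *)
Definition cemetery_generator (L : C -> C) (G : ED -> R) (y : ED) : R :=
  if y is Some x then complex.Re (cfun_fun (L (realfun (above_cemetery G))) x : R[i])
  else 0.

Lemma some_continuous (G : ED -> R) : continuous G ->
  continuous ((fun x : E => G (Some x)) : E -> R).
Proof.
move=> cG x; apply: (@continuous_comp _ _ _ (Some : E -> ED) G); last exact: cG.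
exact: one_point_compactification_some_continuous.
Qed.

Lemma above_cemetery_continuous (G : ED -> R) : continuous G ->
  continuous (above_cemetery G).
Proof.
move=> cG x; apply: cvgB; last exact: cvg_cst.
exact: some_continuous.
Qed.

Lemma cemetery_generatorD (L : {linear C -> C}) (G H : ED -> R) y :
  continuous G -> continuous H ->
  cemetery_generator L (G \+ H) y = cemetery_generator L G y + cemetery_generator L H y.
Proof.
move=> cG cH; case: y => [x|] /=; last by rewrite addr0.
have -> : above_cemetery (G \+ H) = (fun x => above_cemetery G x + above_cemetery H x).
  by apply/funext => z; rewrite /above_cemetery /= opprD addrACA.
rewrite realfunD; [|exact: above_cemetery_continuous|exact: above_cemetery_continuous].
by rewrite [L (_ + _)]linearD cfunDE ReD.
Qed.

Lemma cemetery_generatorZ (L : {linear C -> C}) (a : R) (G : ED -> R) y :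
  continuous G ->
  cemetery_generator L (fun y => a * G y) y = a * cemetery_generator L G y.
Proof.
move=> cG; case: y => [x|] /=; last by rewrite mulr0.
have -> : above_cemetery (fun y => a * G y) = (fun x => a * above_cemetery G x).
  by apply/funext => z; rewrite /above_cemetery mulrBr.
rewrite realfunZ; last exact: above_cemetery_continuous.
by rewrite [L (_ *: _)]linearZ cfunZE ReZ.
Qed.

Lemma cemetery_generator_dist (L1 L2 : C -> C) (G : ED -> R) (M e : R) y :
  continuous G -> (forall y, `|G y| <= M) -> 0 <= e ->
  (forall f, supnorm (L1 f - L2 f) <= e * supnorm f) ->
  `|cemetery_generator L1 G y - cemetery_generator L2 G y| <= e * (2 * M).
Proof.
move=> cG GM e0 Le.
have M0 : 0 <= M by apply: le_trans (normr_ge0 _) (GM None).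
case: y => [x|] /=; last by rewrite subrr normr0 !mulr_ge0.
rewrite -ReB -cfunBE; apply: (le_trans (Re_le_supnorm _ x)); apply: (le_trans (Le _)).
rewrite ler_wpM2l//; apply: supnorm_realfun_le; first by rewrite mulr_ge0.
  exact: above_cemetery_continuous.
move=> z; apply: (le_trans (ler_normB _ _)).
by have := GM (Some z); have := GM None; lra.
Qed.

Lemma cemetery_generator_continuous (L : C -> C) (G : ED -> R) :
  continuous (cemetery_generator L G).
Proof. by apply: continuous_with_cemetery => x; exact: cfun_Re_continuous. Qed.

(** G - G None is the restriction of G minus a nonnegative constant, and L maps the constant 1 to a
    nonpositive function; the subtracted constant can only raise the value. *)
Lemma cemetery_generator_lower (L : {linear C -> C}) (kappa : R) (G : ED -> R) y :
  generates_positive_contraction_semigroup L -> 0 <= kappa ->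
  (forall f, supnorm (L f) <= kappa * supnorm f) ->
  continuous G -> (forall y, 0 <= G y) ->
  - (kappa * G y) <= cemetery_generator L G y.
Proof.
move=> [S [_ Spos Scon LS]] k0 Lk cG G0.
case: y => [x|] /=; last by rewrite oppr_le0 mulr_ge0.
have cg : continuous ((fun x : E => G (Some x)) : E -> R).
  exact: some_continuous.
have c1 : continuous ((fun=> 1) : E -> R) by move=> z; exact: cvg_cst.
have cc : continuous ((fun=> - G None * 1) : E -> R) by move=> z; exact: cvg_cst.
have -> : above_cemetery G = (fun x => G (Some x) + (- G None * 1)).
  by apply/funext => z; rewrite mulr1.
rewrite (realfunD cg cc) (realfunZ _ c1) [L (_ + _)]linearD [L (_ *: _)]linearZ.
rewrite cfunDE cfunZE ReD ReZ.
have h1 := generator_lower Spos LS x Lk k0 cg (fun y => G0 (Some y)).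
have h2 := generator_one_le0 Scon LS x.
have : 0 <= - G None * complex.Re (cfun_fun (L (realfun (fun=> 1))) x : R[i]).
  by rewrite mulNr -mulrN mulr_ge0// oppr_ge0.
lra.
Qed.

End CemeteryGenerator.

Section JumpKernel.
Context {R : realType} {E : compactSpaceType}.
Local Notation C := (cfun R E).
Local Notation ED := (one_point_compactification E).
Local Notation S := (borel_space ED).
Context (A : R -> {linear C -> C}) (T kappa : R) (c : {posnum R}).
Hypothesis A_bounded : forall t, 0 <= t -> bounded_operator (A t).
Hypothesis A_continuous : opnorm_continuous A.
Hypothesis A_generates : forall t, 0 <= t ->
  generates_positive_contraction_semigroup (A t).
Hypotheses (T0 : 0 < T) (kappa0 : 0 <= kappa) (kappac : kappa <= c%:num).
Hypothesis A_kappa : forall t, 0 <= t <= T -> forall f,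
  supnorm (A t f) <= kappa * supnorm f.
Hypothesis open_positive : forall U : set ED, open U -> exists h : ED -> R,
  [/\ continuous h, forall x, 0 <= h x & U = [set x | 0 < h x]].
Local Notation clamp := (clamp_time T).

Let clampT u : 0 <= clamp u <= T.
Proof. by rewrite clamp_ge0 (le_trans (clamp_le T u))// max_r// ltW. Qed.

Definition generator_at (u : R) : (ED -> R) -> ED -> R :=
  cemetery_generator (A (clamp u)).

(** The Riesz theorem for I + A / c: the mass is 1 because constants are killed, and positivity
    holds because A G >= - kappa G for G >= 0, with kappa <= c. *)
Lemma jump_probability_exists (z : R * S) : exists mu : probability S R,
  forall G : ED -> R, continuous G ->
    \int[mu]_y G y = G z.2 + c%:num^-1 * generator_at z.1 G z.2.
Proof.
pose L (G : ED -> R) := G z.2 + c%:num^-1 * generator_at z.1 G z.2.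
have [||||||mu Hmu] := @positive_functional_probability R ED L.
- exact: one_point_compactification_compact.
- move=> G H cG cH; rewrite /L /generator_at cemetery_generatorD//=; ring.
- move=> a G cG; rewrite /L /generator_at cemetery_generatorZ//=; ring.
- move=> G cG G0; rewrite /L.
  have /andP[c0 _] := clampT z.1.
  have := cemetery_generator_lower z.2 (A_generates c0) kappa0 (A_kappa (clampT z.1)) cG G0.
  rewrite -/(generator_at z.1) => lo.
  have : - G z.2 <= c%:num^-1 * generator_at z.1 G z.2.
    rewrite ler_pdivlMl//; apply: le_trans lo.
    by rewrite mulrN lerN2 ler_wpM2r.
  lra.
- rewrite /L /generator_at; case: z.2 => [x|] /=; last by rewrite mulr0 addr0.
  have -> : above_cemetery (fun=> 1 : R) = (fun x : E => 0 * 1).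
    by apply/funext => y; rewrite /above_cemetery subrr mul0r.
  rewrite realfunZ; last by move=> y; exact: cvg_cst.
  by rewrite scale0r linear0 mulr0 addr0.
- exact: open_positive.
by exists mu.
Qed.

Definition jump_probability (z : R * S) : probability S R :=
  sval (cid (jump_probability_exists z)).

Lemma jump_probabilityE (z : R * S) (G : ED -> R) : continuous G ->
  \int[jump_probability z]_y G y = G z.2 + c%:num^-1 * generator_at z.1 G z.2.
Proof. by move=> cG; rewrite /jump_probability; case: cid => mu /= ->. Qed.

Lemma generator_at_time (G : ED -> R) (M : R) : continuous G -> (forall y, `|G y| <= M) ->
  forall t e, 0 < e -> exists2 h, 0 < h & forall u x, `|u - t| < h ->
    `|generator_at u G x - generator_at t G x| <= e.
Proof.
move=> cG GM t e e0.
have M0 : 0 <= M by apply: le_trans (normr_ge0 _) (GM None).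
have e1 : 0 < e / (2 * M + 1) by rewrite divr_gt0// ltr_wpDl// mulr_ge0.
have /andP[ct _] := clampT t.
have [h h0 H] := operator_continuous A_bounded A_continuous ct e1.
exists h => // u x ut; have /andP[cu _] := clampT u.
have cut : `|clamp u - clamp t| < h.
  apply: le_lt_trans ut.
  by have [tu|ut] := leP t u;
    [rewrite ger0_norm ?subr_ge0 ?le_clamp// ger0_norm ?subr_ge0//
    |rewrite distrC ger0_norm ?subr_ge0 ?le_clamp ?(ltW ut)// distrC gtr0_norm ?subr_gt0//];
    apply: clamp_lipschitz => //; exact: ltW.
apply: (le_trans (cemetery_generator_dist x cG GM (ltW e1) (H _ cu cut))).
rewrite mulrAC ler_pdivrMr ?ltr_wpDl ?mulr_ge0//.
by rewrite ler_wpM2l ?(ltW e0)// lerDl.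
Qed.

(** Joint measurability by rounding the time: at a fixed time the value is continuous in the state,
    and rounded values converge by continuity in time. *)
Lemma measurable_generator_at (G : ED -> R) (M : R) : continuous G ->
  (forall y, `|G y| <= M) ->
  measurable_fun [set: R * S] (fun z => generator_at z.1 G z.2).
Proof.
move=> cG GM.
have mcl : measurable_fun [set: R * S] (fun z => clamp z.1).
  exact: (measurableT_comp (@measurable_clamp R T) (@measurable_fst _ _ R S)).
apply: (@measurable_fun_cvg _ (R * S)%type R setT
  (fun n z => generator_at (grid T n (cell n (clamp z.1))) G z.2)).
  move=> n; apply: (@measurable_cells _ (R * S)%type R (fun z => cell n (clamp z.1))
    (fun=> 0%N) (fun k l z => generator_at (grid T n k) G z.2)).
  - move=> k.
    rewrite (_ : [set z | _] = [set: R * S] `&` (fun z : R * S => clamp z.1) @^-1`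
        `[k%:R / n.+1%:R, k.+1%:R / n.+1%:R[%classic).
      exact: mcl.
    rewrite setTI; apply/seteqP; split => z /=.
      by move=> /eqP; rewrite cellP ?clamp_ge0// in_itv.
    by rewrite in_itv/= -cellP ?clamp_ge0// => /eqP.
  - by move=> k; case: (eqVneq 0%N k) => [->|/eqP nk];
      [rewrite (_ : [set _ | _] = setT)//; apply/seteqP; split
      |rewrite (_ : [set _ | _] = set0)//; apply/seteqP; split].
  - move=> k l; apply: (measurableT_comp _ (@measurable_snd _ _ R S)).
    apply: continuous_borel_measurable; exact: cemetery_generator_continuous.
move=> z _; apply/(@cvgrPdist_le _ R) => e e0.
have [h h0 H] := generator_at_time cG GM (clamp z.1) e0.
have /andP[c0 cT] := clampT z.1.
near=> n; rewrite distrC.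
have -> : generator_at z.1 G z.2 = generator_at (clamp z.1) G z.2.
  by rewrite /generator_at clampK.
apply: H; rewrite -/(round_up T n (clamp z.1)).
have /andP[h1 h2] : clamp z.1 <= round_up T n (clamp z.1) < clamp z.1 + h.
  by near: n; exact: round_up_cvg.
by rewrite ger0_norm ?subr_ge0// ltrBlDl.
Unshelve. all: by end_near. Qed.

Let measurable_jump_probability (U : set S) : measurable U ->
  measurable_fun [set: R * S] (jump_probability ^~ U).
Proof.
apply: measurable_probability_family => // g cg g1.
under eq_fun do rewrite jump_probabilityE//.
apply: measurable_funD.
  exact: (measurableT_comp (continuous_borel_measurable cg) (@measurable_snd _ _ R S)).
by apply: measurable_funM => //; exact: measurable_generator_at cg g1.
Qed.

Definition jump_kernel : R * S -> {measure set S -> \bar R} := jump_probability.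

HB.instance Definition _ :=
  isKernel.Build _ _ (R * S)%type S R jump_kernel measurable_jump_probability.

Let jump_kernelT z : jump_kernel z setT = 1%E.
Proof. exact: probability_setT. Qed.

HB.instance Definition _ :=
  Kernel_isProbability.Build _ _ (R * S)%type S R jump_kernel jump_kernelT.

Definition jump_pker : R.-pker (R * S)%type ~> S := jump_kernel.

Lemma jump_pkerE u x (G : ED -> R) : continuous G ->
  \int[jump_pker (u, x)]_y G y = G x + c%:num^-1 * generator_at u G x.
Proof. exact: jump_probabilityE. Qed.

Lemma jump_pker_feller u (G : ED -> R) (M : R) : continuous G ->
  (forall y, `|G y| <= M) -> continuous (fun x : ED => \int[jump_pker (u, x)]_y G y : R).
Proof.
move=> cG _.
rewrite (_ : (fun x => _) = (fun x => G x + c%:num^-1 * generator_at u G x)); last first.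
  by apply/funext => x; rewrite jump_pkerE.
exact: continuous_addZ cG (@cemetery_generator_continuous _ _ _ _).
Qed.

Lemma jump_pker_time (G : ED -> R) (M : R) : continuous G -> (forall y, `|G y| <= M) ->
  forall t e, 0 < e -> exists2 h, 0 < h & forall u x, `|u - t| < h ->
    `|\int[jump_pker (u, x)]_y G y - \int[jump_pker (t, x)]_y G y| <= e.
Proof.
move=> cG GM t e e0; have ce : 0 < c%:num * e by rewrite mulr_gt0.
have [h h0 H] := generator_at_time cG GM t ce; exists h => // u x ut.
rewrite !jump_pkerE// opprD addrACA subrr add0r -mulrBr normrM gtr0_norm ?invr_gt0//.
by rewrite ler_pdivrMl//; exact: H.
Qed.

Lemma jump_pker_None u : jump_pker (u, None) [set None] = 1%E.
Proof.
have cN : continuous (\1_[set None] : ED -> R).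
  apply: continuous_with_cemetery.
  rewrite (_ : (fun x => _) = (fun=> 0)); first by move=> x; exact: cvg_cst.
  by apply/funext => x; rewrite indicE memNset.
have mN : measurable ([set None] : set S) by exact: borel_None.
have e : \int[jump_pker (u, None)]_y (\1_[set None] : ED -> R) y = 1.
  rewrite jump_pkerE// [generator_at _ _ _](_ : _ = 0)// mulr0 addr0.
  by rewrite indicE mem_set.
rewrite -[RHS]/((1 : R)%:E) -e /Rintegral integral_indic// setIT fineK//.
exact: fin_num_measure.
Qed.

End JumpKernel.

(** * Mean values as solutions on a finite horizon *)

Section LocalSolution.
Context {R : realType} {E : compactSpaceType}.
Local Notation C := (cfun R E).
Local Notation ED := (one_point_compactification E).
Local Notation S := (borel_space ED).
Context (A : R -> {linear C -> C}) (T : R) (c : {posnum R})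
  (K : R.-pker (R * S)%type ~> S).
Hypothesis A_generates : forall t, 0 <= t ->
  generates_positive_contraction_semigroup (A t).
Hypothesis sequential : forall g : ED -> R,
  (forall (x : ED) (u : nat -> ED), u n @[n --> \oo] --> x ->
    g (u n) @[n --> \oo] --> g x) -> continuous g.
Hypothesis KE : forall u x (G : ED -> R), 0 <= u <= T -> continuous G ->
  \int[K (u, Some x)]_y G y = G (Some x) + c%:num^-1 *
    complex.Re (cfun_fun (A u (realfun (above_cemetery G))) x : R[i]).
Hypothesis K_feller : forall u (G : ED -> R) (M : R), continuous G ->
  (forall y, `|G y| <= M) -> continuous (fun x : ED => \int[K (u, x)]_y G y : R).
Hypothesis K_time : forall (G : ED -> R) (N : R), continuous G ->
  (forall y, `|G y| <= N) -> forall t e, 0 < e -> exists2 h, 0 < h &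
    forall u x, `|u - t| < h -> `|\int[K (u, x)]_y G y - \int[K (t, x)]_y G y| <= e.
Hypothesis KNone : forall u, K (u, None) [set None] = 1%E.

Local Notation transition := (transition_mean c T K).
Local Notation X := (@position_at R E).
Local Notation P := (@path_law R E T c K).

Lemma continuous_bounded_borel (g : E -> R) M : continuous g ->
  (forall x, `|g x| <= M) -> bounded_borel g.
Proof.
move=> cg gM; split; last by exists M.
move=> _ [B mB <-]; rewrite setTI; move: B mB.
suff H : (measurable : set (set R)) `<=` [set B : set R | borel E (g @^-1` B)] by [].
have -> : (measurable : set (set R)) = _ := RGenOInfty.measurableE R.
have [h0 hC hU] := smallest_sigma_algebra [set: E] (@open E).
apply: smallest_sub.
  split => //=.
  - by move=> B bB; exact: hC bB.
  - by move=> F bF; rewrite preimage_bigcup; exact: hU.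
move=> _ [b ->]; apply: sub_sigma_algebra; apply: open_comp; last exact: rray_open.
by move=> x _; exact: cg.
Qed.

Section RealFunction.
Variables (g : E -> R) (M s : R).
Hypotheses (cg : continuous g) (gM : forall x, `|g x| <= M) (M0 : 0 <= M)
  (s0 : 0 <= s).
Local Notation G := (extend0 g : ED -> R).

Let cG : continuous G. Proof. exact: continuous_with_cemetery. Qed.
Let GM y : `|G y| <= M. Proof. by case: y => [x|] /=; rewrite ?normr0. Qed.
Let mG : measurable_fun [set: S] G. Proof. exact: continuous_borel_measurable. Qed.

Definition state_mean (t : R) (x : E) : R := transition s G (t, Some x).

Definition mean_path (t : R) : C := realfun (state_mean t).

(** |G| is at most M times the indicator of E, whose mean from the absorbing cemetery is 0. *)
Lemma transition_None t : s <= t -> transition s G (t, None) = 0.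
Proof.
move=> st; pose N : S -> R := \1_(~` [set None]).
have mNone : measurable ([set None] : set S) by exact: borel_None.
have mN : measurable_fun [set: S] N by apply: measurable_indic; exact: measurableC.
have N1 y : `|N y| <= 1 by rewrite /N indicE; case: (_ \in _); rewrite ?normr1 ?normr0.
have mo (h : S -> R) : measurable_fun [set: S] h ->
    measurable_fun [set: path_space R S] (fun w : path_space R S => h (w s)).
  by move=> mh; exact: (measurable_position s mh).
have := transition_absorbing c T mNone KNone st; rewrite -/N => N0.
have e1 := Rintegral_law c T K (t, None) (mo _ mG) (fun w => GM (w s)).
have e2 := Rintegral_law c T K (t, None) (mo _ mN) (fun w => N1 (w s)).
rewrite /transition_mean -e1; apply/eqP; rewrite -normr_le0.
have <- : M * \int[start_law c T K (t, None)]_w N (w s) = 0.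
  by rewrite e2 -/(transition_mean c T K s N (t, None)) N0 mulr0.
have QT : (start_law c T K (t, None) setT < +oo)%E by rewrite /= probability_setT ltry.
have iN : (start_law c T K (t, None)).-integrable setT (EFin \o (fun w : path_space R S => N (w s))).
  exact: (bounded_integrable measurableT QT (mo _ mN) (fun w => N1 (w s))).
rewrite -RintegralZl//; apply: normr_Rintegral_le => //.
- exact: (bounded_integrable measurableT QT (mo _ mG) (fun w => GM (w s))).
- apply: (bounded_integrable measurableT QT (M := M)).
    by apply: measurable_funM => //; exact: (mo _ mN).
  by move=> w; rewrite normrM (ger0_norm M0) -[leRHS]mulr1 ler_wpM2l.
move=> w _; rewrite /N indicE; case: (w s) => [x|] /=.
  by rewrite mem_set//= mulr1; exact: gM.
rewrite memNset ?mulr0 ?normr0// => h; exact: h.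
Qed.

Let cF t : s <= t -> t <= T -> continuous (fun y : ED => transition s G (t, y)).
Proof. exact: transition_continuous. Qed.

Lemma state_mean_continuous t : s <= t -> t <= T -> continuous (state_mean t).
Proof. by move=> st tT; exact: (some_continuous (cF st tT)). Qed.

Lemma mean_pathE t x : s <= t -> t <= T ->
  cfun_fun (mean_path t) x = (expect X P t (Some x) g s)%:C%C :> R[i].
Proof.
move=> st tT; rewrite (realfunE x (state_mean_continuous st tT)).
by rewrite /state_mean -expectE//; exact: continuous_bounded_borel cg gM.
Qed.

Lemma mean_path_start : mean_path s = realfun g.
Proof.
congr realfun; apply/funext => x.
exact: (transition_refl c T K mG GM).
Qed.

Lemma mean_path_lipschitz r t : s <= r -> r <= t -> t <= T ->
  supnorm (mean_path t - mean_path r) <= 2 * M * c%:num * total_mass_bound c T * (t - r).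
Proof.
move=> sr rt tT; have st := le_trans sr rt; have rT := le_trans rt tT.
have L0 : 0 <= 2 * M * c%:num * total_mass_bound c T * (t - r).
  by rewrite !mulr_ge0// ?subr_ge0// expR_ge0.
apply: supnorm_le => // x.
rewrite cfunBE (realfunE x (state_mean_continuous st tT)).
rewrite (realfunE x (state_mean_continuous sr rT)) -rmorphB normc_def /=.
rewrite expr0n /= addr0 sqrtr_sqr.
exact: (transition_lipschitz c T K mG GM).
Qed.

(** By [KE], c (K F - F) = A F for the mean F: as F vanishes at the cemetery, [above_cemetery]
    leaves it unchanged. The norm is that of complex functions, so A F must also be real, which is
    [generator_Im]. *)
Lemma mean_path_slope : has_slope A s T mean_path.
Proof.
move=> t e /andP[st tT] e0.
have t0T : 0 <= t <= T by rewrite (le_trans s0 st).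
have [S0 [_ Spos Scon LS]] := A_generates (le_trans s0 st).
have [h h0 H] := transition_derivative c sequential K_feller cG GM s0 K_time st tT e0.
exists h => // r /andP[sr rT] rt.
apply: supnorm_le => [|x]; first by rewrite mulr_ge0// ltW.
have cr := state_mean_continuous sr rT; have ct := state_mean_continuous st tT.
rewrite cfunBE cfunBE cfunZE (realfunE x cr) (realfunE x ct).
rewrite normc_def ImB ImB ImZ (generator_Im Spos LS x ct) /=.
rewrite subrr mulr0 subr0 expr0n /= addr0 sqrtr_sqr ReB ReB ReZ /=.
have := H r (Some x) _ rt; rewrite sr rT => /(_ isT).
rewrite (KE x t0T (cF st tT)).
have -> : above_cemetery (fun y => transition s G (t, y)) = state_mean t.
  by apply/funext => z; rewrite /above_cemetery transition_None// subr0.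
have cE (u b : R) : c%:num * (u + c%:num^-1 * b - u) = b.
  by rewrite addrAC subrr add0r mulrA divff ?gt_eqF// mul1r.
by rewrite cE.
Qed.

End RealFunction.

(** Twice the constant of [mean_path_lipschitz] with M = 1, for the real and the imaginary part. *)
Definition lipschitz_bound : R := 4 * c%:num * total_mass_bound c T.

Lemma lipschitz_bound_ge0 : 0 <= lipschitz_bound.
Proof. by rewrite !mulr_ge0// expR_ge0. Qed.

Lemma supnormZi (f : C) : supnorm ('i%C *: f) = supnorm f.
Proof.
apply: complexI; rewrite supnormZ normc_def /= expr0n /= expr1n add0r sqrtr1.
exact: mul1r.
Qed.

Lemma local_solution (f : C) s : 0 <= s -> exists V : R -> C,
  [/\ V s = f, has_slope A s T V,
      forall t x, s <= t -> t <= T -> cfun_fun (V t) x = cexpect X P t (Some x) f s &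
      forall r t, s <= r -> r <= t -> t <= T ->
        supnorm (V t - V r) <= lipschitz_bound * supnorm f * (t - r)].
Proof.
move=> s0; pose M := supnorm f; have M0 : 0 <= M by exact: supnorm_ge0.
pose g1 (x : E) : R := complex.Re (cfun_fun f x : R[i]).
pose g2 (x : E) : R := complex.Im (cfun_fun f x : R[i]).
have c1 : continuous g1 by exact: cfun_Re_continuous.
have c2 : continuous g2 by exact: cfun_Im_continuous.
have b1 x : `|g1 x| <= M by exact: Re_le_supnorm.
have b2 x : `|g2 x| <= M by exact: Im_le_supnorm.
exists (fun t => mean_path g1 s t + 'i%C *: mean_path g2 s t); split.
- by rewrite (mean_path_start s c1 b1 M0) (mean_path_start s c2 b2 M0) -cfun_ReIm.
- apply: has_slopeD; first exact: mean_path_slope c1 b1 M0 s0.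
  by apply: has_slopeZ; exact: mean_path_slope c2 b2 M0 s0.
- move=> t x st tT; rewrite cfunDE cfunZE (mean_pathE c1 b1 M0 s0 x st tT).
  rewrite (mean_pathE c2 b2 M0 s0 x st tT).
  by rewrite [RHS]complexE.
move=> r t sr rt tT.
have -> : mean_path g1 s t + 'i%C *: mean_path g2 s t -
    (mean_path g1 s r + 'i%C *: mean_path g2 s r) =
    (mean_path g1 s t - mean_path g1 s r) +
    'i%C *: (mean_path g2 s t - mean_path g2 s r).
  by rewrite scalerBr opprD addrACA.
apply: (le_trans (supnorm_triangle _ _)); rewrite supnormZi.
have l1 := mean_path_lipschitz c1 b1 M0 s0 sr rt tT.
have l2 := mean_path_lipschitz c2 b2 M0 s0 sr rt tT.
apply: (le_trans (lerD l1 l2)); rewrite /lipschitz_bound -/M.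
by rewrite le_eqVlt; apply/orP; left; apply/eqP; ring.
Qed.

End LocalSolution.

(** * The evolution family *)

Section Evolution.
Context {R : realType} {E : compactSpaceType}.
Local Notation C := (cfun R E).
Local Notation ED := (one_point_compactification E).
Local Notation Om := (path_space R (borel_space ED)).
Context (A : R -> {linear C -> C}).
Hypothesis polishE : polish R E.
Hypothesis A_bounded : forall t, 0 <= t -> bounded_operator (A t).
Hypothesis A_continuous : opnorm_continuous A.
Hypothesis A_generates : forall t, 0 <= t ->
  generates_positive_contraction_semigroup (A t).

(** The Lipschitz clause is uniform in s and linear in the norm of f; it yields strong continuity
    jointly in both times. *)
Definition local_family (T : R) (L : R) (V : R -> C -> R -> C) : Prop :=
  forall s f, 0 <= s -> [/\ V s f s = f, has_slope A s T (V s f) &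
    forall r t, s <= r -> r <= t -> t <= T ->
      supnorm (V s f t - V s f r) <= L * supnorm f * (t - r)].

Lemma local_process (T : R) : 0 < T ->
  exists (X : R -> Om -> with_cemetery E) (P : R -> with_cemetery E -> probability Om R),
    hunt_process T X P /\ exists L V, [/\ 0 <= L, local_family T L V &
      forall s f t x, 0 <= s -> s <= t -> t <= T ->
        cfun_fun (V s f t) x = cexpect X P t (Some x) f s].
Proof.
move=> T0; have [sepE [dist [[d0 d1 ds dt] dn _]]] := polishE.
have [kappa k0 Hk] := operator_bounded A_bounded A_continuous T.
(* The rate kappa + 1 is positive even if kappa = 0, and it dominates kappa as the jump kernel
   requires. *)
have k1 : 0 < kappa + 1 by rewrite ltr_wpDl.
pose c : {posnum R} := PosNum k1.
have kc : kappa <= c%:num by rewrite /= lerDl.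
have oP := open_positive_set_cemetery d0 d1 ds dt dn.
pose K := jump_pker A_bounded A_continuous A_generates T0 k0 kc Hk oP.
have seqE := @sequential_cemetery _ _ dist dn.
have KF u (G : ED -> R) (M : R) : continuous G -> (forall y, `|G y| <= M) ->
    continuous (fun x : ED => \int[K (u, x)]_y G y : R) by exact: jump_pker_feller.
have KT := @jump_pker_time _ _ _ _ _ _ A_bounded A_continuous A_generates T0 k0 kc Hk oP.
have KN u : K (u, None) [set None] = 1%E by exact: jump_pker_None.
exists (@position_at R E), (@path_law R E T c K); split.
  apply: hunt_process_position => //.
  - exact: borel_singleton_cemetery d0 d1 dn.
  - exact: separating_cemetery d0 d1 ds dt dn sepE.
have KE u x (G : ED -> R) : 0 <= u <= T -> continuous G ->
    \int[K (u, Some x)]_y G y = G (Some x) + c%:num^-1 *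
      complex.Re (cfun_fun (A u (realfun (above_cemetery G))) x : R[i]).
  move=> u0T cG; rewrite jump_pkerE// /generator_at /=.
  by rewrite clamp_id.
have H (p : R * C) : exists V : R -> C, 0 <= p.1 ->
    [/\ V p.1 = p.2, has_slope A p.1 T V,
      forall t x, p.1 <= t -> t <= T ->
        cfun_fun (V t) x = cexpect (@position_at R E) (@path_law R E T c K) t (Some x) p.2 p.1 &
      forall r t, p.1 <= r -> r <= t -> t <= T ->
        supnorm (V t - V r) <= lipschitz_bound T c * supnorm p.2 * (t - r)].
  have [p0|np0] := pselect (0 <= p.1); last by exists (fun=> 0).
  have [V HV] := local_solution A_generates seqE KE KF KT KN p.2 p0.
  by exists V.
have [V HV] := choice H.
exists (lipschitz_bound T c), (fun s f => V (s, f)); split.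
- exact: lipschitz_bound_ge0.
- by move=> s f s0; have [] := HV (s, f) s0.
- by move=> s f t x s0 st tT; have [_ _ h _] := HV (s, f) s0; exact: h.
Qed.

Lemma has_slope_eq s T w1 w2 : (forall t, s <= t <= T -> w1 t = w2 t) ->
  has_slope A s T w1 -> has_slope A s T w2.
Proof.
move=> ww H t e tsT e0; have [h h0 K] := H t e tsT e0; exists h => // r rsT rt.
by rewrite -(ww r rsT) -(ww t tsT); exact: K.
Qed.

(** The value at t is read off from the solution with horizon t + 1. By uniqueness it agrees with
    that of any horizon T >= t, so slopes and Lipschitz bounds carry over. *)
Lemma global_family : exists V : R -> C -> R -> C,
  forall T, 0 < T -> exists2 L, 0 <= L & local_family T L V.
Proof.
have H (T : R) : exists V, 0 < T -> exists2 L, 0 <= L & local_family T L V.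
  have [T0|nT0] := pselect (0 < T); last by exists (fun _ _ _ => 0).
  by have [X [P [_ [L [V [L0 HV _]]]]]] := local_process T0; exists V => _; exists L.
have [W HW] := choice H.
exists (fun s f t => W (t + 1) s f t) => T T0.
have [L L0 HL] := HW T T0; exists L => // s f s0.
have [V1 V2 V3] := HL s f s0.
have EW t : s <= t <= T -> W T s f t = W (t + 1) s f t.
  move=> /andP[st tT].
  have t10 : 0 < t + 1 by rewrite ltr_wpDl// (le_trans s0).
  have [L1 _ HL1] := HW _ t10; have [U1 U2 _] := HL1 s f s0.
  have tt1 : t <= t + 1 by rewrite lerDl.
  apply: (has_slope_unique A_generates s0 (has_slope_sub (lexx s) tT V2)
    (has_slope_sub (lexx s) tt1 U2)); first by rewrite V1 U1.
  by rewrite st lexx.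
split.
- have s10 : 0 < s + 1 by rewrite ltr_wpDl.
  by have [L1 _ HL1] := HW _ s10; have [-> _ _] := HL1 s f s0.
- exact: has_slope_eq V2.
- move=> r t sr rt tT; rewrite -!EW; [exact: V3|..].
  + by rewrite sr (le_trans rt).
  + by rewrite (le_trans sr rt).
Qed.

Section Family.
Variable V : R -> C -> R -> C.
Hypothesis HV : forall T, 0 < T -> exists2 L, 0 <= L & local_family T L V.

Let V_start s f : 0 <= s -> V s f s = f.
Proof. by move=> s0; have [L _ /(_ s f s0)[]] := HV ltr01. Qed.

Let V_slope s f T : 0 <= s -> has_slope A s T (V s f).
Proof.
move=> s0; have [T0|nT0] := ltP 0 (T + 1).
  have [L _ /(_ s f s0)[_ H _]] := HV T0.
  by apply: has_slope_sub H => //; rewrite lerDl.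
by move=> t e /andP[st tT]; exfalso; move: (le_trans s0 (le_trans st tT)); lra.
Qed.

(** Outside 0 <= s <= t the identity keeps the map linear for all pairs of times. *)
Definition evolution (t s : R) (f : C) : C :=
  if (0 <= s) && (s <= t) then V s f t else f.

(** Linearity and the composition law are instances of this, with w the curve that ought to be the
    solution. *)
Lemma evolution_unique s T w t : 0 <= s -> has_slope A s T w -> s <= t -> t <= T ->
  evolution t s (w s) = w t.
Proof.
move=> s0 Hw st tT; rewrite /evolution s0 st /=.
have H := has_slope_unique A_generates s0 (@V_slope s (w s) T s0) Hw (V_start (w s) s0).
by apply: H; rewrite st.
Qed.

Lemma evolution_slope s T f : 0 <= s -> has_slope A s T (fun t => evolution t s f).
Proof.
move=> s0; apply: has_slope_eq (@V_slope s f T s0) => t /andP[st _].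
by rewrite /evolution s0 st.
Qed.

Lemma evolution_refl t f : evolution t t f = f.
Proof.
rewrite /evolution lexx andbT; case: ifPn => // t0; exact: V_start.
Qed.

Lemma evolution_linear t s (a : R[i]) (f g : C) :
  evolution t s (a *: f + g) = a *: evolution t s f + evolution t s g.
Proof.
have [/andP[s0 st]|nst] := boolP ((0 <= s) && (s <= t)); last first.
  by rewrite /evolution (negbTE nst).
have H := has_slopeD (has_slopeZ a (@evolution_slope s t f s0)) (@evolution_slope s t g s0).
have := evolution_unique s0 H st (lexx t).
by rewrite !evolution_refl.
Qed.

HB.instance Definition _ t s :=
  GRing.isLinear.Build R[i] C C *:%R (evolution t s) (evolution_linear t s).

Definition evolution_map t s : {linear C -> C} := evolution t s.

Lemma evolution_comp s r t f : 0 <= s -> s <= r -> r <= t ->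
  evolution t r (evolution r s f) = evolution t s f.
Proof.
move=> s0 sr rt; have r0 := le_trans s0 sr.
have H := has_slope_sub sr (lexx t) (@evolution_slope s t f s0).
exact: evolution_unique r0 H rt (lexx t).
Qed.

Lemma evolution_contraction s t f : 0 <= s -> s <= t ->
  supnorm (evolution t s f) <= supnorm f.
Proof.
move=> s0 st; have := has_slope_contraction A_generates s0 st (@evolution_slope s t f s0).
by rewrite evolution_refl.
Qed.

(** In t this is the bound of the family. Dependence on s reduces to it by U(t,s) f - U(t,s') f =
    U(t,s') (U(s',s) f - f) for s <= s' <= t and contractivity. *)
Lemma evolution_lipschitz T : 0 < T -> exists2 L, 0 <= L &
  forall s t s' t' f, 0 <= s -> s <= t -> t <= T -> 0 <= s' -> s' <= t' -> t' <= T ->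
    supnorm (evolution t s f - evolution t' s' f) <=
    L * supnorm f * (`|s - s'| + `|t - t'|).
Proof.
move=> T0; have [L L0 HL] := HV T0; exists L => //.
have lip s r t f : 0 <= s -> s <= r -> r <= t -> t <= T ->
    supnorm (evolution t s f - evolution r s f) <= L * supnorm f * (t - r).
  move=> s0 sr rt tT; rewrite /evolution s0 sr (le_trans sr rt) /=.
  by have [_ _ h] := HL s f s0; exact: h.
have lipa s t t' f : 0 <= s -> s <= t -> t <= T -> s <= t' -> t' <= T ->
    supnorm (evolution t s f - evolution t' s f) <= L * supnorm f * `|t - t'|.
  move=> s0 st tT st' t'T; have [tt'|t't] := leP t t'.
    by rewrite supnorm_distC distrC ger0_norm ?subr_ge0//; exact: lip.
  by rewrite gtr0_norm ?subr_gt0//; apply: lip => //; exact: ltW.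
have lips s s' t f : 0 <= s -> s <= s' -> s' <= t -> t <= T ->
    supnorm (evolution t s f - evolution t s' f) <= L * supnorm f * (s' - s).
  move=> s0 ss' s't tT; rewrite -(evolution_comp f s0 ss' s't).
  rewrite -[evolution t s' _ - _]linearB.
  apply: (le_trans (evolution_contraction _ (le_trans s0 ss') s't)).
  rewrite -[X in _ - X](evolution_refl s f).
  by apply: lip => //; exact: le_trans tT.
move=> s t s' t' f s0 st tT s'0 s't' t'T.
have N0 : 0 <= L * supnorm f by rewrite mulr_ge0// supnorm_ge0.
have [s's|ss'] := leP s' s.
  rewrite mulrDr; apply: (le_trans (supnorm_dist _ (evolution t s' f) _)); apply: lerD.
    by rewrite supnorm_distC ger0_norm ?subr_ge0//; exact: lips.
  by apply: lipa => //; exact: le_trans st.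
have [s't|ts'] := leP s' t.
  rewrite mulrDr; apply: (le_trans (supnorm_dist _ (evolution t s' f) _)); apply: lerD.
    by rewrite distrC gtr0_norm ?subr_gt0//; apply: lips => //; exact: ltW.
  exact: lipa.
(* If t < s', the intermediate pair (s', t) is inadmissible. Both operators are compared with the
   identity, since (t - s) + (t' - s') is at most |s - s'| + |t - t'|. *)
apply: (le_trans (supnorm_dist _ f _)).
have h1 := lip s s t f s0 (lexx s) st tT; rewrite evolution_refl in h1.
have h2 := lip s' s' t' f s'0 (lexx s') s't' t'T; rewrite evolution_refl supnorm_distC in h2.
apply: (le_trans (lerD h1 h2)); rewrite -mulrDr ler_wpM2l//.
have a1 : s' - s <= `|s - s'| by rewrite distrC ler_norm.
have a2 : t' - t <= `|t - t'| by rewrite distrC ler_norm.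
lra.
Qed.

End Family.

(** * Slopes versus derivatives, and well-posedness *)

Lemma slope_quotient (q h : R) (f g : C) : q * h = 1 ->
  g - q%:C%C *: f = (- q)%:C%C *: (f - h%:C%C *: g).
Proof.
move=> qh; rewrite rmorphN scaleNr scalerBr opprB scalerA.
by rewrite -rmorphM qh scale1r.
Qed.

Lemma has_slope_derivative s u : (forall T, has_slope A s T u) ->
  forall t, s <= t -> has_derivative_on [set t | s <= t] u t (A t (u t)).
Proof.
move=> H t st; rewrite /has_derivative_on.
apply/cvgrPdist_le => e e0.
have [e1 ee] : exists e1 : R, e = e1%:C%C.
  exists (complex.Re e); rewrite [e in LHS]complexE (_ : complex.Im e = 0) ?mulr0 ?addr0//.
  by move: e0; rewrite ltcE => /andP[/eqP ->].
have e10 : 0 < e1 by move: e0; rewrite ee ltcR.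
have stT : s <= t <= t + 1 by rewrite st lerDl ler01.
have [h h0 K] := H (t + 1) t e1 stT e10.
have hm : 0 < Num.min h 1 by rewrite lt_min h0 ltr01.
suff : nbhs t (fun r => r != t -> s <= r ->
    `|A t (u t) - ((r - t)^-1)%:C%C *: (u r - u t)| <= e) by [].
apply/nbhs_ballP; exists (Num.min h 1) => // r tr rt sr.
have tr' : `|r - t| < Num.min h 1 by rewrite distrC.
rewrite lt_min in tr'; have /andP[rh r1] := tr'.
have rT : s <= r <= t + 1.
  by rewrite sr; move: r1; rewrite ltr_norml => /andP[_ h1]; rewrite -lerBlDl ltW.
have rt0 : r - t != 0 by rewrite subr_eq0.
rewrite ee cfun_normE lecR.
have -> : A t (u t) - ((r - t)^-1)%:C%C *: (u r - u t) =
    (- (r - t)^-1)%:C%C *: (u r - u t - (r - t)%:C%C *: A t (u t)).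
  by apply: slope_quotient; rewrite mulVf.
rewrite supnormZr normrN normfV mulrC ler_pdivrMr ?normr_gt0//.
exact: K.
Qed.

Lemma derivative_has_slope s u :
  (forall t, s <= t -> has_derivative_on [set t | s <= t] u t (A t (u t))) ->
  forall T, has_slope A s T u.
Proof.
move=> H T t e /andP[st tT] e0.
have e0C : 0 < e%:C%C :> R[i] by rewrite ltcR.
have /cvgrPdist_le/(_ _ e0C) N0 := H t st.
have {}N0 : nbhs t (fun r => r != t -> s <= r ->
    `|A t (u t) - ((r - t)^-1)%:C%C *: (u r - u t)| <= e%:C%C) by exact: N0.
have [h /= h0 K] := (nbhs_ballP (t : R) _).1 N0.
exists h => // r /andP[sr rT] rt.
have [->|rnt] := eqVneq r t.
  by rewrite !subrr scale0r subr0 supnorm0 normr0 mulr0.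
have rt0 : r - t != 0 by rewrite subr_eq0.
have bt : ball (t : R) h r by rewrite /ball /= distrC.
have := K r bt rnt sr; rewrite cfun_normE lecR => k1.
have -> : u r - u t - (r - t)%:C%C *: A t (u t) =
    (- (r - t))%:C%C *: (A t (u t) - ((r - t)^-1)%:C%C *: (u r - u t)).
  by apply: slope_quotient; rewrite mulfV.
by rewrite supnormZr normrN mulrC ler_wpM2r.
Qed.

(** The derivative A t (u t) is continuous in t, since A is norm continuous and u is continuous,
    hence bounded near t. *)
Lemma has_slope_is_solution s u : 0 <= s -> (forall T, has_slope A s T u) ->
  is_solution A s (u s) u.
Proof.
move=> s0 H; have dH := has_slope_derivative H; split => //.
exists (fun t => A t (u t)); split => //.
apply/subspace_continuousP => t st.
apply/cvgrPdist_le => e e0.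
have [e1 ee] : exists e1 : R, e = e1%:C%C.
  exists (complex.Re e); rewrite [e in LHS]complexE (_ : complex.Im e = 0) ?mulr0 ?addr0//.
  by move: e0; rewrite ltcE => /andP[/eqP ->].
have e10 : 0 < e1 by move: e0; rewrite ee ltcR.
have t0 : 0 <= t := le_trans s0 st.
have [K0 AK0] := A_bounded t0.
pose K := `|K0| + 1; have Kp : 0 < K by rewrite ltr_wpDl.
have AK f : supnorm (A t f) <= K * supnorm f.
  apply: (le_trans (AK0 f)); rewrite ler_wpM2r ?supnorm_ge0//.
  by apply: (le_trans (ler_norm _)); rewrite lerDl.
pose N := supnorm (u t) + 1; have Np : 0 < N by rewrite ltr_wpDl// supnorm_ge0.
have eN : 0 < e1 / 2 / N by rewrite !divr_gt0.
have eK : 0 < Num.min 1 (e1 / 2 / K) by rewrite lt_min ltr01 !divr_gt0.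
have [h1 h10 H1] := operator_continuous A_bounded A_continuous t0 eN.
have stT : s <= t <= t + 1 by rewrite st lerDl ler01.
have [h2 h20 H2] := has_slope_continuous (H (t + 1)) stT eK.
suff : nbhs t (fun r => s <= r -> `|A t (u t) - A r (u r)| <= e) by [].
apply/nbhs_ballP; exists (Num.min (Num.min h1 h2) 1).
  by rewrite /= !lt_min h10 h20 ltr01.
move=> r tr sr; have : `|r - t| < Num.min (Num.min h1 h2) 1 by rewrite distrC.
rewrite !lt_min => /andP[/andP[r1 r2] r3].
have rT : s <= r <= t + 1.
  by rewrite sr; move: r3; rewrite ltr_norml => /andP[_ h3]; rewrite -lerBlDl ltW.
have := H2 r rT r2; rewrite le_min => /andP[u1 u2].
have uN : supnorm (u r) <= N.
  have := supnorm_triangle (u r - u t) (u t); rewrite subrK /N; lra.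
rewrite ee cfun_normE lecR.
apply: (le_trans (supnorm_dist _ (A t (u r)) _)).
rewrite [e1]splitr; apply: lerD.
  rewrite -[A t (u t) - _]linearB; apply: (le_trans (AK _)).
  by rewrite supnorm_distC mulrC -ler_pdivlMr.
rewrite supnorm_distC; apply: (le_trans (H1 r (le_trans s0 sr) r1 _)).
by rewrite mulrAC ler_pdivrMr// ler_wpM2l// ltW// divr_gt0.
Qed.

Lemma is_solution_has_slope s us u : is_solution A s us u -> forall T, has_slope A s T u.
Proof. by move=> [_ _ H]; exact: derivative_has_slope. Qed.

Lemma evolution_well_posed : well_posed A.
Proof.
have [V HV] := global_family.
exists (evolution_map HV); split.
- by move=> s r t f s0 sr rt; exact: evolution_comp.
- by move=> t f t0; exact: evolution_refl.
- move=> f; apply/subspace_continuousP => -[s0 t0] /= [s00 st0].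
  have T0 : 0 < t0 + 1 by rewrite ltr_wpDl// (le_trans s00).
  have [L L0 HL] := evolution_lipschitz HV T0.
  apply/cvgrPdist_le => e e0.
  have [e1 ee] : exists e1 : R, e = e1%:C%C.
    exists (complex.Re e); rewrite [e in LHS]complexE (_ : complex.Im e = 0) ?mulr0 ?addr0//.
    by move: e0; rewrite ltcE => /andP[/eqP ->].
  have e10 : 0 < e1 by move: e0; rewrite ee ltcR.
  pose N := L * supnorm f + 1.
  have Np : 0 < N by rewrite ltr_wpDl// mulr_ge0// supnorm_ge0.
  suff : nbhs (s0, t0) (fun p : R * R => (0 <= p.1 /\ p.1 <= p.2) ->
    `|evolution V t0 s0 f - evolution V p.2 p.1 f| <= e) by [].
  apply/nbhs_ballP; exists (Num.min 1 (e1 / 2 / N)).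
    by rewrite /= lt_min ltr01 !divr_gt0.
  move=> [s t] /= [ss tt] [s0' st].
  have {}ss : `|s0 - s| < Num.min 1 (e1 / 2 / N) by exact: ss.
  have {}tt : `|t0 - t| < Num.min 1 (e1 / 2 / N) by exact: tt.
  move: ss tt; rewrite !lt_min => /andP[_ ss] /andP[t1 tt].
  have tT : t <= t0 + 1.
    by move: t1; rewrite ltr_norml => /andP[h1 _]; rewrite -lerBlDl; lra.
  have t0T : t0 <= t0 + 1 by rewrite lerDl.
  rewrite ee cfun_normE lecR; apply: (le_trans (HL _ _ _ _ f s00 st0 t0T s0' st tT)).
  apply: (@le_trans _ _ (N * (e1 / 2 / N + e1 / 2 / N))).
    apply: ler_pM.
    - by rewrite mulr_ge0// supnorm_ge0.
    - exact: addr_ge0.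
    - by rewrite lerDl.
    - by apply: lerD; exact: ltW.
  by rewrite -mulrDl -splitr mulrCA divff ?mulr1// gt_eqF.
- exists 1, 0; split => // s t f s0 st; rewrite mul0r expR0 !mul1r.
  exact: evolution_contraction.
(* Every initial value has a solution, so any point of the open set serves. *)
- move=> s s0 O [y Oy] _; exists y; split => //=; split.
    have := has_slope_is_solution s0 (fun T => @evolution_slope V HV s T y s0).
    by rewrite /= evolution_refl.
  move=> v sv t st; have Hv := @is_solution_has_slope s y v sv t.
  have [vs _ _] := sv.
  have := evolution_unique HV s0 Hv st (lexx t); rewrite vs => <-.
  by [].
Qed.

(** A solving family is known to solve the equation for a dense set of initial values y, and there
    it agrees with V by uniqueness. For general f both sides are approximated, U through its
    exponential bound and V through contractivity; the two errors explain the shape of [N]. *)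
Lemma solving_family_mean (U : R -> R -> {linear C -> C}) (T L : R) V s t f :
  solving_evolution_family A U -> local_family T L V ->
  0 <= s -> s <= t -> t <= T -> U t s f = V s f t.
Proof.
move=> [_ _ _ [M [w [M1 UM]]] Ud] HV s0 st tT.
have V0 g : V s g s = g by have [] := HV s g s0.
have Vs g : has_slope A s T (V s g) by have [] := HV s g s0.
apply/eqP; rewrite -subr_eq0; apply/eqP; apply: supnorm0_eq.
apply/ler_addgt0Pr => e e0; rewrite add0r.
pose N := M * expR (w * (t - s)) + 1.
have N1 : 0 <= M * expR (w * (t - s)).
  by rewrite mulr_ge0 ?expR_ge0// (le_trans ler01).
have Np : 0 < N by rewrite ltr_wpDl.
have eN : 0 < e / N by rewrite divr_gt0.
have eNC : 0 < (e / N)%:C%C :> R[i] by rewrite ltcR.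
have [|y [/interior_subset By Hy]] :=
  Ud s s0 (ball f (e / N)%:C%C)^° _ (@open_interior _ _).
  by exists f; exact: nbhsx_ballx.
have fy : supnorm (f - y) < e / N.
  by move: By; rewrite -ball_normE /= cfun_normE ltcR.
have Uy : U t s y = V s y t.
  have Hs := @is_solution_has_slope s y (fun t => U t s y) Hy.1 T.
  apply: (has_slope_unique A_generates s0 Hs (Vs y)); last by rewrite st.
  by rewrite V0; case: Hy.1.
apply: (le_trans (supnorm_dist _ (U t s y) _)).
have -> : e = M * expR (w * (t - s)) * (e / N) + e / N.
  by rewrite -[X in _ + X]mul1r -mulrDl mulrCA divff ?mulr1// gt_eqF.
apply: lerD.
  rewrite -[U t s f - _]linearB; apply: (le_trans (UM s t _ s0 st)).
  by rewrite ler_wpM2l// ltW.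
rewrite Uy; apply: le_trans (ltW fy); rewrite [leRHS]supnorm_distC.
have := has_slope_contraction A_generates s0 st
  (has_slope_sub (lexx s) tT (has_slopeB (Vs y) (Vs f))).
by rewrite !V0.
Qed.

End Evolution.

Theorem theorem4p6 (R : realType) (E : compactSpaceType) (polishE : polish R E)
    (A : R -> {linear cfun R E -> cfun R E})
    (A_bounded : forall t, 0 <= t -> bounded_operator (A t))
    (A_continuous : opnorm_continuous A)
    (A_generates : forall t, 0 <= t ->
      generates_positive_contraction_semigroup (A t)) :
  well_posed A /\
  forall U : R -> R -> {linear cfun R E -> cfun R E},
    solving_evolution_family A U ->
    forall T : R, 0 < T ->
      exists (d : measure_display) (Om : measurableType d)
        (X : R -> Om -> with_cemetery E)
        (P : R -> with_cemetery E -> probability Om R),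
        hunt_process T X P /\
        forall (f : cfun R E) (x : E) (s t : R),
          0 <= s -> s <= t -> t <= T ->
          (U t s f : cfun R E) x = cexpect X P t (Some x) f s.
Proof.
split; first exact: evolution_well_posed.
move=> U HU T T0.
(* The process is built independently of U; the formula holds because every solving family must
   coincide with the mean values. *)
have [X [P [hunt [L [V [_ HV VE]]]]]] :=
  local_process polishE A_bounded A_continuous A_generates T0.
exists _, (path_space R (borel_space (one_point_compactification E))), X, P.
split => // f x s t s0 st tT.
have UV := solving_family_mean A_generates f HU HV s0 st tT.
by transitivity (cfun_fun (V s f t) x); [rewrite -UV|exact: VE].
Qed.
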